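(* Let $H\neq\{0\}$ be a complex Hilbert space with norm $|\cdot|$ and inner product $(\cdot\,|\,\cdot)$, and let $A$ be an operator in $H$ with domain $D(A)$ such that $-A$ generates a uniformly bounded, holomorphic $C_0$-semigroup $e^{-tA}$ in $H$ (in the sense of the context: $A$ is densely defined and closed and satisfies, for some $\delta\in\,]0,\frac{\pi}{2}[$ and $C>0$, the stated resolvent estimate on $\{0\}\cup\Sigma_{\delta+\pi/2}$). Then the following properties are equivalent: (I) $2\big(\operatorname{Re}(Ax\,|\,x)\big)^2\le \operatorname{Re}(A^2x\,|\,x)\,|x|^2+|Ax|^2|x|^2$ for every $x\in D(A^2)$. (II) For every $u_0\in H$ with $u_0\ne0$, the function $h(t)=|e^{-tA}u_0|$ is log-convex; that is, whenever $0\le r<s<t$, $$\big|e^{-sA}u_0\big| \le \big|e^{-rA}u_0\big|^{\frac{t-s}{t-r}}\,\big|e^{-tA}u_0\big|^{\frac{s-r}{t-r}}.$$ Moreover, if (I) and (II) hold, then: (a) for every $u_0\ne0$ the function $h(t)=|e^{-tA}u_0|$ is strictly positive, strictly decreasing and strictly convex on the closed half-line $[0,\infty[$, and it is differentiable from the right at $t=0$ in the extended sense, with a derivative $h'(0)=\lim_{t\to0^+}\frac{h(t)-h(0)}{t}\in[-\infty,0[$; (b) if $|u_0|=1$, then $h'(0)=\inf_{t>0}h'(t)\le -m(A)<0$; (c) if $u_0\in D(A)$ and $|u_0|=1$, then $h\in C^1([0,\infty[,\mathbb{R})\cap C^\infty(]0,\infty[,\mathbb{R})$ and $h'(0)=-\operatorname{Re}(Au_0\,|\,u_0)$;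 (d) $\underline{\sigma}(A)=m(A)>0$; in particular $A$ is strictly accretive.
   Context: For $\theta>0$ write $\Sigma_\theta=\{z\in\mathbb{C}\mid -\theta<\arg z<\theta\}$ (an open sector, $0\notin\Sigma_\theta$). Meaning of ''$-A$ generates a uniformly bounded, holomorphic $C_0$-semigroup'': $A$ is a densely defined, closed operator in $H$ for which there are $\delta\in\,]0,\frac{\pi}{2}[$ and $C>0$ such that for all $\lambda\in\{0\}\cup\Sigma_{\delta+\pi/2}$ the operator $A+\lambda I$ is a bijection $D(A)\to H$ with bounded inverse and $|\lambda|\,\|(A+\lambda I)^{-1}\|\le C$ (for $\lambda=0$ this just says that $0$ is in the resolvent set of $A$). Then $-A$ generates a $C_0$-semigroup $e^{-tA}$, $t\ge0$, in $\mathbb{B}(H)$, uniformly bounded ($\|e^{-tA}\|\le M$ for $t\ge 0$), which extends holomorphically to $\Sigma_\delta$. $D(A^2)=\{x\in D(A)\mid Ax\in D(A)\}$. The numerical range of $A$ is $\nu(A)=\{(Ax\,|\,x)\mid x\in D(A),\ |x|=1\}$ and its lower bound is $m(A)=\inf\operatorname{Re}\nu(A)$. The operator $A$ is called strictly accretive if $m(A)>0$. The spectral abscissa of $A$ is $\underline{\sigma}(A)=\inf\operatorname{Re}\sigma(A)$, where $\sigma(A)$ is the spectrum of $A$. In (c), $C^1$ on $[0,\infty[$ is understood with the one-sided derivative at $t=0$. *)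

(* Defs.v *)
From Stdlib Require Export Reals.
From Coquelicot Require Export Coquelicot.
Open Scope R_scope.

(** Complex Hilbert spaces: [CompleteNormedModule C_AbsRing] provides the vector
    space, the norm and completeness; positive definiteness of the inner product
    comes from [inner_norm]. *)
Record HilbertSpace := {
  Hcarrier :> CompleteNormedModule C_AbsRing;
  inner : Hcarrier -> Hcarrier -> C;
  inner_plus : forall x y z : Hcarrier,
    inner (plus x y) z = Cplus (inner x z) (inner y z);
  inner_scal : forall (a : C) (x y : Hcarrier),
    inner (scal a x) y = Cmult a (inner x y);
  inner_conj : forall x y : Hcarrier, inner y x = Cconj (inner x y);
  inner_norm : forall x : Hcarrier, inner x x = RtoC (norm x ^ 2) }.

Arguments inner {_} _ _.

(** Linear operators [D(A) -> H]. The map is total on [H] for convenience; its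
    values outside [dom] carry no meaning and are never used. *)
Record operator (H : HilbertSpace) := {
  dom : H -> Prop;
  op :> H -> H;
  dom_zero : dom zero;
  dom_plus : forall x y : H, dom x -> dom y -> dom (plus x y);
  dom_scal : forall (a : C) (x : H), dom x -> dom (scal a x);
  op_plus : forall x y : H,
    dom x -> dom y -> op (plus x y) = plus (op x) (op y);
  op_scal : forall (a : C) (x : H), dom x -> op (scal a x) = scal a (op x) }.

Arguments dom {H} _ _.
Arguments op {H} _ _.

Definition densely_defined {H : HilbertSpace} (A : operator H) : Prop :=
  forall (x : H) (eps : R), 0 < eps ->
    exists y : H, dom A y /\ norm (minus x y) < eps.

Definition closed_operator {H : HilbertSpace} (A : operator H) : Prop :=
  closed (fun p : H * H => dom A (fst p) /\ snd p = A (fst p)).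

(** [A + lam I] is a bijection [D(A) -> H] whose inverse [Q] is bounded
    (boundedness is part of Coquelicot's [is_linear]). *)
Definition bounded_inverse {H : HilbertSpace} (A : operator H) (lam : C)
    (Q : H -> H) : Prop :=
  is_linear Q /\
  (forall y : H, dom A (Q y) /\ plus (A (Q y)) (scal lam (Q y)) = y) /\
  (forall x : H, dom A x -> Q (plus (A x) (scal lam x)) = x).

Definition resolvent_set {H : HilbertSpace} (A : operator H) (z : C) : Prop :=
  exists Q : H -> H, bounded_inverse A (Copp z) Q.

Definition spectrum {H : HilbertSpace} (A : operator H) (z : C) : Prop :=
  ~ resolvent_set A z.

(** The infima are taken in [Rbar]: [nu(A)] may be unbounded below and nothing
    is assumed about [sigma(A)] being nonempty. *)
Definition inf_Re (S : C -> Prop) : Rbar :=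
  Glb_Rbar (fun r => exists z : C, S z /\ r = Re z).

Definition spectral_abscissa {H : HilbertSpace} (A : operator H) : Rbar :=
  inf_Re (spectrum A).

Definition numerical_range {H : HilbertSpace} (A : operator H) (z : C) : Prop :=
  exists x : H, dom A x /\ norm x = 1 /\ z = inner (A x) x.

Definition lower_bound {H : HilbertSpace} (A : operator H) : Rbar :=
  inf_Re (numerical_range A).

Definition strictly_accretive {H : HilbertSpace} (A : operator H) : Prop :=
  Rbar_lt (Finite 0) (lower_bound A).

(** The open sector [-theta < arg z < theta], in polar form (for
    [theta <= PI] this is the sector given by the principal argument). *)
Definition sector (theta : R) (z : C) : Prop :=
  exists r phi : R, 0 < r /\ - theta < phi < theta /\
    z = (r * cos phi, r * sin phi).

(** [|lam| ||(A + lam I)^{-1}|| <= K] is written pointwise. *)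
Definition generates_bounded_holomorphic {H : HilbertSpace} (A : operator H) :
    Prop :=
  densely_defined A /\ closed_operator A /\
  exists delta K : R, 0 < delta < PI / 2 /\ 0 < K /\
    forall lam : C, lam = RtoC 0 \/ sector (delta + PI / 2) lam ->
      exists Q : H -> H, bounded_inverse A lam Q /\
        forall y : H, Cmod lam * norm (Q y) <= K * norm y.

(** Only the values [T t] with [0 <= t] are meaningful. *)
Record C0_semigroup {H : HilbertSpace} (T : R -> H -> H) : Prop := {
  C0_bounded : forall t : R, 0 <= t -> is_linear (T t);
  C0_zero : forall x : H, T 0 x = x;
  C0_plus : forall (s t : R) (x : H),
    0 <= s -> 0 <= t -> T (s + t) x = T s (T t x);
  C0_continuous : forall x : H,
    filterlim (fun t => T t x) (at_right 0) (locally x) }.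

(** [- A] is the infinitesimal generator of [T], i.e. [T t] is [exp (- t A)];
    the domain of the generator consists of all [x] for which the limit exists. *)
Definition generated_by_opp {H : HilbertSpace} (A : operator H)
    (T : R -> H -> H) : Prop :=
  forall x y : H,
    filterlim (fun t => scal (RtoC (/ t)) (minus (T t x) x))
      (at_right 0) (locally y)
    <-> dom A x /\ y = opp (A x).

(** Real power of a base [x >= 0] with exponent [a > 0]: [Rpower 0 a] is [1]
    in the standard library, whereas [0 ^ a = 0] is needed here. *)
Definition rpow (x a : R) : R := if Req_EM_T x 0 then 0 else Rpower x a.

(** For the predicates below only the values [h t] with [0 <= t] matter. *)

Definition log_convex (h : R -> R) : Prop :=
  forall r s t : R, 0 <= r -> r < s -> s < t ->
    h s <= rpow (h r) ((t - s) / (t - r)) * rpow (h t) ((s - r) / (t - r)).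

Definition strictly_positive (h : R -> R) : Prop :=
  forall t : R, 0 <= t -> 0 < h t.

Definition strictly_decreasing (h : R -> R) : Prop :=
  forall s t : R, 0 <= s -> s < t -> h t < h s.

Definition strictly_convex (h : R -> R) : Prop :=
  forall s t a : R, 0 <= s -> 0 <= t -> s <> t -> 0 < a < 1 ->
    h (a * s + (1 - a) * t) < a * h s + (1 - a) * h t.

Definition right_derivative0 (h : R -> R) (d : Rbar) : Prop :=
  filterlim (fun t => (h t - h 0) / t) (at_right 0) (Rbar_locally d).

(** [h] is [C^1] on [0 <= t], one-sidedly at [0], with derivative [dh]. *)
Definition C1_with (h dh : R -> R) : Prop :=
  (forall t : R, 0 < t -> is_derive h t (dh t)) /\
  right_derivative0 h (Finite (dh 0)) /\
  (forall t : R, 0 <= t ->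
     filterlim dh (within (fun s => 0 <= s) (locally t)) (locally (dh t))).

Definition smooth_pos (h : R -> R) : Prop :=
  forall (n : nat) (t : R), 0 < t -> ex_derive_n h n t.

(* Main.v *)
Require Import Defs.
From Stdlib Require Import Reals Lra Lia Classical ClassicalEpsilon ssreflect.
From Coquelicot Require Import Coquelicot.
Open Scope R_scope.

(* (I) says that f = |e^{-tA}x|^2 satisfies f'^2 <= f f'' along orbits in D(A^2), i.e. that
   every tilt e^{kt} f is convex. Tilted convexity is preserved by limits and is equivalent
   to log-convexity, so it extends from the dense set D(A^2) to H; conversely it is read off
   at t = 0.

   For the rest one needs smoothing and decay of the semigroup from resolvent bounds alone.
   With J = l R(l), l > 0, the discrete Cauchy estimate comes from circle means of
   z^-j F(z)^m, F(z) = l R(l(1 - z)): the second power has an integrable bound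
   K^2/|1 - z|^2 whose mean is a Poisson integral, which gives |J^k| <= C and, with one more
   power, k |J^k(1 - J)| <= C, uniformly in l. The exponential formula e^{-tA} = lim (1 + tA/n)^-n
   turns these into |A e^{-tA}| <= C/t and, after a shift of A, into |e^{-tA}| <= C e^{-mu t}
   for every mu below the spectral abscissa. By log-convexity an orbit decays no faster
   than its initial rate Re(Ax|x), hence Re(Ax|x) >= mu and m(A) >= sigma(A); the converse
   inequality and everything in (a)-(c) follow from accretivity and convexity. *)

(** * Hilbert space preliminaries *)

(** [T] is known only through its generator, so every bound on [T t] has to be proved for the powers
    [(1 + h A)^-n], uniformly in [h] and [n], before passing to the limit. The power of [F] is
    dictated by counting. The [k]-th coefficient of [F^m] carries a factor of order [k^(m-1)], while
    the circle mean of [|1-z|^-2] at radius about [1 - 1/k] is of order [k]. With [m = 1] the mean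
    of [1/|1-z|] would leave a logarithm of [k]; with [m = 2] the two orders cancel exactly. With
    [m = 3] the third singular factor is removed by [1 - J], and the spare power of [k] becomes the
    decay [1/k]. Coefficients are tested against themselves in the inner product, so only real
    integrals of real parts occur, and functional relations such as [F z = J + z F z J] replace
    power series. Tilts are used because an orbit is not known in advance to be free of zeros: that
    [e^{-tA}u] never vanishes is a consequence of log-convexity, so logarithms cannot be taken
    beforehand. *)

Definition rin {H : HilbertSpace} (x y : H) : R := Re (inner x y).

Lemma RtoC_neq_0 (r : R) : r <> 0 -> RtoC r <> RtoC 0.
Proof. by move=> h /RtoC_inj. Qed.

Section HilbertBasics.
Context {H : HilbertSpace}.
Implicit Types x y z v : H.

Lemma inner_plus_r x y z : inner x (plus y z) = Cplus (inner x y) (inner x z).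
Proof.
by rewrite inner_conj inner_plus (inner_conj _ x y) (inner_conj _ x z) /Cconj /Cplus /=;
  f_equal; ring.
Qed.

Lemma inner_scal_r a x y : inner x (scal a y) = Cmult (Cconj a) (inner x y).
Proof.
by rewrite inner_conj inner_scal (inner_conj _ x y) /Cconj /Cmult /=; f_equal; ring.
Qed.

Lemma inner_zero_l x : inner zero x = RtoC 0.
Proof.
have -> : (zero : H) = scal (RtoC 0) (zero : H) by rewrite scal_zero_r.
by rewrite inner_scal; ring.
Qed.

Lemma inner_opp_l x y : inner (opp x) y = Copp (inner x y).
Proof. by rewrite -(scal_opp_one x) inner_scal /opp /one /=; ring. Qed.

Lemma inner_opp_r x y : inner x (opp y) = Copp (inner x y).
Proof. by rewrite -(scal_opp_one y) inner_scal_r /opp /one /= /Cconj /Copp /Cmult /=; f_equal; ring. Qed.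

Lemma inner_ext x y : (forall v, inner x v = inner y v) -> x = y.
Proof.
move=> E.
have Z : inner (minus x y) (minus x y) = RtoC 0.
  by rewrite {1}/minus inner_plus inner_opp_l E; ring.
rewrite inner_norm in Z.
have N : norm (minus x y) ^ 2 = 0 by move: Z => [].
have {}N : norm (minus x y) = 0 by nra.
move: (norm_eq_zero _ N) => M.
rewrite -(plus_zero_r y) -M /minus plus_comm -plus_assoc plus_opp_l plus_zero_r //.
Qed.

Lemma scal_cancel (c : C) x y : c <> RtoC 0 -> scal c x = scal c y -> x = y.
Proof.
move=> hc E; apply inner_ext => v.
have : Cmult (/ c)%C (inner (scal c x) v) = Cmult (/ c)%C (inner (scal c y) v) by rewrite E.
by rewrite !inner_scal !Cmult_assoc Cinv_l // !Cmult_1_l.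
Qed.

Lemma rin_sym x y : rin y x = rin x y.
Proof. by rewrite /rin inner_conj. Qed.

Lemma rin_norm x : rin x x = norm x ^ 2.
Proof. by rewrite /rin inner_norm. Qed.

Lemma rin_plus_l x y z : rin (plus x y) z = rin x z + rin y z.
Proof. by rewrite /rin inner_plus. Qed.
Lemma rin_plus_r x y z : rin x (plus y z) = rin x y + rin x z.
Proof. by rewrite /rin inner_plus_r. Qed.
Lemma rin_opp_l x y : rin (opp x) y = - rin x y.
Proof. by rewrite /rin inner_opp_l. Qed.
Lemma rin_opp_r x y : rin x (opp y) = - rin x y.
Proof. by rewrite /rin inner_opp_r. Qed.
Lemma rin_minus_l x y z : rin (minus x y) z = rin x z - rin y z.
Proof. by rewrite /minus rin_plus_l rin_opp_l. Qed.
Lemma rin_minus_r x y z : rin x (minus y z) = rin x y - rin x z.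
Proof. by rewrite /minus rin_plus_r rin_opp_r. Qed.
Lemma rin_scal_l (a : R) x y : rin (scal (RtoC a) x) y = a * rin x y.
Proof. by rewrite /rin inner_scal /Cmult /Re /=; ring. Qed.
Lemma rin_scal_r (a : R) x y : rin x (scal (RtoC a) y) = a * rin x y.
Proof. by rewrite rin_sym rin_scal_l rin_sym. Qed.
Lemma rin_zero_l x : rin zero x = 0.
Proof. by rewrite /rin inner_zero_l. Qed.

Lemma norm_scalC (a : C) x : norm (scal a x) = Cmod a * norm x.
Proof.
have E : norm (scal a x) ^ 2 = (Cmod a * norm x) ^ 2.
  rewrite -rin_norm /rin inner_scal inner_scal_r inner_norm.
  have -> : (Cmod a * norm x) ^ 2 = Cmod a ^ 2 * norm x ^ 2 by ring.
  rewrite Cmod2_alt /Cmult /Cconj /Re /Im /=; ring.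
move: (norm_ge_0 (scal a x)) (norm_ge_0 x) (Cmod_ge_0 a) => h1 h2 h3.
have h4 : 0 <= Cmod a * norm x by apply Rmult_le_pos.
nra.
Qed.

Lemma norm_scalR (a : R) x : norm (scal (RtoC a) x) = Rabs a * norm x.
Proof. by rewrite norm_scalC Cmod_R. Qed.

Lemma norm_eq_0 x : norm x = 0 -> x = zero.
Proof. move=> h; exact: (norm_eq_zero x h). Qed.

Lemma rin_le x y : rin x y <= norm x * norm y.
Proof.
move: (norm_ge_0 x) (norm_ge_0 y) => hx hy.
(* This square expands to [2 |x| |y| (|x| |y| - Re(x|y))]. *)
have P : 0 <= norm (minus (scal (RtoC (norm y)) x) (scal (RtoC (norm x)) y)) ^ 2 by apply pow2_ge_0.
rewrite -rin_norm !(rin_minus_l, rin_minus_r, rin_scal_l, rin_scal_r) !rin_norm (rin_sym x y) in P.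
case: (Req_dec (norm x) 0) => [z|n].
  have -> : x = zero by apply norm_eq_0.
  by rewrite rin_zero_l norm_zero; lra.
case: (Req_dec (norm y) 0) => [z|n'].
  have -> : y = zero by apply norm_eq_0.
  by rewrite rin_sym rin_zero_l norm_zero; lra.
have Q : 0 < norm x * norm y by nra.
nra.
Qed.

Lemma rin_abs_le x y : Rabs (rin x y) <= norm x * norm y.
Proof.
apply Rabs_le; split; last exact: rin_le.
move: (rin_le (opp x) y); rewrite rin_opp_l norm_opp; lra.
Qed.

(** Take [y := x]. Vector estimates are thereby reduced to scalar functions, to which the mean value
    theorem applies. *)
Lemma norm_le_rin x (B : R) : 0 <= B -> (forall y, rin x y <= B * norm y) -> norm x <= B.
Proof.
move=> hB h; move: (h x) (norm_ge_0 x); rewrite rin_norm => h1 h2.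
case: (Req_dec (norm x) 0) => [->|n] //; nra.
Qed.

Lemma norm_plus_le x y : norm (plus x y) <= norm x + norm y.
Proof. exact: norm_triangle. Qed.

Lemma norm_minus_sym x y : norm (minus x y) = norm (minus y x).
Proof. by rewrite -norm_opp opp_minus. Qed.

Lemma norm_triangle3 x y z : norm (minus x z) <= norm (minus x y) + norm (minus y z).
Proof. rewrite (minus_trans y x z); exact: norm_triangle. Qed.

Lemma norm_minus_le x y : norm x <= norm y + norm (minus x y).
Proof.
have {1}-> : x = plus y (minus x y).
  rewrite /minus (plus_comm x) plus_assoc plus_opp_r plus_zero_l //.
exact: norm_triangle.
Qed.

Lemma norm_minus_small_eq x y : (forall eps, 0 < eps -> norm (minus x y) < eps) -> x = y.
Proof.
move=> h; apply inner_ext.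
have N : norm (minus x y) = 0.
  move: (norm_ge_0 (minus x y)) => p.
  case: (Req_dec (norm (minus x y)) 0) => // n.
  by move: (h (norm (minus x y)) ltac:(lra)); lra.
move: (norm_eq_zero _ N) => M v.
have -> : x = plus (minus x y) y by rewrite /minus -plus_assoc plus_opp_l plus_zero_r.
by rewrite M plus_zero_l.
Qed.

Lemma hilbert_complete (u : nat -> H) :
  (forall eps, 0 < eps -> exists N, forall n m, (N <= n)%nat -> (N <= m)%nat ->
     norm (minus (u n) (u m)) < eps) ->
  exists l : H, forall eps, 0 < eps -> exists N, forall n, (N <= n)%nat ->
     norm (minus (u n) l) < eps.
Proof.
move=> hC.
have FF : ProperFilter (filtermap u eventually).
  apply filtermap_proper_filter; apply eventually_filter.
have Cc : cauchy (filtermap u eventually).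
  move=> eps; case: (hC eps (cond_pos eps)) => N hN.
  exists (u N); exists N => n hn; exact: (norm_compat1 (u N) (u n) eps (hN _ _ hn (Nat.le_refl _))).
exists (lim (filtermap u eventually)) => eps heps.
have nf := @norm_factor_gt_0 _ H.
have e' : 0 < eps / @norm_factor _ H by apply Rdiv_lt_0_compat.
case: (complete_cauchy _ FF Cc (mkposreal _ e')) => N hN.
exists N => n hn.
move: (norm_compat2 (lim (filtermap u eventually)) (u n) (mkposreal _ e') (hN n hn)) => /=.
set c := @norm_factor _ _; have c0 : c <> 0 by apply Rgt_not_eq.
by have -> : c * (eps / c) = eps by field.
Qed.

Lemma geometric_cauchy (u : nat -> H) (D : R) :
  0 <= D -> (forall n, norm (minus (u (S n)) (u n)) <= D * (/ 2) ^ n) ->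
  exists l : H, (forall eps, 0 < eps -> exists N, forall n, (N <= n)%nat ->
     norm (minus (u n) l) < eps) /\
     (forall n, norm (minus l (u n)) <= 2 * D * (/2) ^ n).
Proof.
move=> hD h.
(* The exact partial geometric sum is kept, since the cruder bound [P'] does not reproduce itself
   under induction on [k]. *)
have P : forall k n, norm (minus (u (n + k)%nat) (u n)) <= 2 * D * (/2) ^ n * (1 - (/2)^k).
  elim=> [|k IH] n.
    rewrite Nat.add_0_r /minus plus_opp_r norm_zero /=; lra.
  rewrite Nat.add_succ_r.
  move: (norm_triangle3 (u (S (n + k))) (u (n + k)%nat) (u n)) (h (n+k)%nat) (IH n).
  rewrite pow_add /=.
  have := pow_lt (/2) n ltac:(lra); have := pow_lt (/2) k ltac:(lra).
  move: ((/2)^n) ((/2)^k) => p q *; nra.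
have P' : forall k n, norm (minus (u (n + k)%nat) (u n)) <= 2 * D * (/2) ^ n.
  move=> k n; move: (P k n).
  have := pow_lt (/2) n ltac:(lra); have := pow_lt (/2) k ltac:(lra).
  move: ((/2)^n) ((/2)^k) => p q hp hq h0.
  have : 0 <= 2 * D * p * q by repeat apply Rmult_le_pos; lra.
  nra.
case: (hilbert_complete u).
  move=> eps he.
  have [N hN] : exists N, forall n, (N <= n)%nat -> Rabs ((/2)^n) < eps / (4 * D + 1).
    apply pow_lt_1_zero; last by apply Rdiv_lt_0_compat; lra.
    rewrite Rabs_pos_eq; lra.
  exists N => n m hn hm.
  move: (hN N (Nat.le_refl _)); rewrite Rabs_pos_eq; last by apply pow_le; lra.
  move=> /(Rmult_lt_compat_r (4 * D + 1) _ _ ltac:(lra)).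
  rewrite /Rdiv Rmult_assoc Rinv_l; last lra.
  move: (P' (n - N)%nat N) (P' (m - N)%nat N).
  have -> : (N + (n - N))%nat = n by lia.
  have -> : (N + (m - N))%nat = m by lia.
  move: (norm_triangle3 (u n) (u N) (u m)); rewrite (norm_minus_sym (u N)).
  have := pow_lt (/2) N ltac:(lra); nra.
move=> l hl; exists l; split=> // n.
apply Rnot_lt_le => hlt.
case: (hl _ (proj2 (Rlt_0_minus _ _) hlt)) => N hN.
move: (hN (n + N)%nat ltac:(lia)) (P' N n) (norm_triangle3 l (u (n + N)%nat) (u n)).
rewrite (norm_minus_sym l (u (n + N)%nat)); lra.
Qed.

End HilbertBasics.

Ltac hinner :=
  rewrite /minus ?(inner_plus, inner_scal, inner_opp_l, inner_zero_l, RtoC_plus, RtoC_minus, RtoC_mult, RtoC_opp).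
Ltac hvec := apply inner_ext; intro; hinner; ring.

(** * Local boundedness and strong continuity *)

Lemma at_right_0 (P : R -> Prop) :
  at_right 0 P <-> exists d, 0 < d /\ forall t, 0 < t < d -> P t.
Proof.
split.
  case=> d h; exists d; split; first exact: cond_pos.
  move=> t ht; apply h; last lra.
  rewrite /ball /= /AbsRing_ball /abs /minus /plus /opp /= Ropp_0 Rplus_0_r Rabs_pos_eq; lra.
case=> d [hd h]; exists (mkposreal d hd) => t.
rewrite /ball /= /AbsRing_ball /abs /minus /plus /opp /= Ropp_0 Rplus_0_r => h1 h2.
apply h; split=> //; move: (Rle_abs t); lra.
Qed.

Lemma filterlim_at_right_0 {H : HilbertSpace} (f : R -> H) (y : H) :
  filterlim f (at_right 0) (locally y) <->
  forall eps, 0 < eps -> exists d, 0 < d /\ forall t, 0 < t < d -> norm (minus (f t) y) < eps.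
Proof.
split.
  move=> /filterlim_locally_ball_norm h eps he.
  by move: (h (mkposreal eps he)) => /at_right_0.
move=> h; apply filterlim_locally => eps; apply at_right_0.
case: (h eps (cond_pos eps)) => d [hd hh]; exists d; split=> // t ht.
exact: (norm_compat1 y (f t) eps (hh t ht)).
Qed.

Lemma filterlim_at_right_0_R (f : R -> R) (y : R) :
  filterlim f (at_right 0) (locally y) <->
  forall eps, 0 < eps -> exists d, 0 < d /\ forall t, 0 < t < d -> Rabs (f t - y) < eps.
Proof.
split.
  move=> /filterlim_locally h eps he.
  by move: (h (mkposreal eps he)) => /at_right_0.
move=> h; apply filterlim_locally => eps; apply at_right_0.
exact: (h eps (cond_pos eps)).
Qed.

Section LocalBound.
Context {H : HilbertSpace} {T : R -> H -> H} (T_C0 : C0_semigroup T).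

Lemma T_plus t x y : 0 <= t -> T t (plus x y) = plus (T t x) (T t y).
Proof. by move=> ht; apply (linear_plus _ (C0_bounded _ T_C0 t ht)). Qed.

Lemma T_scal t a x : 0 <= t -> T t (scal a x) = scal a (T t x).
Proof. by move=> ht; apply (linear_scal _ (C0_bounded _ T_C0 t ht)). Qed.

Lemma T_opp t x : 0 <= t -> T t (opp x) = opp (T t x).
Proof. by move=> ht; rewrite -(scal_opp_one x) T_scal // scal_opp_one. Qed.

Lemma T_minus t x y : 0 <= t -> T t (minus x y) = minus (T t x) (T t y).
Proof. by move=> ht; rewrite /minus T_plus // T_opp. Qed.

Lemma T_add s t x : 0 <= s -> 0 <= t -> T (s + t) x = T s (T t x).
Proof. exact: (C0_plus _ T_C0). Qed.

Lemma T_right_cont x eps : 0 < eps ->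
  exists d, 0 < d /\ forall t, 0 <= t < d -> norm (minus (T t x) x) < eps.
Proof.
move=> he; have /filterlim_at_right_0 h := C0_continuous _ T_C0 x.
case: (h _ he) => d [hd hh]; exists d; split=> // t ht.
case: (Req_dec t 0) => [->|n]; last by apply hh; lra.
by rewrite (C0_zero _ T_C0) /minus plus_opp_r norm_zero.
Qed.

(* Baire category: otherwise nested closed balls produce a vector whose orbit is unbounded near 0. *)
Lemma T_bounded_on_ball : exists (N : nat) (x0 : H) (r : R), 0 < r /\
  forall t y, 0 <= t <= / (INR N + 1) -> norm (minus y x0) <= r -> norm (T t y) <= INR N.
Proof.
apply NNPP => hno.
(* Failure of the claim on the ball of radius [r / 4] provides [y] and [t]. Boundedness of this
   single [T t] keeps the norm above [N] on a small closed ball around [y]. The factors [1/4] make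
   the balls nested. *)
have esc : forall (N : nat) (p : H * posreal), exists q : H * posreal,
    norm (minus (fst q) (fst p)) <= snd p / 4 /\ snd q <= snd p / 4 /\
    exists t, 0 <= t <= / (INR N + 1) /\
      forall z, norm (minus z (fst q)) <= snd q -> INR N < norm (T t z).
  move=> N [x r] /=.
  have hr := cond_pos r.
  have [y [t [ht [hy hT]]]] : exists y t, 0 <= t <= / (INR N + 1) /\
      norm (minus y x) <= r / 4 /\ INR N < norm (T t y).
    apply NNPP => hn; apply hno; exists N, x, (r / 4); split; first lra.
    move=> t y ht hy; apply Rnot_lt_le => hlt; apply hn; by exists y, t.
  case: (linear_norm _ (C0_bounded _ T_C0 t (proj1 ht))) => M [hM hMb].
  have hd : 0 < (norm (T t y) - INR N) / (2 * M) by apply Rdiv_lt_0_compat; lra.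
  have hm : 0 < Rmin (r / 4) ((norm (T t y) - INR N) / (2 * M)) by apply Rmin_pos; lra.
  exists (y, mkposreal _ hm) => /=; split=> //; split; first exact: Rmin_l.
  exists t; split=> // z hz.
  have h1 : norm (minus z y) <= (norm (T t y) - INR N) / (2 * M)
    by apply (Rle_trans _ _ _ hz), Rmin_r.
  have := norm_minus_le (T t y) (T t z).
  rewrite -T_minus ?norm_minus_sym; last lra.
  have h2 := hMb (minus y z).
  rewrite (norm_minus_sym y z) in h2.
  have h3 : M * norm (minus z y) <= (norm (T t y) - INR N) / 2.
    apply (Rle_trans _ (M * ((norm (T t y) - INR N) / (2 * M)))).
      apply Rmult_le_compat_l; lra.
    right; field; lra.
  lra.
pose nx N p := proj1_sig (constructive_indefinite_description _ (esc N p)).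
have nxP N p := proj2_sig (constructive_indefinite_description _ (esc N p)).
pose s := fix s (n : nat) : H * posreal :=
  match n with O => ((zero : H), mkposreal 1 Rlt_0_1) | S k => nx k (s k) end.
have sS n : s (S n) = nx n (s n) by [].
have step n : norm (minus (fst (s (S n))) (fst (s n))) <= snd (s n) / 4.
  rewrite sS; by case: (nxP n (s n)).
have rad n : snd (s (S n)) <= snd (s n) / 4.
  rewrite sS; by case: (nxP n (s n)) => _ [].
have small n : snd (s n) <= (/2)^n.
  elim: n => [|n IH]; first by rewrite /=; lra.
  move: (rad n) (cond_pos (snd (s n))); rewrite -[(/2)^(S n)]/((/2) * (/2)^n); lra.
case: (geometric_cauchy (fun n => fst (s n)) 1 ltac:(lra)) => [n|l [hl _]].
  move: (step n) (small n) (cond_pos (snd (s n))); lra.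
have tel n k : norm (minus (fst (s (n + k)%nat)) (fst (s n))) <= snd (s n) - snd (s (n + k)%nat).
  elim: k => [|k IH].
    rewrite Nat.add_0_r /minus plus_opp_r norm_zero; lra.
  rewrite Nat.add_succ_r.
  move: (norm_triangle3 (fst (s (S (n + k)))) (fst (s (n + k)%nat)) (fst (s n))).
  move: (step (n + k)%nat) (rad (n + k)%nat) (cond_pos (snd (s (n + k)%nat))); lra.
have inball n : norm (minus l (fst (s n))) <= snd (s n).
  apply Rnot_lt_le => hlt.
  case: (hl _ (proj2 (Rlt_0_minus _ _) hlt)) => N hN.
  move: (hN (n + N)%nat ltac:(lia)) (tel n N) (cond_pos (snd (s (n + N)%nat))).
  move: (norm_triangle3 l (fst (s (n + N)%nat)) (fst (s n))).
  rewrite (norm_minus_sym l (fst (s (n + N)%nat))); lra.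
(* The common point [l] of the balls satisfies [norm (T t l) > N] for some [t <= / (N + 1)], for
   every [N]; strong continuity at [0] bounds these norms by [norm l + 1] once [t < d]. *)
case: (T_right_cont l 1 Rlt_0_1) => d [hd hdb].
case: (INR_unbounded (/ d + norm l + 1)) => N hN.
have hid : 0 < / d by apply Rinv_0_lt_compat.
case: (nxP N (s N)) => _ [_ [t [ht hz]]].
have := hz l (inball (S N)).
have ht2 : t < d.
  apply (Rle_lt_trans _ _ _ (proj2 ht)).
  rewrite -(Rinv_inv d); apply Rinv_lt_contravar; move: (norm_ge_0 l); last lra.
  move=> ?; apply Rmult_lt_0_compat; lra.
move: (hdb t (conj (proj1 ht) ht2)) (norm_minus_le (T t l) l) => ? ? ?; lra.
Qed.

(** A bound on one ball around [x0] moves to the origin by [T v = T (x0 + v) - T x0] and then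
    scales; this gives [2 N / r]. *)
Lemma T_bounded_near_0 : exists d M, 0 < d /\ 1 <= M /\
  forall t x, 0 <= t <= d -> norm (T t x) <= M * norm x.
Proof.
case: T_bounded_on_ball => N [x0 [r [hr hb]]].
have hN := pos_INR N.
exists (/ (INR N + 1)), (2 * INR N / r + 1); split; first by apply Rinv_0_lt_compat; lra.
have hq : 0 <= 2 * INR N / r by apply Rdiv_le_0_compat; lra.
split; first lra.
move=> t v ht.
case: (Req_dec (norm v) 0) => [z|n].
  have -> : v = scal (RtoC 0) v by rewrite (norm_eq_0 _ z) scal_zero_r.
  rewrite T_scal; last lra. rewrite !norm_scalR Rabs_R0; lra.
have hv : 0 < norm v by move: (norm_ge_0 v); lra.
have hc : 0 < r / norm v by apply Rdiv_lt_0_compat.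
have h0 := hb t x0 ht; rewrite /minus plus_opp_r norm_zero in h0.
have h1 := hb t (plus x0 (scal (RtoC (r / norm v)) v)) ht.
have E : minus (plus x0 (scal (RtoC (r / norm v)) v)) x0 = scal (RtoC (r / norm v)) v by hvec.
rewrite E norm_scalR Rabs_pos_eq in h1; last lra.
have e2 : r / norm v * norm v = r by field.
rewrite e2 in h1.
have h2 := norm_minus_le (T t (scal (RtoC (r / norm v)) v)) (opp (T t x0)).
have E2 : minus (T t (scal (RtoC (r / norm v)) v)) (opp (T t x0)) =
   T t (plus x0 (scal (RtoC (r / norm v)) v)).
  rewrite T_plus; last lra. hvec.
rewrite E2 norm_opp T_scal in h2; last lra.
rewrite norm_scalR Rabs_pos_eq in h2; last lra.
have h3 : r / norm v * norm (T t v) <= 2 * INR N by move: (h0 ltac:(lra)) (h1 ltac:(lra)); lra.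
have h4 : norm (T t v) <= 2 * INR N / r * norm v.
  apply (Rmult_le_reg_l (r / norm v)) => //.
  apply (Rle_trans _ _ _ h3); right; field; lra.
nra.
Qed.

Lemma T_bounded_on (L : R) : exists M, 1 <= M /\
  forall t x, 0 <= t <= L -> norm (T t x) <= M * norm x.
Proof.
case: T_bounded_near_0 => d [M [hd [hM hb]]].
have hk : forall k, forall t x, 0 <= t <= INR k * d -> norm (T t x) <= M ^ k * norm x.
  elim=> [|k IH] t x.
    rewrite Rmult_0_l => ht; have -> : t = 0 by lra.
    rewrite (C0_zero _ T_C0) /=; lra.
  move=> ht; rewrite S_INR in ht.
  have hp := pow_R1_Rle M k hM.
  case: (Rle_lt_dec t d) => htd.
    apply (Rle_trans _ _ _ (hb t x (conj (proj1 ht) htd))).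
    apply Rmult_le_compat_r; first exact: norm_ge_0.
    rewrite /=; nra.
  have -> : t = d + (t - d) by ring.
  rewrite T_add; [|lra|lra].
  apply (Rle_trans _ _ _ (hb d _ (conj (Rlt_le _ _ hd) (Rle_refl _)))).
  rewrite /= Rmult_assoc; apply Rmult_le_compat_l; first lra.
  apply IH; lra.
case: (INR_unbounded (L / d)) => k hk'.
exists (M ^ k); split; first exact: pow_R1_Rle.
move=> t x ht; apply hk; split; first lra.
apply (Rle_trans _ L); first lra.
have -> : L = L / d * d by field; lra.
apply Rmult_le_compat_r; lra.
Qed.

Lemma T_continuous (t0 : R) (x : H) (eps : R) : 0 <= t0 -> 0 < eps ->
  exists d, 0 < d /\ forall t, 0 <= t -> Rabs (t - t0) < d -> norm (minus (T t x) (T t0 x)) < eps.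
Proof.
move=> ht0 he.
case: (T_bounded_on (t0 + 1)) => M [hM hb].
have he' : 0 < eps / (M + 1) by apply Rdiv_lt_0_compat; lra.
case: (T_right_cont x _ he') => d [hd hdb].
exists (Rmin d 1); split; first by apply Rmin_pos; lra.
(* With [s] the smaller of the two times, [T s] factors out and is uniformly bounded, so continuity
   from the left also reduces to right continuity at [0]. *)
have key : forall s h, 0 <= s <= t0 + 1 -> 0 <= h < d ->
    norm (minus (T (s + h) x) (T s x)) < eps.
  move=> s h hs hh; rewrite T_add; [|lra|lra]. rewrite -T_minus; last lra.
  apply (Rle_lt_trans _ _ _ (hb s _ hs)).
  apply (Rle_lt_trans _ (M * (eps / (M + 1)))).
    apply Rmult_le_compat_l; first lra. by apply Rlt_le, hdb.
  have -> : M * (eps / (M + 1)) = eps - eps / (M + 1) by field; lra.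
  lra.
move=> t ht hd'.
move: (Rmin_l d 1) (Rmin_r d 1) => m1 m2.
case: (Rle_lt_dec t0 t) => hle.
  rewrite Rabs_pos_eq in hd'; last lra.
  have -> : t = t0 + (t - t0) by ring.
  apply key; lra.
rewrite Rabs_left in hd'; last lra.
have E : t0 = t + (t0 - t) by ring.
rewrite norm_minus_sym {1}E.
apply key; lra.
Qed.

End LocalBound.

(** * Derivatives on the half-line *)

Lemma is_derive_eps f t l : is_derive f t l <->
  forall eps, 0 < eps -> exists d, 0 < d /\ forall s, Rabs (s - t) < d ->
    Rabs (f s - f t - (s - t) * l) <= eps * Rabs (s - t).
Proof.
split.
  move=> /is_derive_Reals h eps he; case: (h eps he) => d hd.
  exists d; split; first exact: cond_pos.
  move=> s hsd; case: (Req_dec s t) => [->|n].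
    rewrite !Rminus_diag Rmult_0_l Rminus_0_r Rabs_R0; lra.
  have n' : s - t <> 0 by lra.
  have := hd (s - t) n' hsd; have -> : t + (s - t) = s by ring.
  move=> hh.
  have -> : f s - f t - (s - t) * l = ((f s - f t) / (s - t) - l) * (s - t) by field.
  rewrite Rabs_mult; apply Rmult_le_compat_r; [exact: Rabs_pos|lra].
move=> h; apply is_derive_Reals => eps he.
case: (h (eps / 2) ltac:(lra)) => d [hd hb].
exists (mkposreal _ hd) => k hk /= hkd.
have hk' : 0 < Rabs k by apply Rabs_pos_lt.
have := hb (t + k).
have -> : t + k - t = k by ring.
move=> /(_ hkd) hh.
have -> : (f (t + k) - f t) / k - l = (f (t + k) - f t - k * l) / k by field.
rewrite Rabs_div //.
apply (Rle_lt_trans _ (eps / 2)); last lra.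
apply (Rmult_le_reg_r (Rabs k)) => //.
rewrite /Rdiv Rmult_assoc Rinv_l; lra.
Qed.

(* Derivatives relative to the closed half-line [0 <= t], one-sided at [0]. *)
Definition hderiv (f : R -> R) (t l : R) : Prop :=
  forall eps, 0 < eps -> exists d, 0 < d /\ forall s, 0 <= s -> Rabs (s - t) < d ->
    Rabs (f s - f t - (s - t) * l) <= eps * Rabs (s - t).

Definition vderiv {H : HilbertSpace} (u : R -> H) (t : R) (a : H) : Prop :=
  forall eps, 0 < eps -> exists d, 0 < d /\ forall s, 0 <= s -> Rabs (s - t) < d ->
    norm (minus (minus (u s) (u t)) (scal (RtoC (s - t)) a)) <= eps * Rabs (s - t).

Definition hcont (f : R -> R) (t : R) : Prop :=
  forall eps, 0 < eps -> exists d, 0 < d /\ forall s, 0 <= s -> Rabs (s - t) < d ->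
    Rabs (f s - f t) < eps.

Definition vcont {H : HilbertSpace} (u : R -> H) (t : R) : Prop :=
  forall eps, 0 < eps -> exists d, 0 < d /\ forall s, 0 <= s -> Rabs (s - t) < d ->
    norm (minus (u s) (u t)) < eps.

Lemma hderiv_is_derive f t l : 0 < t -> hderiv f t l -> is_derive f t l.
Proof.
move=> ht h; apply is_derive_eps => eps he; case: (h eps he) => d [hd hb].
exists (Rmin d t); split; first exact: Rmin_pos.
move=> s hs; move: (Rmin_l d t) (Rmin_r d t) (Rabs_def2 _ _ hs) => m1 m2 [k1 k2].
apply hb; lra.
Qed.

Lemma hderiv_right f l : hderiv f 0 l -> filterlim (fun t => (f t - f 0) / t) (at_right 0) (locally l).
Proof.
move=> h; apply filterlim_at_right_0_R => eps he.
case: (h (eps / 2) ltac:(lra)) => d [hd hb].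
exists d; split=> // t ht.
have := hb t ltac:(lra); rewrite Rminus_0_r Rabs_pos_eq; last lra.
move=> /(_ ltac:(lra)) hh.
have -> : (f t - f 0) / t - l = (f t - f 0 - t * l) / t by field; lra.
rewrite Rabs_div; last lra. rewrite (Rabs_pos_eq t); last lra.
apply (Rle_lt_trans _ (eps / 2)); last lra.
apply (Rmult_le_reg_r t); first lra.
rewrite /Rdiv Rmult_assoc Rinv_l; lra.
Qed.

Lemma is_derive_hderiv f t l : is_derive f t l -> hderiv f t l.
Proof.
move=> /is_derive_eps h eps he; case: (h eps he) => d [hd hb].
exists d; split=> // s _; exact: hb.
Qed.

Lemma hderiv_hcont f t l : hderiv f t l -> hcont f t.
Proof.
move=> h eps he.
case: (h 1 Rlt_0_1) => d [hd hb].
have hl := Rabs_pos l.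
have he' : 0 < eps / (Rabs l + 2) by apply Rdiv_lt_0_compat; lra.
exists (Rmin d (eps / (Rabs l + 2))); split; first by apply Rmin_pos.
move=> s hs hsd; move: (Rmin_l d (eps / (Rabs l + 2))) (Rmin_r d (eps / (Rabs l + 2))) => m1 m2.
move: (hb s hs ltac:(lra)) => h1.
have h2 : Rabs (f s - f t) <= Rabs (f s - f t - (s - t) * l) + Rabs ((s - t) * l).
  have {1}-> : f s - f t = (f s - f t - (s - t) * l) + (s - t) * l by ring.
  exact: Rabs_triang.
rewrite Rabs_mult in h2.
have h3 : Rabs (s - t) * (Rabs l + 2) < eps.
  apply (Rlt_le_trans _ (eps / (Rabs l + 2) * (Rabs l + 2))); last by right; field; lra.
  apply Rmult_lt_compat_r; lra.
move: (Rabs_pos (s - t)); nra.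
Qed.

Lemma vderiv_vcont {H : HilbertSpace} (u : R -> H) t a : vderiv u t a -> vcont u t.
Proof.
move=> h eps he.
case: (h 1 Rlt_0_1) => d [hd hb].
have hl := norm_ge_0 a.
have he' : 0 < eps / (norm a + 2) by apply Rdiv_lt_0_compat; lra.
exists (Rmin d (eps / (norm a + 2))); split; first by apply Rmin_pos.
move=> s hs hsd; move: (Rmin_l d (eps / (norm a + 2))) (Rmin_r d (eps / (norm a + 2))) => m1 m2.
move: (hb s hs ltac:(lra)) => h1.
have := norm_minus_le (minus (u s) (u t)) (scal (RtoC (s - t)) a).
rewrite norm_scalR => h2.
have h3 : Rabs (s - t) * (norm a + 2) < eps.
  apply (Rlt_le_trans _ (eps / (norm a + 2) * (norm a + 2))); last by right; field; lra.
  apply Rmult_lt_compat_r; lra.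
move: (Rabs_pos (s - t)); nra.
Qed.

Lemma vcont_hcont_norm {H : HilbertSpace} (u : R -> H) t :
  vcont u t -> hcont (fun s => norm (u s)) t.
Proof.
move=> h eps he; case: (h eps he) => d [hd hb]; exists d; split=> // s hs hsd.
apply (Rle_lt_trans _ (norm (minus (u s) (u t)))); last exact: hb.
exact: norm_triangle_inv.
Qed.

Lemma hderiv_rin {H : HilbertSpace} (u v : R -> H) t a b :
  vderiv u t a -> vderiv v t b ->
  hderiv (fun s => rin (u s) (v s)) t (rin a (v t) + rin (u t) b).
Proof.
move=> hu hv eps he.
set D := norm (v t) + norm (u t) + norm a + 2.
have hD : 2 <= D by rewrite /D; move: (norm_ge_0 (v t)) (norm_ge_0 (u t)) (norm_ge_0 a); lra.
have he' : 0 < Rmin 1 (eps / D) by apply Rmin_pos; [lra|apply Rdiv_lt_0_compat; lra].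
set e := Rmin 1 (eps / D) in he'.
have e1 : e <= 1 by apply Rmin_l.
have e2 : e * D <= eps.
  apply (Rle_trans _ (eps / D * D)); last by right; field; lra.
  apply Rmult_le_compat_r; [lra|exact: Rmin_r].
case: (hu e he') => d1 [hd1 b1]; case: (hv e he') => d2 [hd2 b2].
case: (vderiv_vcont v t b hv e he') => d3 [hd3 b3].
exists (Rmin d1 (Rmin d2 d3)); split; first by repeat apply Rmin_pos.
move=> s hs hsd.
have [l1 [l2 l3]] : Rabs (s - t) < d1 /\ Rabs (s - t) < d2 /\ Rabs (s - t) < d3.
  move: (Rmin_l d1 (Rmin d2 d3)) (Rmin_r d1 (Rmin d2 d3)) (Rmin_l d2 d3) (Rmin_r d2 d3); lra.
move: (b1 s hs l1) (b2 s hs l2) (b3 s hs l3).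
set U := minus (minus (u s) _) _; set V := minus (minus (v s) _) _; set W := minus (v s) (v t).
move=> c1 c2 c3.
have -> : rin (u s) (v s) - rin (u t) (v t) - (s - t) * (rin a (v t) + rin (u t) b) =
   rin U (v s) + (s - t) * rin a W + rin (u t) V.
  rewrite /U /V /W !(rin_minus_l, rin_minus_r, rin_scal_l, rin_scal_r); ring.
have p := Rabs_pos (s - t).
have q1 : Rabs (rin U (v s)) <= e * Rabs (s - t) * (norm (v t) + 1).
  apply (Rle_trans _ _ _ (rin_abs_le _ _)).
  apply Rmult_le_compat => //; try exact: norm_ge_0.
  move: (norm_minus_le (v s) (v t)); rewrite -/W; lra.
have q2 : Rabs ((s - t) * rin a W) <= Rabs (s - t) * (norm a * e).
  rewrite Rabs_mult; apply Rmult_le_compat_l => //.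
  apply (Rle_trans _ _ _ (rin_abs_le _ _)).
  apply Rmult_le_compat_l; [exact: norm_ge_0|lra].
have q3 : Rabs (rin (u t) V) <= norm (u t) * (e * Rabs (s - t)).
  apply (Rle_trans _ _ _ (rin_abs_le _ _)).
  by apply Rmult_le_compat_l; first exact: norm_ge_0.
move: (Rabs_triang (rin U (v s) + (s - t) * rin a W) (rin (u t) V))
  (Rabs_triang (rin U (v s)) ((s - t) * rin a W)) => t1 t2.
apply (Rle_trans _ (e * D * Rabs (s - t))); last by apply Rmult_le_compat_r.
rewrite /D; have : 0 <= e * Rabs (s - t) by apply Rmult_le_pos; lra.
nra.
Qed.

(** * Invariance of the domain and derivatives of orbits *)

Section Generator.
Context {H : HilbertSpace} {A : operator H} {T : R -> H -> H}
  (T_C0 : C0_semigroup T) (T_gen : generated_by_opp A T).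

Lemma dom_opp x : dom A x -> dom A (opp x).
Proof. move=> h; rewrite -scal_opp_one; exact: dom_scal. Qed.

Lemma dom_minus x y : dom A x -> dom A y -> dom A (minus x y).
Proof. move=> hx hy; apply dom_plus => //; exact: dom_opp. Qed.

Lemma op_minus x y : dom A x -> dom A y -> A (minus x y) = minus (A x) (A y).
Proof.
move=> hx hy; rewrite /minus op_plus //; last exact: dom_opp.
by rewrite -(scal_opp_one y) op_scal // scal_opp_one.
Qed.

Lemma T_gen_0 x eps : dom A x -> 0 < eps -> exists d, 0 < d /\ forall t, 0 <= t < d ->
  norm (plus (minus (T t x) x) (scal (RtoC t) (A x))) <= eps * t.
Proof.
move=> hx he.
have /filterlim_at_right_0 h := proj2 (T_gen x (opp (A x))) (conj hx eq_refl).
case: (h eps he) => d [hd hb]; exists d; split=> // t ht.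
case: (Req_dec t 0) => [->|n].
  rewrite (C0_zero _ T_C0).
  have -> : plus (minus x x) (scal (RtoC 0) (A x)) = scal (RtoC 0) (A x) by hvec.
  rewrite norm_scalR Rabs_R0; lra.
have E : plus (minus (T t x) x) (scal (RtoC t) (A x)) =
  scal (RtoC t) (minus (scal (RtoC (/ t)) (minus (T t x) x)) (opp (A x))).
  apply inner_ext => v; rewrite /minus !(inner_plus, inner_scal, inner_opp_l) RtoC_inv //.
  by field; apply RtoC_neq_0.
rewrite E norm_scalR Rabs_pos_eq; last lra.
rewrite Rmult_comm; apply Rmult_le_compat_r; first lra.
apply Rlt_le, hb; lra.
Qed.

(** [T t] commutes with the difference quotients at [0] and is bounded, so the quotients of [T t x]
    converge to [- T t (A x)]; the description of the generator then yields both claims at once. *)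
Lemma T_dom t x : 0 <= t -> dom A x -> dom A (T t x) /\ A (T t x) = T t (A x).
Proof.
move=> ht hx.
case: (T_bounded_on T_C0 t) => M [hM hb].
have [h1 h2] : dom A (T t x) /\ opp (T t (A x)) = opp (A (T t x)).
  apply (T_gen (T t x)); apply filterlim_at_right_0 => eps he.
  have he' : 0 < eps / (2 * M) by apply Rdiv_lt_0_compat; lra.
  case: (T_gen_0 x _ hx he') => d [hd hbd]; exists d; split=> // s hs.
  have E : minus (scal (RtoC (/ s)) (minus (T s (T t x)) (T t x))) (opp (T t (A x))) =
     scal (RtoC (/ s)) (T t (plus (minus (T s x) x) (scal (RtoC s) (A x)))).
    rewrite (T_plus T_C0) // (T_minus T_C0) // (T_scal T_C0) // -!(T_add T_C0) //; try lra.
    rewrite (Rplus_comm t s).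
    apply inner_ext => v; rewrite /minus !(inner_plus, inner_scal, inner_opp_l) RtoC_inv; last lra.
    field; apply RtoC_neq_0; lra.
  rewrite E norm_scalR Rabs_pos_eq; last by apply Rlt_le, Rinv_0_lt_compat; lra.
  apply (Rle_lt_trans _ (/ s * (M * (eps / (2 * M) * s)))).
    apply Rmult_le_compat_l; first by apply Rlt_le, Rinv_0_lt_compat; lra.
    apply (Rle_trans _ _ _ (hb t _ ltac:(lra))).
    apply Rmult_le_compat_l; first lra. apply hbd; lra.
  have -> : / s * (M * (eps / (2 * M) * s)) = eps / 2 by field; lra.
  lra.
split=> //; by rewrite -(opp_opp (A (T t x))) -h2 opp_opp.
Qed.

Lemma T_vcont x t : 0 <= t -> vcont (fun s => T s x) t.
Proof. move=> ht eps he; exact: (T_continuous T_C0). Qed.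

Lemma T_vderiv x t : 0 <= t -> dom A x -> vderiv (fun s => T s x) t (opp (A (T t x))).
Proof.
move=> ht hx eps he.
rewrite (proj2 (T_dom t x ht hx)).
case: (T_bounded_on T_C0 (t + 1)) => M [hM hb].
have he' : 0 < eps / (2 * M) by apply Rdiv_lt_0_compat; lra.
case: (T_gen_0 x _ hx he') => d1 [hd1 hb1].
case: (T_vcont (A x) t ht (eps / 2) ltac:(lra)) => d2 [hd2 hb2].
exists (Rmin d1 (Rmin d2 1)); split; first by repeat apply Rmin_pos; lra.
move=> s hs hsd.
have [l1 [l2 l3]] : Rabs (s - t) < d1 /\ Rabs (s - t) < d2 /\ Rabs (s - t) < 1.
  move: (Rmin_l d1 (Rmin d2 1)) (Rmin_r d1 (Rmin d2 1)) (Rmin_l d2 1) (Rmin_r d2 1); lra.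
case: (Rle_lt_dec t s) => hts.
  rewrite Rabs_pos_eq in l1; last lra. rewrite Rabs_pos_eq; last lra.
  have E : minus (minus (T s x) (T t x)) (scal (RtoC (s - t)) (opp (T t (A x)))) =
     T t (plus (minus (T (s - t) x) x) (scal (RtoC (s - t)) (A x))).
    rewrite (T_plus T_C0) // (T_minus T_C0) // (T_scal T_C0) // -!(T_add T_C0) //; try lra.
    have -> : t + (s - t) = s by ring.
    apply inner_ext => v; rewrite /minus !(inner_plus, inner_scal, inner_opp_l); ring.
  rewrite E; apply (Rle_trans _ _ _ (hb t _ ltac:(lra))).
  apply (Rle_trans _ (M * (eps / (2 * M) * (s - t)))).
    apply Rmult_le_compat_l; first lra. apply hb1; lra.
  have -> : M * (eps / (2 * M) * (s - t)) = eps / 2 * (s - t) by field; lra.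
  nra.
rewrite Rabs_left in l1; last lra. rewrite Rabs_left; last lra.
rewrite Rabs_left in l3; last lra.
(* To the left of [t] the factor pulled out is [T s], which produces the derivative at [s] instead
   of [t]; the discrepancy [T s (A x) - T t (A x)] is small by strong continuity. *)
have E : minus (minus (T s x) (T t x)) (scal (RtoC (s - t)) (opp (T t (A x)))) =
   plus (opp (T s (plus (minus (T (t - s) x) x) (scal (RtoC (t - s)) (A x)))))
     (scal (RtoC (t - s)) (minus (T s (A x)) (T t (A x)))).
  rewrite (T_plus T_C0) // (T_minus T_C0) // (T_scal T_C0) // -!(T_add T_C0) //; try lra.
  have -> : s + (t - s) = t by ring.
  apply inner_ext => v.
  rewrite /minus !(inner_plus, inner_scal, inner_opp_l) !RtoC_plus !RtoC_opp; ring.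
rewrite E; apply (Rle_trans _ _ _ (norm_plus_le _ _)).
rewrite norm_opp norm_scalR Rabs_pos_eq; last lra.
have q1 : norm (T s (plus (minus (T (t - s) x) x) (scal (RtoC (t - s)) (A x)))) <= eps / 2 * (t - s).
  apply (Rle_trans _ _ _ (hb s _ ltac:(lra))).
  apply (Rle_trans _ (M * (eps / (2 * M) * (t - s)))).
    apply Rmult_le_compat_l; first lra. apply hb1; lra.
  right; field; lra.
have q2 := Rlt_le _ _ (hb2 s hs l2).
nra.
Qed.

Lemma T_hderiv_rin x y t : 0 <= t -> dom A x -> dom A y ->
  hderiv (fun s => rin (T s x) (T s y)) t (- rin (T t (A x)) (T t y) - rin (T t x) (T t (A y))).
Proof.
move=> ht hx hy.
have := hderiv_rin _ _ t _ _ (T_vderiv x t ht hx) (T_vderiv y t ht hy).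
by rewrite rin_opp_l rin_opp_r (proj2 (T_dom t x ht hx)) (proj2 (T_dom t y ht hy)).
Qed.

Lemma T_hderiv_rin_l x v t : 0 <= t -> dom A x ->
  hderiv (fun s => rin (T s x) v) t (- rin (T t (A x)) v).
Proof.
move=> ht hx.
have hv : vderiv (fun _ => v) t (zero : H).
  move=> eps he; exists 1; split; first lra. move=> s hs hsd.
  have -> : minus (minus v v) (scal (RtoC (s - t)) (zero : H)) = scal (RtoC 0) v.
    by apply inner_ext => w; rewrite /minus !(inner_plus, inner_scal, inner_opp_l, inner_zero_l); ring.
  rewrite norm_scalR Rabs_R0; move: (Rabs_pos (s - t)); nra.
have := hderiv_rin _ _ t _ _ (T_vderiv x t ht hx) hv.
by rewrite (rin_sym zero) rin_zero_l Rplus_0_r rin_opp_l (proj2 (T_dom t x ht hx)).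
Qed.

End Generator.

(** * Convexity and log-convexity *)

Lemma hderiv_mult f g t a b : hderiv f t a -> hderiv g t b ->
  hderiv (fun s => f s * g s) t (a * g t + f t * b).
Proof.
move=> hf hg eps he.
set D := Rabs (g t) + Rabs (f t) + Rabs a + 2.
have hD : 2 <= D by rewrite /D; move: (Rabs_pos (g t)) (Rabs_pos (f t)) (Rabs_pos a); lra.
have he' : 0 < Rmin 1 (eps / D) by apply Rmin_pos; [lra|apply Rdiv_lt_0_compat; lra].
set e := Rmin 1 (eps / D) in he'.
have e1 : e <= 1 by apply Rmin_l.
have e2 : e * D <= eps.
  apply (Rle_trans _ (eps / D * D)); last by right; field; lra.
  apply Rmult_le_compat_r; [lra|exact: Rmin_r].
case: (hf e he') => d1 [hd1 b1]; case: (hg e he') => d2 [hd2 b2].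
case: (hderiv_hcont g t b hg e he') => d3 [hd3 b3].
exists (Rmin d1 (Rmin d2 d3)); split; first by repeat apply Rmin_pos.
move=> s hs hsd.
have [l1 [l2 l3]] : Rabs (s - t) < d1 /\ Rabs (s - t) < d2 /\ Rabs (s - t) < d3.
  move: (Rmin_l d1 (Rmin d2 d3)) (Rmin_r d1 (Rmin d2 d3)) (Rmin_l d2 d3) (Rmin_r d2 d3); lra.
move: (b1 s hs l1) (b2 s hs l2) (b3 s hs l3).
set U := f s - _ - _; set V := g s - _ - _; set W := g s - g t.
move=> c1 c2 c3.
have -> : f s * g s - f t * g t - (s - t) * (a * g t + f t * b) =
   U * g s + (s - t) * (a * W) + f t * V by rewrite /U /V /W; ring.
have p := Rabs_pos (s - t).
have gs : Rabs (g s) <= Rabs (g t) + 1.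
  have -> : g s = g t + W by rewrite /W; ring.
  move: (Rabs_triang (g t) W); lra.
have q1 : Rabs (U * g s) <= e * Rabs (s - t) * (Rabs (g t) + 1).
  rewrite Rabs_mult; apply Rmult_le_compat => //; exact: Rabs_pos.
have q2 : Rabs ((s - t) * (a * W)) <= Rabs (s - t) * (Rabs a * e).
  rewrite !Rabs_mult; apply Rmult_le_compat_l => //.
  apply Rmult_le_compat_l; [exact: Rabs_pos|lra].
have q3 : Rabs (f t * V) <= Rabs (f t) * (e * Rabs (s - t)).
  rewrite Rabs_mult; by apply Rmult_le_compat_l; first exact: Rabs_pos.
move: (Rabs_triang (U * g s + (s - t) * (a * W)) (f t * V))
  (Rabs_triang (U * g s) ((s - t) * (a * W))) => t1 t2.
apply (Rle_trans _ (e * D * Rabs (s - t))); last by apply Rmult_le_compat_r.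
rewrite /D; have : 0 <= e * Rabs (s - t) by apply Rmult_le_pos; lra.
nra.
Qed.

Lemma hderiv_exp k t : hderiv (fun s => exp (k * s)) t (k * exp (k * t)).
Proof. by apply is_derive_hderiv; auto_derive => //; ring. Qed.

Lemma hderiv_eq f t l l' : l = l' -> hderiv f t l -> hderiv f t l'.
Proof. by move=> ->. Qed.

Lemma hderiv_plus f g t a b : hderiv f t a -> hderiv g t b -> hderiv (fun s => f s + g s) t (a + b).
Proof.
move=> hf hg eps he.
case: (hf (eps / 2) ltac:(lra)) => d1 [hd1 b1]; case: (hg (eps / 2) ltac:(lra)) => d2 [hd2 b2].
exists (Rmin d1 d2); split; first by apply Rmin_pos.
move=> s hs hsd; move: (Rmin_l d1 d2) (Rmin_r d1 d2) => m1 m2.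
move: (b1 s hs ltac:(lra)) (b2 s hs ltac:(lra)) => c1 c2.
have -> : f s + g s - (f t + g t) - (s - t) * (a + b) =
  (f s - f t - (s - t) * a) + (g s - g t - (s - t) * b) by ring.
apply (Rle_trans _ _ _ (Rabs_triang _ _)); lra.
Qed.

Lemma hderiv_scal c f t a : hderiv f t a -> hderiv (fun s => c * f s) t (c * a).
Proof.
move=> hf; apply (hderiv_eq _ _ (0 * f t + c * a)); first ring.
apply hderiv_mult => //; apply is_derive_hderiv; auto_derive => //.
Qed.

Lemma hderiv_exp_mult k f t a : hderiv f t a ->
  hderiv (fun s => exp (k * s) * f s) t (exp (k * t) * (k * f t + a)).
Proof.
move=> hf; apply (hderiv_eq _ _ (k * exp (k * t) * f t + exp (k * t) * a)); first ring.
exact (hderiv_mult _ _ _ _ _ (hderiv_exp k t) hf).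
Qed.

Lemma hcont_mult f g t : hcont f t -> hcont g t -> hcont (fun s => f s * g s) t.
Proof.
move=> hf hg eps he.
set D := Rabs (g t) + Rabs (f t) + 2.
have hD : 2 <= D by rewrite /D; move: (Rabs_pos (g t)) (Rabs_pos (f t)); lra.
have he' : 0 < Rmin 1 (eps / D) by apply Rmin_pos; [lra|apply Rdiv_lt_0_compat; lra].
set e := Rmin 1 (eps / D) in he'.
have e1 : e <= 1 by apply Rmin_l.
have e2 : e * D <= eps.
  apply (Rle_trans _ (eps / D * D)); last by right; field; lra.
  apply Rmult_le_compat_r; [lra|exact: Rmin_r].
case: (hf e he') => d1 [hd1 b1]; case: (hg e he') => d2 [hd2 b2].
exists (Rmin d1 d2); split; first by apply Rmin_pos.
move=> s hs hsd; move: (Rmin_l d1 d2) (Rmin_r d1 d2) => m1 m2.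
move: (b1 s hs ltac:(lra)) (b2 s hs ltac:(lra)) => c1 c2.
have -> : f s * g s - f t * g t = (f s - f t) * (g s - g t) + (f s - f t) * g t + f t * (g s - g t) by ring.
apply (Rle_lt_trans _ _ _ (Rabs_triang _ _)).
apply (Rle_lt_trans _ _ _ (Rplus_le_compat_r _ _ _ (Rabs_triang _ _))).
rewrite !Rabs_mult.
move: (Rabs_pos (g t)) (Rabs_pos (f t)) (Rabs_pos (f s - f t)) (Rabs_pos (g s - g t)) => p1 p2 p3 p4.
have q1 : Rabs (f s - f t) * Rabs (g s - g t) < e * 1 by apply Rmult_le_0_lt_compat; lra.
have q2 : Rabs (f s - f t) * Rabs (g t) <= e * Rabs (g t) by apply Rmult_le_compat_r; lra.
have q3 : Rabs (f t) * Rabs (g s - g t) <= Rabs (f t) * e by apply Rmult_le_compat_l; lra.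
rewrite /D in e2; nra.
Qed.

(** [Rmax 0] is 1-Lipschitz. Extending [f] by the constant [f 0] makes the two-sided mean value
    theorem applicable on intervals that start at [0]. *)
Lemma hcont_continuity_Rmax f t : (forall s, 0 <= s -> hcont f s) ->
  continuity_pt (fun s => f (Rmax 0 s)) t.
Proof.
move=> h eps he.
case: (h (Rmax 0 t) (Rmax_l _ _) eps he) => d [hd hb]; exists d; split=> // s [_].
rewrite /dist /= /Rdist => hs.
apply hb; first exact: Rmax_l.
apply (Rle_lt_trans _ (Rabs (s - t))) => //.
case: (Rle_lt_dec 0 s) => h1; case: (Rle_lt_dec 0 t) => h2;
  rewrite ?(Rmax_right _ _ h1) ?(Rmax_right _ _ h2)
    ?(Rmax_left _ _ (Rlt_le _ _ h1)) ?(Rmax_left _ _ (Rlt_le _ _ h2)); split_Rabs; lra.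
Qed.

Lemma MVT_half_line g dg a b : 0 <= a -> a < b ->
  (forall t, a < t < b -> hderiv g t (dg t)) -> (forall t, 0 <= t -> hcont g t) ->
  exists c, a < c < b /\ g b - g a = dg c * (b - a).
Proof.
move=> ha hab hd hc.
have hd' : forall c, a < c < b -> derivable_pt_lim (fun s => g (Rmax 0 s)) c (dg c).
  move=> c hcab; apply is_derive_Reals.
  apply (is_derive_ext_loc g); last by apply hderiv_is_derive; [lra|apply hd].
  have hp : 0 < c by lra.
  exists (mkposreal c hp) => y; rewrite /ball /= /AbsRing_ball /abs /minus /plus /opp /= => /Rabs_def2 hy.
  rewrite Rmax_right //; lra.
pose pr1 c (P : a < c < b) : derivable_pt (fun s => g (Rmax 0 s)) c := exist _ _ (hd' c P).
pose pr2 c (P : a < c < b) : derivable_pt id c := derivable_pt_id c.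
have [c [P e]] := MVT (fun s => g (Rmax 0 s)) id a b pr1 pr2 hab
  (fun c _ => hcont_continuity_Rmax g c hc) (fun c _ => derivable_continuous_pt _ _ (derivable_pt_id c)).
exists c; split=> //.
move: e; rewrite (derive_pt_eq_0 _ _ _ (pr1 c P) (hd' c P)).
rewrite (derive_pt_eq_0 _ _ _ (pr2 c P) (derivable_pt_lim_id c)) /id.
rewrite !Rmax_right; lra.
Qed.

Definition hconvex (G : R -> R) : Prop :=
  forall r s t, 0 <= r -> r < s -> s < t -> (t - r) * G s <= (t - s) * G r + (s - r) * G t.

Lemma hconvex_of_deriv G G1 G2 :
  (forall t, 0 < t -> hderiv G t (G1 t)) -> (forall t, 0 < t -> hderiv G1 t (G2 t)) ->
  (forall t, 0 < t -> 0 <= G2 t) -> (forall t, 0 <= t -> hcont G t) -> hconvex G.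
Proof.
move=> h1 h2 hp hc r s t hr hrs hst.
case: (MVT_half_line G G1 r s hr hrs) => //; first by move=> u hu; apply h1; lra.
move=> c1 [hc1 e1].
case: (MVT_half_line G G1 s t ltac:(lra) hst) => //; first by move=> u hu; apply h1; lra.
move=> c2 [hc2 e2].
(* The slopes over [[r, s]] and [[s, t]] are values of [G1] at [c1 < s < c2], and [G2 >= 0] orders
   them. *)
have hle : G1 c1 <= G1 c2.
  have hdG1 : forall u, 0 < u -> is_derive G1 u (G2 u) by move=> u hu; apply hderiv_is_derive => //; apply h2.
  case: (MVT_gen G1 c1 c2 G2).
  - rewrite Rmin_left ?Rmax_right; try lra. move=> x hx; apply hdG1; lra.
  - rewrite Rmin_left ?Rmax_right; try lra. move=> x hx.
    apply derivable_continuous_pt; exists (G2 x); apply is_derive_Reals, hdG1; lra.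
  - rewrite Rmin_left ?Rmax_right; try lra. move=> c [hcc e3].
    have := hp c ltac:(lra); nra.
have -> : (t - r) * G s = (t - s) * G r + (s - r) * G t + ((t - s) * (G s - G r) - (s - r) * (G t - G s)) by ring.
rewrite e1 e2.
have : 0 <= (t - s) * (s - r) * (G1 c2 - G1 c1) by repeat apply Rmult_le_pos; lra.
nra.
Qed.

Lemma hderiv_le_slope G r t a m : 0 <= r -> r < t -> hderiv G r a ->
  (forall s, r < s < t -> G s - G r <= m * (s - r)) -> a <= m.
Proof.
move=> hr hrt hd hs; apply Rnot_lt_le => hlt.
case: (hd ((a - m) / 2) ltac:(lra)) => d [hd0 hb].
have p : 0 < Rmin d (t - r) by apply Rmin_pos; lra.
move: (Rmin_l d (t - r)) (Rmin_r d (t - r)) => m1 m2.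
set s := r + Rmin d (t - r) / 2.
have e : s - r = Rmin d (t - r) / 2 by rewrite /s; ring.
have := hs s ltac:(rewrite /s; lra); have := hb s ltac:(rewrite /s; lra).
rewrite e Rabs_pos_eq; last lra.
move=> /(_ ltac:(lra)) /Rabs_le_between h1 h2; nra.
Qed.

Lemma slope_le_hderiv G r t b m : 0 <= r -> r < t -> hderiv G t b ->
  (forall s, r < s < t -> m * (t - s) <= G t - G s) -> m <= b.
Proof.
move=> hr hrt hd hs; apply Rnot_lt_le => hlt.
case: (hd ((m - b) / 2) ltac:(lra)) => d [hd0 hb].
have p : 0 < Rmin d (t - r) by apply Rmin_pos; lra.
move: (Rmin_l d (t - r)) (Rmin_r d (t - r)) => m1 m2.
set s := t - Rmin d (t - r) / 2.
have e : s - t = - (Rmin d (t - r) / 2) by rewrite /s; ring.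
have := hs s ltac:(rewrite /s; lra); have := hb s ltac:(rewrite /s; lra).
have -> : t - s = Rmin d (t - r) / 2 by rewrite /s; ring.
rewrite e Rabs_Ropp Rabs_pos_eq; last lra.
move=> /(_ ltac:(lra)) /Rabs_le_between h1 h2; nra.
Qed.

Lemma hconvex_slope_l G r t a : hconvex G -> 0 <= r -> r < t -> hderiv G r a ->
  a <= (G t - G r) / (t - r).
Proof.
move=> hG hr hrt hd; apply: (hderiv_le_slope G r t) => // s hs.
apply (Rmult_le_reg_l (t - r)); first lra.
have -> : (t - r) * ((G t - G r) / (t - r) * (s - r)) = (G t - G r) * (s - r) by field; lra.
have := hG r s t hr (proj1 hs) (proj2 hs); lra.
Qed.

Lemma hconvex_slope_r G r t b : hconvex G -> 0 <= r -> r < t -> hderiv G t b ->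
  (G t - G r) / (t - r) <= b.
Proof.
move=> hG hr hrt hd; apply: (slope_le_hderiv G r t) => // s hs.
apply (Rmult_le_reg_l (t - r)); first lra.
have -> : (t - r) * ((G t - G r) / (t - r) * (t - s)) = (G t - G r) * (t - s) by field; lra.
have := hG r s t hr (proj1 hs) (proj2 hs); lra.
Qed.

(* Log-convexity is equivalent to convexity of all exponential tilts; this form
   is free of logarithms and survives both zeros and pointwise limits. *)
Definition tilt_convex (f : R -> R) : Prop :=
  forall k, hconvex (fun t => exp (k * t) * f t).

Lemma le_0_of_exp_bound x B c : 0 < c -> 0 <= B -> (forall k, x <= B * exp (- k * c)) -> x <= 0.
Proof.
move=> hc hB h; apply Rnot_lt_le => hx.
(* For this value of [k], [x * exp (k * c) >= x * (1 + k * c) = x + B > B]. *)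
have hk : 0 <= B / (x * c) by apply Rdiv_le_0_compat => //; apply Rmult_lt_0_compat.
have h1 := h (B / (x * c)).
have h2 := exp_ineq1_le (B / (x * c) * c).
have e : exp (- (B / (x * c)) * c) * exp (B / (x * c) * c) = 1.
  rewrite -exp_plus -exp_0; f_equal; ring.
have h3 := exp_pos (- (B / (x * c)) * c).
have e' : x * (B / (x * c) * c) = B by field; lra.
have : x * exp (B / (x * c) * c) <= B.
  have := exp_pos (B / (x * c) * c) => h4.
  have := Rmult_le_compat_r _ _ _ (Rlt_le _ _ h4) h1; rewrite Rmult_assoc e; lra.
nra.
Qed.

Lemma tilt_convex_log_convex f : (forall t, 0 <= t -> 0 <= f t) -> tilt_convex f -> log_convex f.
Proof.
move=> hpos hf r s t hr hrs hst.
have hfr := hpos r hr; have hfs := hpos s ltac:(lra); have hft := hpos t ltac:(lra).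
have key : forall k, (t - r) * f s <= (t - s) * (exp (- k * (s - r)) * f r) + (s - r) * (exp (k * (t - s)) * f t).
  move=> k; have h := hf k r s t hr hrs hst.
  have hp := exp_pos (- k * s).
  have := Rmult_le_compat_l _ _ _ (Rlt_le _ _ hp) h.
  have E1 : exp (- k * (s - r)) = exp (- k * s) * exp (k * r) by rewrite -exp_plus; f_equal; ring.
  have E2 : exp (k * (t - s)) = exp (- k * s) * exp (k * t) by rewrite -exp_plus; f_equal; ring.
  have E3 : exp (- k * s) * exp (k * s) = 1 by rewrite -exp_plus -exp_0; f_equal; ring.
  rewrite E1 E2 => hh.
  have -> : (t - r) * f s = exp (- k * s) * ((t - r) * (exp (k * s) * f s)).
    have -> : exp (- k * s) * ((t - r) * (exp (k * s) * f s)) =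
      (exp (- k * s) * exp (k * s)) * ((t - r) * f s) by ring.
    by rewrite E3 Rmult_1_l.
  lra.
have zero_case : f s <= 0 -> f s <= rpow (f r) ((t - s) / (t - r)) * rpow (f t) ((s - r) / (t - r)).
  move=> h; apply (Rle_trans _ 0) => //; apply Rmult_le_pos; rewrite /rpow;
    case: Req_EM_T => _; try lra; apply Rlt_le, exp_pos.
(* If an endpoint value vanishes, a tilt towards minus infinity (for [f r = 0]) or plus infinity
   (for [f t = 0]) extinguishes the other term and forces [f s = 0], in agreement with
   [rpow 0 a = 0]. *)
case: (Req_dec (f r) 0) => [zr|nr].
  apply zero_case.
  have : (t - r) * f s <= 0; last by nra.
  apply (le_0_of_exp_bound _ ((s - r) * f t) (t - s)); [lra|by apply Rmult_le_pos; lra|].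
  move=> k; have := key (- k); rewrite zr; nra.
case: (Req_dec (f t) 0) => [zt|nt].
  apply zero_case.
  have : (t - r) * f s <= 0; last by nra.
  apply (le_0_of_exp_bound _ ((t - s) * f r) (s - r)); [lra|by apply Rmult_le_pos; lra|].
  move=> k; have := key k; rewrite zt; nra.
rewrite /rpow; case: Req_EM_T => // _; case: Req_EM_T => // _.
have pr : 0 < f r by lra. have pt : 0 < f t by lra.
(* The optimal tilt: it makes both tilted endpoint values equal to the weighted geometric mean [E],
   and the weights then add up to [t - r]. *)
have h := key ((ln (f r) - ln (f t)) / (t - r)).
rewrite /Rpower -exp_plus.
set E := exp ((t - s) / (t - r) * ln (f r) + (s - r) / (t - r) * ln (f t)).
have E1 : exp (- ((ln (f r) - ln (f t)) / (t - r)) * (s - r)) * f r = E.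
  transitivity (exp (- ((ln (f r) - ln (f t)) / (t - r)) * (s - r)) * exp (ln (f r))).
    by rewrite exp_ln.
  rewrite /E -exp_plus; f_equal; field; lra.
have E2 : exp ((ln (f r) - ln (f t)) / (t - r) * (t - s)) * f t = E.
  transitivity (exp ((ln (f r) - ln (f t)) / (t - r) * (t - s)) * exp (ln (f t))).
    by rewrite exp_ln.
  rewrite /E -exp_plus; f_equal; field; lra.
rewrite E1 E2 in h; nra.
Qed.

Lemma exp_convex_le a b X Y : 0 <= a -> 0 <= b -> a + b = 1 -> exp (a * X + b * Y) <= a * exp X + b * exp Y.
Proof.
move=> ha hb hab; set M := a * X + b * Y.
have hM := exp_pos M.
have h : forall Z, exp M * (1 + (Z - M)) <= exp Z.
  move=> Z; have -> : exp Z = exp M * exp (Z - M) by rewrite -exp_plus; f_equal; ring.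
  apply Rmult_le_compat_l; [lra|exact: exp_ineq1_le].
have hX := Rmult_le_compat_l _ _ _ ha (h X).
have hY := Rmult_le_compat_l _ _ _ hb (h Y).
have e : a * (exp M * (1 + (X - M))) + b * (exp M * (1 + (Y - M))) = exp M * ((a + b) + (M - (a + b) * M)).
  rewrite /M; ring.
rewrite hab in e; lra.
Qed.

(** An exponential is log-affine, so [exp (k t) * h t ^ 2] is again log-convex, and the weighted
    inequality of arithmetic and geometric means, in the form [exp_convex_le], makes it convex.
    Vanishing endpoint values are treated apart. *)
Lemma log_convex_tilt_sq h : (forall t, 0 <= t -> 0 <= h t) -> log_convex h ->
  tilt_convex (fun t => h t ^ 2).
Proof.
move=> hpos hl k r s t hr hrs hst.
have := hl r s t hr hrs hst.
have hhr := hpos r hr; have hhs := hpos s ltac:(lra); have hht := hpos t ltac:(lra).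
have p1 : 0 <= (t - s) * (exp (k * r) * h r ^ 2).
  apply Rmult_le_pos; [lra|apply Rmult_le_pos; [apply Rlt_le, exp_pos|exact: pow2_ge_0]].
have p2 : 0 <= (s - r) * (exp (k * t) * h t ^ 2).
  apply Rmult_le_pos; [lra|apply Rmult_le_pos; [apply Rlt_le, exp_pos|exact: pow2_ge_0]].
rewrite /rpow; case: Req_EM_T => zr.
  rewrite Rmult_0_l => h0; have -> : h s = 0 by lra. lra.
case: Req_EM_T => zt.
  rewrite Rmult_0_r => h0; have -> : h s = 0 by lra. lra.
rewrite /Rpower -exp_plus => h0.
have pr : 0 < h r by lra. have pt : 0 < h t by lra.
set a := (t - s) / (t - r) in h0; set b := (s - r) / (t - r) in h0.
have ab : a + b = 1 by rewrite /a /b; field; lra.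
have ha : 0 <= a by apply Rdiv_le_0_compat; lra.
have hb : 0 <= b by apply Rdiv_le_0_compat; lra.
have sq : h s ^ 2 <= exp (a * ln (h r) + b * ln (h t)) ^ 2 by apply pow_incr.
have st : k * s = a * (k * r) + b * (k * t) by rewrite /a /b; field; lra.
have c := exp_convex_le a b (k * r + 2 * ln (h r)) (k * t + 2 * ln (h t)) ha hb ab.
have e2 : forall x, 0 < x -> exp (2 * ln x) = x ^ 2.
  move=> x hx; have -> : 2 * ln x = ln x + ln x by ring.
  rewrite exp_plus !exp_ln //; ring.
rewrite !exp_plus !e2 // in c.
have e3 : exp (k * s) * exp (a * ln (h r) + b * ln (h t)) ^ 2 =
  exp (a * (k * r + 2 * ln (h r))) * exp (b * (k * t + 2 * ln (h t))).
  rewrite st /= Rmult_1_r -!exp_plus; f_equal; ring.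
have c2 : exp (k * s) * h s ^ 2 <= a * (exp (k * r) * h r ^ 2) + b * (exp (k * t) * h t ^ 2).
  apply (Rle_trans _ (exp (k * s) * exp (a * ln (h r) + b * ln (h t)) ^ 2)).
    by apply Rmult_le_compat_l; [apply Rlt_le, exp_pos|].
  by rewrite e3.
have := Rmult_le_compat_l (t - r) _ _ ltac:(lra) c2.
have -> : (t - r) * (a * (exp (k * r) * h r ^ 2) + b * (exp (k * t) * h t ^ 2)) =
  (t - s) * (exp (k * r) * h r ^ 2) + (s - r) * (exp (k * t) * h t ^ 2) by rewrite /a /b; field; lra.
done.
Qed.

(** The second derivative of the tilt is [exp (k t) * (k^2 f + 2 k f1 + f2)], a quadratic polynomial
    in [k] whose discriminant is not positive. *)
Lemma tilt_convex_of_deriv f f1 f2 :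
  (forall t, 0 < t -> hderiv f t (f1 t)) -> (forall t, 0 < t -> hderiv f1 t (f2 t)) ->
  (forall t, 0 <= t -> hcont f t) ->
  (forall t, 0 < t -> 0 <= f t /\ 0 <= f2 t /\ f1 t ^ 2 <= f t * f2 t) -> tilt_convex f.
Proof.
move=> h1 h2 hc hp k.
apply (hconvex_of_deriv _ (fun t => exp (k * t) * (k * f t + f1 t))
  (fun t => exp (k * t) * (k * (k * f t + f1 t) + (k * f1 t + f2 t)))).
- move=> t ht; exact (hderiv_exp_mult k f t _ (h1 t ht)).
- move=> t ht; apply (hderiv_exp_mult k (fun t => k * f t + f1 t) t).
  by apply hderiv_plus; [apply hderiv_scal, h1|apply h2].
- move=> t ht; apply Rmult_le_pos; first exact/Rlt_le/exp_pos.
  case: (hp t ht) => p0 [p2 p1].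
  have -> : k * (k * f t + f1 t) + (k * f1 t + f2 t) = k ^ 2 * f t + 2 * k * f1 t + f2 t by ring.
  case: (Req_dec (f t) 0) => [z|n].
    rewrite z in p1 *. have -> : f1 t = 0 by nra. lra.
  (* Completing the square: [f] times the quadratic is [(k f + f1)^2 + (f f2 - f1^2)]. *)
  apply (Rmult_le_reg_l (f t)); first lra.
  rewrite Rmult_0_r.
  have := pow2_ge_0 (k * f t + f1 t); nra.
- move=> t ht; apply (hcont_mult (fun s => exp (k * s)) f); last exact: hc.
  exact: (hderiv_hcont _ _ _ (hderiv_exp k t)).
Qed.

Lemma tilt_convex_deriv_at_0 f f1 c : 0 < f 0 -> tilt_convex f ->
  (forall t, 0 <= t -> hderiv f t (f1 t)) -> hderiv f1 0 c -> f1 0 ^ 2 <= f 0 * c.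
Proof.
move=> hf0 hf h1 h2.
(* Only [f1] at [0] is differentiated a second time. Convexity of the tilt gives [G1 0 <= G1 s],
   both being compared with the slope over [[0, s]], so the derivative of [G1] at [0] is
   nonnegative; the factor [- 1] turns this into an upper bound. *)
have pos : forall k, 0 <= k * (k * f 0 + f1 0) + (k * f1 0 + c).
  move=> k; set G1 := fun t => exp (k * t) * (k * f t + f1 t).
  have hG := hf k.
  have hG1 : hderiv G1 0 (exp (k * 0) * (k * (k * f 0 + f1 0) + (k * f1 0 + c))).
    apply (hderiv_exp_mult k (fun t => k * f t + f1 t) 0).
    by apply hderiv_plus => //; apply hderiv_scal, h1; lra.
  rewrite Rmult_0_r exp_0 Rmult_1_l in hG1.
  have hneg : - 1 * (k * (k * f 0 + f1 0) + (k * f1 0 + c)) <= 0; last lra.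
  apply (hderiv_le_slope (fun t => - 1 * G1 t) 0 1 _ 0); try lra.
    exact: hderiv_scal.
  move=> s hs.
  have s1 := hconvex_slope_l _ 0 s _ hG ltac:(lra) (proj1 hs) (hderiv_exp_mult k f 0 _ (h1 0 ltac:(lra))).
  have s2 := hconvex_slope_r _ 0 s _ hG ltac:(lra) (proj1 hs) (hderiv_exp_mult k f s _ (h1 s ltac:(lra))).
  rewrite /G1; lra.
(* The minimiser of the quadratic in [k], where its nonnegativity is the discriminant inequality. *)
have := pos (- f1 0 / f 0).
set k := - f1 0 / f 0.
have e : k * f 0 + f1 0 = 0 by rewrite /k; field; lra.
rewrite e Rmult_0_r Rplus_0_l => h.
have := Rmult_le_compat_l _ _ _ (Rlt_le _ _ hf0) h.
have -> : f 0 * (k * f1 0 + c) = (k * f 0) * f1 0 + f 0 * c by ring.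
have -> : k * f 0 = - f1 0 by lra.
lra.
Qed.

(** * Mean value property *)

Definition eI (a : R) : C := (cos a, sin a).

Lemma eI_plus a b : eI (a + b) = Cmult (eI a) (eI b).
Proof. by rewrite /eI cos_plus sin_plus /Cmult /=; f_equal; ring. Qed.

Lemma Cmod_eI a : Cmod (eI a) = 1.
Proof.
rewrite /Cmod /eI /=; have -> : cos a * (cos a * 1) + sin a * (sin a * 1) = 1.
  have := sin2_cos2 a; rewrite /Rsqr; lra.
exact: sqrt_1.
Qed.

Lemma Cmod_le_Re_Im z : Cmod z <= Rabs (Re z) + Rabs (Im z).
Proof.
have {1}-> : z = Cplus (Re z, 0) (0, Im z) by case: z => a b; rewrite /Cplus /=; f_equal; ring.
apply (Rle_trans _ _ _ (Cmod_triangle _ _)); right; f_equal.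
  exact: Cmod_R.
rewrite /Cmod /=; have -> : 0 * (0 * 1) + Im z * (Im z * 1) = (Im z)² by rewrite /Rsqr /=; ring.
exact: sqrt_Rsqr_abs.
Qed.

Lemma Re_le_Cmod z : Rabs (Re z) <= Cmod z.
Proof. apply (Rle_trans _ _ _ (Rmax_l _ (Rabs (snd z)))); exact: Rmax_Cmod. Qed.

Lemma Im_le_Cmod z : Rabs (Im z) <= Cmod z.
Proof. apply (Rle_trans _ _ _ (Rmax_r (Rabs (fst z)) _)); exact: Rmax_Cmod. Qed.

Definition cderiv (g : C -> C) (z l : C) : Prop :=
  forall eps, 0 < eps -> exists d, 0 < d /\ forall w, Cmod (w - z) < d ->
    Cmod (g w - g z - (w - z) * l) <= eps * Cmod (w - z).

Definition ccont (g : C -> C) (z : C) : Prop :=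
  forall eps, 0 < eps -> exists d, 0 < d /\ forall w, Cmod (w - z) < d -> Cmod (g w - g z) < eps.

Definition rcderiv (u : R -> C) (t : R) (c : C) : Prop :=
  is_derive (fun s => Re (u s)) t (Re c) /\ is_derive (fun s => Im (u s)) t (Im c).

Lemma rcderiv_eps u t c : rcderiv u t c <->
  forall eps, 0 < eps -> exists d, 0 < d /\ forall s, Rabs (s - t) < d ->
    Cmod (u s - u t - RtoC (s - t) * c) <= eps * Rabs (s - t).
Proof.
have re s : Re (u s - u t - RtoC (s - t) * c)%C = Re (u s) - Re (u t) - (s - t) * Re c.
  by rewrite /Re /Cminus /Cplus /Copp /Cmult /=; ring.
have im s : Im (u s - u t - RtoC (s - t) * c)%C = Im (u s) - Im (u t) - (s - t) * Im c.
  by rewrite /Im /Cminus /Cplus /Copp /Cmult /=; ring.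
split.
  case=> /is_derive_eps h1 /is_derive_eps h2 eps he.
  case: (h1 (eps / 2) ltac:(lra)) => d1 [hd1 b1]; case: (h2 (eps / 2) ltac:(lra)) => d2 [hd2 b2].
  exists (Rmin d1 d2); split; first exact: Rmin_pos.
  move=> s hs; move: (Rmin_l d1 d2) (Rmin_r d1 d2) => m1 m2.
  apply (Rle_trans _ _ _ (Cmod_le_Re_Im _)); rewrite re im.
  move: (b1 s ltac:(lra)) (b2 s ltac:(lra)); lra.
move=> h; split; apply is_derive_eps => eps he; case: (h eps he) => d [hd hb];
  exists d; split=> // s hs; rewrite -?re -?im; apply (Rle_trans _ (Cmod (u s - u t - RtoC (s - t) * c)));
  try exact: hb; [exact: Re_le_Cmod|exact: Im_le_Cmod].
Qed.

Lemma rcderiv_comp g u t c l : rcderiv u t c -> cderiv g (u t) l ->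
  rcderiv (fun s => g (u s)) t (l * c)%C.
Proof.
move=> /rcderiv_eps hu hg; apply rcderiv_eps => eps he.
set D := Cmod c + Cmod l + 2.
have hD : 2 <= D by rewrite /D; move: (Cmod_ge_0 c) (Cmod_ge_0 l); lra.
have he' : 0 < Rmin 1 (eps / D) by apply Rmin_pos; [lra|apply Rdiv_lt_0_compat; lra].
set e := Rmin 1 (eps / D) in he'.
have e1 : e <= 1 by apply Rmin_l.
have e2 : e * D <= eps.
  apply (Rle_trans _ (eps / D * D)); last by right; field; lra.
  apply Rmult_le_compat_r; [lra|exact: Rmin_r].
case: (hg e he') => d1 [hd1 b1]; case: (hu e he') => d2 [hd2 b2].
have hd3 : 0 < d1 / D by apply Rdiv_lt_0_compat; lra.
exists (Rmin d2 (d1 / D)); split; first exact: Rmin_pos.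
move=> s hs; move: (Rmin_l d2 (d1 / D)) (Rmin_r d2 (d1 / D)) => m1 m2.
have c2 := b2 s ltac:(lra).
have p := Rabs_pos (s - t).
have c3 : Cmod (u s - u t) <= (e + Cmod c) * Rabs (s - t).
  have -> : (u s - u t = (u s - u t - RtoC (s - t) * c) + RtoC (s - t) * c)%C by ring.
  apply (Rle_trans _ _ _ (Cmod_triangle _ _)); rewrite Cmod_mult Cmod_R; lra.
have c4 : (e + Cmod c) * Rabs (s - t) <= D * Rabs (s - t).
  apply Rmult_le_compat_r => //; rewrite /D; move: (Cmod_ge_0 l); lra.
have c5 : Cmod (u s - u t) < d1.
  apply (Rle_lt_trans _ (D * Rabs (s - t))); first lra.
  apply (Rlt_le_trans _ (D * (d1 / D))); last by right; field; lra.
  apply Rmult_lt_compat_l; lra.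
have c1 := b1 (u s) c5.
have -> : (g (u s) - g (u t) - RtoC (s - t) * (l * c) =
  (g (u s) - g (u t) - (u s - u t) * l) + l * (u s - u t - RtoC (s - t) * c))%C by ring.
apply (Rle_trans _ _ _ (Cmod_triangle _ _)); rewrite Cmod_mult.
have q := Rmult_le_compat_l _ _ _ (Cmod_ge_0 l) c2.
have q2 := Rmult_le_compat_l _ _ _ (Rlt_le _ _ he') c3.
apply (Rle_trans _ (e * D * Rabs (s - t))); last by apply Rmult_le_compat_r.
have q3 : e * (e * Rabs (s - t)) <= e * (1 * Rabs (s - t)).
  apply Rmult_le_compat_l; first lra. apply Rmult_le_compat_r; lra.
have q4 : 0 <= e * Rabs (s - t) by apply Rmult_le_pos; lra.
rewrite /D; nra.
Qed.

Lemma is_derive_val (f : R -> R) t l l' : l = l' -> is_derive f t l -> is_derive f t l'.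
Proof. by move=> ->. Qed.

Lemma rcderiv_mult u v t a b : rcderiv u t a -> rcderiv v t b ->
  rcderiv (fun s => u s * v s)%C t (a * v t + u t * b)%C.
Proof.
case=> u1 u2 [v1 v2]; split.
  apply: (is_derive_ext (fun s => Re (u s) * Re (v s) - Im (u s) * Im (v s))) => //.
  have := is_derive_minus _ _ t _ _ (is_derive_mult _ _ t _ _ u1 v1 Rmult_comm)
    (is_derive_mult _ _ t _ _ u2 v2 Rmult_comm).
  apply is_derive_val; rewrite /minus /plus /opp /mult /Re /Im /=; ring.
apply: (is_derive_ext (fun s => Re (u s) * Im (v s) + Im (u s) * Re (v s))) => //.
have := is_derive_plus _ _ t _ _ (is_derive_mult _ _ t _ _ u1 v2 Rmult_comm)
  (is_derive_mult _ _ t _ _ u2 v1 Rmult_comm).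
apply is_derive_val; rewrite /plus /opp /mult /Re /Im /=; ring.
Qed.

Lemma rcderiv_eI k t : rcderiv (fun s => eI (k * s)) t (Cmult (0, k) (eI (k * t))).
Proof. by split; rewrite /eI /Re /Im /=; auto_derive => //; ring. Qed.

Lemma eI_cont t e : 0 < e -> exists d, 0 < d /\ forall v, Rabs (v - t) < d -> Cmod (eI v - eI t) < e.
Proof.
move=> he.
have /rcderiv_eps h := rcderiv_eI 1 t.
case: (h 1 Rlt_0_1) => d [hd hb].
exists (Rmin d (e / 3)); split; first by apply Rmin_pos; lra.
move=> v hv; move: (Rmin_l d (e / 3)) (Rmin_r d (e / 3)) => m1 m2.
have := hb v ltac:(lra).
rewrite !Rmult_1_l.
set c := Cmult (0, 1) _.
have hc : Cmod c = 1.
  rewrite Cmod_mult Cmod_eI Rmult_1_r /Cmod /=.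
  have -> : 0 * (0 * 1) + 1 * (1 * 1) = 1 by ring.
  exact: sqrt_1.
have E : (eI v - eI t = (eI v - eI t - RtoC (v - t) * c) + RtoC (v - t) * c)%C by ring.
move=> h1; rewrite E; apply (Rle_lt_trans _ _ _ (Cmod_triangle _ _)).
rewrite Cmod_mult Cmod_R hc; lra.
Qed.

Lemma rcderiv_circle r t : rcderiv (fun s => Cmult (RtoC r) (eI s)) t (Cmult (0, r) (eI t)).
Proof. by split; rewrite /eI /Re /Im /=; auto_derive => //; ring. Qed.

Lemma rcderiv_ray r t : rcderiv (fun s => Cmult (RtoC s) (eI t)) r (eI t).
Proof. by split; rewrite /eI /Re /Im /=; auto_derive => //; ring. Qed.

Lemma rcderiv_continuous_Re u t c : rcderiv u t c -> continuous (fun s => Re (u s)) t.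
Proof. case=> h _; apply: ex_derive_continuous; by eexists; exact: h. Qed.

Lemma Cmod_circle r t : Cmod (Cmult (RtoC r) (eI t)) = Rabs r.
Proof. by rewrite Cmod_mult Cmod_R Cmod_eI Rmult_1_r. Qed.

Lemma ccont_of_cderiv g z l : cderiv g z l -> ccont g z.
Proof.
move=> hg eps he.
case: (hg 1 Rlt_0_1) => d [hd hb].
have hl := Cmod_ge_0 l.
have he' : 0 < eps / (Cmod l + 2) by apply Rdiv_lt_0_compat; lra.
exists (Rmin d (eps / (Cmod l + 2))); split; first by apply Rmin_pos.
move=> w hw; move: (Rmin_l d (eps / (Cmod l + 2))) (Rmin_r d (eps / (Cmod l + 2))) => m1 m2.
have h1 := hb w ltac:(lra).
have -> : (g w - g z = (g w - g z - (w - z) * l) + (w - z) * l)%C by ring.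
apply (Rle_lt_trans _ _ _ (Cmod_triangle _ _)); rewrite Cmod_mult.
have h3 : Cmod (w - z) * (Cmod l + 2) < eps.
  apply (Rlt_le_trans _ (eps / (Cmod l + 2) * (Cmod l + 2))); last by right; field; lra.
  apply Rmult_lt_compat_r; lra.
move: (Cmod_ge_0 (w - z)); nra.
Qed.

Section MeanValue.
Context (g g1 : C -> C)
  (g_deriv : forall z, Cmod z < 1 -> cderiv g z (g1 z))
  (g1_cont : forall z, Cmod z < 1 -> ccont g1 z).

Let f (s t : R) : R := Re (g (Cmult (RtoC s) (eI t))).

Let f_derive s t : Rabs s < 1 ->
  is_derive (fun u => f u t) s (Re (g1 (Cmult (RtoC s) (eI t)) * eI t)%C).
Proof.
move=> hs; apply (rcderiv_comp g (fun u => Cmult (RtoC u) (eI t))).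
  exact: rcderiv_ray.
by apply g_deriv; rewrite Cmod_circle.
Qed.

Let near_disc s : Rabs s < 1 -> locally s (fun u => Rabs u < 1).
Proof.
move=> hs; have hp : 0 < 1 - Rabs s by lra.
exists (mkposreal _ hp) => u; rewrite /ball /= /AbsRing_ball /abs /minus /plus /opp /= => hu.
have := Rabs_triang (u + - s) s; have -> : u + - s + s = u by ring. lra.
Qed.

Let f_ex_RInt s : Rabs s < 1 -> ex_RInt (fun t => f s t) 0 (2 * PI).
Proof.
move=> hs; apply (ex_RInt_continuous (V := R_CompleteNormedModule)) => t _.
apply (rcderiv_continuous_Re (fun t => g (Cmult (RtoC s) (eI t))) t (g1 (Cmult (RtoC s) (eI t)) * Cmult (0, s) (eI t))%C).
apply (rcderiv_comp g); first exact: rcderiv_circle.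
by apply g_deriv; rewrite Cmod_circle.
Qed.

Let Df_cont s t : Rabs s < 1 ->
  continuity_2d_pt (fun u v => Re (g1 (Cmult (RtoC u) (eI v)) * eI v)%C) s t.
Proof.
move=> hs eps.
set z := Cmult (RtoC s) (eI t).
have hz : Cmod z < 1 by rewrite Cmod_circle.
have heps := cond_pos eps.
set e := Rmin 1 (eps / (Cmod (g1 z) + 3)).
have hg := Cmod_ge_0 (g1 z).
have he : 0 < e by apply Rmin_pos; [lra|apply Rdiv_lt_0_compat; lra].
have e1 : e <= 1 by apply Rmin_l.
have e2 : e * (Cmod (g1 z) + 3) <= eps.
  apply (Rle_trans _ (eps / (Cmod (g1 z) + 3) * (Cmod (g1 z) + 3))); last by right; field; lra.
  apply Rmult_le_compat_r; [lra|exact: Rmin_r].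
case: (g1_cont z hz e he) => d [hd hb].
set m := Rmin e (d / 2).
have hm : 0 < m by apply Rmin_pos; lra.
have m1 : m <= e by apply Rmin_l. have m2 : m <= d / 2 by apply Rmin_r.
case: (eI_cont t m hm) => d' [hd' hb'].
have hd2 : 0 < Rmin m d' by apply Rmin_pos.
exists (mkposreal _ hd2) => u v /= hu hv.
move: (Rmin_l m d') (Rmin_r m d') => k1 k2.
have hev := hb' v ltac:(lra).
have hw : Cmod (Cmult (RtoC u) (eI v) - z) < d.
  have -> : (Cmult (RtoC u) (eI v) - z = RtoC (u - s) * eI v + RtoC s * (eI v - eI t))%C
    by rewrite /z RtoC_minus; ring.
  apply (Rle_lt_trans _ _ _ (Cmod_triangle _ _)).
  rewrite !Cmod_mult !Cmod_R Cmod_eI; move: (Rabs_pos s) (Cmod_ge_0 (eI v - eI t)); nra.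
have hgw := hb _ hw.
set w := Cmult (RtoC u) (eI v) in hw hgw *.
apply (Rle_lt_trans _ (Cmod ((g1 w - g1 z) * eI v + g1 z * (eI v - eI t)))).
  have -> : Re (g1 w * eI v)%C - Re (g1 z * eI t)%C = Re ((g1 w - g1 z) * eI v + g1 z * (eI v - eI t))%C.
    rewrite /Re /Cminus /Cplus /Copp /Cmult /=; ring.
  exact: Re_le_Cmod.
apply (Rle_lt_trans _ _ _ (Cmod_triangle _ _)).
rewrite !Cmod_mult Cmod_eI; nra.
Qed.

(** Differentiation in the radius: the derivative of the integrand is [Re (g'(s e^{it}) e^{it})],
    which is also the [t]-derivative of [Im g(s e^{it}) / s]. The latter is periodic, so the
    integral does not depend on [s] and can be evaluated at [s = 0]. *)
Lemma mean_value s : 0 <= s < 1 ->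
  RInt (fun t => Re (g (Cmult (RtoC s) (eI t)))) 0 (2 * PI) = 2 * PI * Re (g (RtoC 0)).
Proof.
move=> hs.
have hPI := PI_RGT_0.
have zero_int u : Rabs u < 1 ->
    is_RInt (fun t => Re (g1 (Cmult (RtoC u) (eI t)) * eI t)%C) 0 (2 * PI) 0.
  move=> hu.
  have per : eI (2 * PI) = eI 0 by rewrite /eI cos_2PI sin_2PI cos_0 sin_0.
  (* At [u = 0] the antiderivative with the factor [/ u] is meaningless; there the integrand is
     [Re (g'(0) e^{it})], which is integrated directly. *)
  case: (Req_dec u 0) => [z|n].
    have hh : is_RInt (fun t => Re (g1 (RtoC 0) * eI t)%C) 0 (2 * PI)
       (minus (Re (Cmult (0, -1) (g1 (RtoC 0) * eI (2 * PI)))) (Re (Cmult (0, -1) (g1 (RtoC 0) * eI 0)))).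
      apply (is_RInt_derive (fun t => Re (Cmult (0, -1) (g1 (RtoC 0) * eI t)))) => t _.
        by rewrite /eI /Re /=; auto_derive => //; ring.
      apply: ex_derive_continuous; rewrite /eI /Re /=; auto_derive => //.
    rewrite per /minus plus_opp_r in hh.
    apply: is_RInt_ext hh => t _; rewrite z; do 3 f_equal; ring.
  have hh : is_RInt (fun t => Re (g1 (Cmult (RtoC u) (eI t)) * eI t)%C) 0 (2 * PI)
     (minus (/ u * (Im (g (Cmult (RtoC u) (eI (2 * PI)))))) (/ u * (Im (g (Cmult (RtoC u) (eI 0)))))).
    apply (is_RInt_derive (fun t => / u * Im (g (Cmult (RtoC u) (eI t))))) => t _.
      have hz : Cmod (Cmult (RtoC u) (eI t)) < 1 by rewrite Cmod_circle.
      have [_ hd] := rcderiv_comp g (fun t => Cmult (RtoC u) (eI t)) t _ _ (rcderiv_circle u t) (g_deriv _ hz).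
      have := is_derive_scal _ t (/ u) _ hd.
      apply is_derive_val; rewrite /Re /Im /Cmult /=; field => //.
    move=> P [eps hP].
    case: (Df_cont u t hu eps) => d hd.
    exists d => v hv; apply hP.
    apply (hd u v) => //; rewrite Rminus_diag Rabs_R0; exact: cond_pos.
  by rewrite per /minus plus_opp_r in hh.
have D0 u : Rabs u < 1 -> is_derive (fun s => RInt (fun t => f s t) 0 (2 * PI)) u 0.
  move=> hu.
  have E : RInt (fun t => Derive (fun s => f s t) u) 0 (2 * PI) = 0.
    apply is_RInt_unique; apply: is_RInt_ext (zero_int u hu) => t _.
    by apply eq_sym, is_derive_unique, f_derive.
  apply: (is_derive_val _ _ _ _ E); apply: is_derive_RInt_param.
  - case: (near_disc u hu) => d hd; exists d => v hv t _.
    by eexists; apply f_derive, hd.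
  - move=> t _.
    apply: (continuity_2d_pt_ext_loc (fun u v => Re (g1 (Cmult (RtoC u) (eI v)) * eI v)%C)); last exact: Df_cont.
    case: (near_disc u hu) => d hd; exists d => v w hv hw.
    apply eq_sym, is_derive_unique, f_derive, hd; exact: hv.
  - case: (near_disc u hu) => d hd; exists d => v hv.
    exact/f_ex_RInt/hd.
case: (MVT_gen (fun s => RInt (fun t => f s t) 0 (2 * PI)) 0 s (fun _ => 0)).
- rewrite Rmin_left ?Rmax_right; try lra. move=> x hx; apply D0; rewrite Rabs_pos_eq; lra.
- rewrite Rmin_left ?Rmax_right; try lra. move=> x hx.
  apply derivable_continuous_pt; exists 0; apply is_derive_Reals, D0; rewrite Rabs_pos_eq; lra.
move=> c [_ e].
have e0 : RInt (fun t => f 0 t) 0 (2 * PI) = 2 * PI * Re (g (RtoC 0)).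
  transitivity (RInt (fun _ => Re (g (RtoC 0))) 0 (2 * PI)).
    by apply RInt_ext => t _; rewrite /f; do 2 f_equal; ring.
  rewrite RInt_const /scal /= /mult /=; ring.
rewrite -e0; move: e; rewrite /f; lra.
Qed.

End MeanValue.

(** * Circle means of resolvent powers *)

(** Multiplying [x] by the conjugate of [inner x y] makes the inner product real, so [rin_le]
    applies. *)
Lemma Cmod_inner_le {H : HilbertSpace} (x y : H) : Cmod (inner x y) <= norm x * norm y.
Proof.
have h := rin_le (scal (Cconj (inner x y)) x) y.
rewrite norm_scalC Cmod_conj /rin inner_scal in h.
have e : Re (Cconj (inner x y) * inner x y)%C = Cmod (inner x y) ^ 2.
  rewrite Cmod2_alt /Cmult /Cconj /Re /Im /=; ring.
rewrite e in h.
have p := Cmod_ge_0 (inner x y).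
case: (Req_dec (Cmod (inner x y)) 0) => [->|n].
  by apply Rmult_le_pos; apply norm_ge_0.
apply (Rmult_le_reg_l (Cmod (inner x y))); lra.
Qed.

Definition hcderiv {H : HilbertSpace} (X : C -> H) (z : C) (Y : H) : Prop :=
  forall eps, 0 < eps -> exists d, 0 < d /\ forall w, Cmod (w - z) < d ->
    norm (minus (minus (X w) (X z)) (scal (w - z)%C Y)) <= eps * Cmod (w - z).

Lemma hcderiv_inner {H : HilbertSpace} (X : C -> H) z Y (y : H) :
  hcderiv X z Y -> cderiv (fun w => inner (X w) y) z (inner Y y).
Proof.
move=> hX eps he.
have hy := norm_ge_0 y.
case: (hX (eps / (norm y + 1))) => [|d [hd hb]]; first by apply Rdiv_lt_0_compat; lra.
exists d; split=> // w hw.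
have -> : (inner (X w) y - inner (X z) y - (w - z) * inner Y y)%C =
   inner (minus (minus (X w) (X z)) (scal (w - z)%C Y)) y.
  rewrite /minus !(inner_plus, inner_opp_l, inner_scal); ring.
apply (Rle_trans _ _ _ (Cmod_inner_le _ _)).
apply (Rle_trans _ (eps / (norm y + 1) * Cmod (w - z) * (norm y + 1))).
  apply Rmult_le_compat; try exact: norm_ge_0; [exact: hb|lra].
right; field; lra.
Qed.

Lemma hcderiv_ext {H : HilbertSpace} (X X' : C -> H) z Y Y' :
  (forall w, X w = X' w) -> Y = Y' -> hcderiv X z Y -> hcderiv X' z Y'.
Proof. by move=> E <- h eps he; case: (h eps he) => d [hd hb]; exists d; split=> // w hw; rewrite -!E; apply hb. Qed.

(** For holomorphic [X] this is [2 PI r^j] times the real part of the [j]-th Taylor coefficient of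
    [inner (X z) y]: Cauchy's formula tested against [y]. *)
Definition circle_mean {H : HilbertSpace} (X : C -> H) (y : H) (r : R) (j : nat) : R :=
  RInt (fun t => Re (eI (- INR j * t) * inner (X (Cmult (RtoC r) (eI t))) y)%C) 0 (2 * PI).

Definition holomorphic {H : HilbertSpace} (X : C -> H) : Prop :=
  forall z, Cmod z < 1 -> exists Y, hcderiv X z Y.

Section CircleMean.
Context {H : HilbertSpace}.
Implicit Types (X P Q : C -> H) (y v : H).

Lemma circle_mean_ex X y r j : 0 <= r < 1 -> holomorphic X ->
  ex_RInt (fun t => Re (eI (- INR j * t) * inner (X (Cmult (RtoC r) (eI t))) y)%C) 0 (2 * PI).
Proof.
move=> hr hX; apply (ex_RInt_continuous (V := R_CompleteNormedModule)) => t _.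
have hz : Cmod (Cmult (RtoC r) (eI t)) < 1 by rewrite Cmod_circle Rabs_pos_eq; lra.
case: (hX _ hz) => Y hY.
apply: rcderiv_continuous_Re; apply: rcderiv_mult; first exact: rcderiv_eI.
apply: (rcderiv_comp (fun w => inner (X w) y)); first exact: rcderiv_circle.
exact: hcderiv_inner hY.
Qed.

(** On the circle [z = r e^{it}], so multiplication by [z] shifts the index by one and leaves a
    factor [r]. This allows coefficients to be computed by induction from a functional relation. *)
Lemma circle_mean_rec X P Q y r j : 0 <= r < 1 -> holomorphic P -> holomorphic Q ->
  (forall z, Cmod z < 1 -> X z = plus (P z) (scal z (Q z))) ->
  circle_mean X y r (S j) = circle_mean P y r (S j) + r * circle_mean Q y r j.
Proof.
move=> hr hP hQ E.
have h1 := RInt_correct _ _ _ (circle_mean_ex P y r (S j) hr hP).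
have h2 := is_RInt_scal _ _ _ r _ (RInt_correct _ _ _ (circle_mean_ex Q y r j hr hQ)).
apply is_RInt_unique; apply: is_RInt_ext (is_RInt_plus _ _ _ _ _ _ h1 h2) => t _.
rewrite E ?Cmod_circle ?Rabs_pos_eq; try lra.
rewrite inner_plus inner_scal.
have -> : eI (- INR j * t) = Cmult (eI (- INR (S j) * t)) (eI t).
  rewrite -eI_plus; f_equal; rewrite S_INR; ring.
rewrite /plus /scal /= /mult /= /Re /Cmult /Cplus /=; ring.
Qed.

Lemma circle_mean_const v y r j : circle_mean (fun _ => v) y r (S j) = 0.
Proof.
set k := INR (S j); have hk : k <> 0 by apply not_0_INR.
set c := inner v y.
have hh : is_RInt (fun t => Re (eI (- k * t) * c)%C) 0 (2 * PI)
   (minus (Re (Cmult (0, / k) (eI (- k * (2 * PI)) * c))) (Re (Cmult (0, / k) (eI (- k * 0) * c)))).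
  apply (is_RInt_derive (fun t => Re (Cmult (0, / k) (eI (- k * t) * c)))) => t _.
    by rewrite /eI /Re /=; auto_derive => //; field.
  apply: ex_derive_continuous; rewrite /eI /Re /=; auto_derive => //.
have per : eI (- k * (2 * PI)) = eI (- k * 0).
  have -> : - k * (2 * PI) = - (0 + 2 * INR (S j) * PI) by rewrite /k; ring.
  by rewrite /eI !cos_neg !sin_neg cos_period sin_period Rmult_0_r cos_0 sin_0 Ropp_0.
rewrite per /minus plus_opp_r in hh.
exact: is_RInt_unique hh.
Qed.

End CircleMean.

(* Modelled on [F z = l0 (l0 (1 - z) + A)^-1] with [l0 > 0]: [F 0] is the normalised
   resolvent at [l0], and [z |-> l0 (1 - z)] maps the unit disc into the right half-plane. *)
Record disc_family {H : HilbertSpace} (F : C -> H -> H) (K : R) : Prop := {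
  disc_K : 1 <= K;
  disc_plus : forall z x y, Cmod z < 1 -> F z (plus x y) = plus (F z x) (F z y);
  disc_scal : forall z a x, Cmod z < 1 -> F z (scal a x) = scal a (F z x);
  disc_id : forall z w x, Cmod z < 1 -> Cmod w < 1 ->
    minus (F z x) (F w x) = scal (z - w)%C (F z (F w x));
  disc_bound : forall z x, Cmod z < 1 -> Cmod (1 - z)%C * norm (F z x) <= K * norm x }.

(** * Taylor coefficients of the powers of a disc family *)

Section DiscFamily.
Context {H : HilbertSpace} {F : C -> H -> H} {K : R} (hF : disc_family F K).
Let K_ge_1 := disc_K _ _ hF.
Let F_plus := disc_plus _ _ hF.
Let F_scal := disc_scal _ _ hF.
Let F_id := disc_id _ _ hF.
Let F_bound := disc_bound _ _ hF.

Let J := F (RtoC 0).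

Lemma Cmod_0_lt_1 : Cmod (RtoC 0) < 1.
Proof. rewrite Cmod_0; lra. Qed.
Let h0 := Cmod_0_lt_1.

Lemma F_opp z x : Cmod z < 1 -> F z (opp x) = opp (F z x).
Proof. by move=> hz; rewrite -scal_opp_one F_scal // scal_opp_one. Qed.

Lemma F_minus z x y : Cmod z < 1 -> F z (minus x y) = minus (F z x) (F z y).
Proof. by move=> hz; rewrite /minus F_plus // F_opp. Qed.

(** Exchange the roles of [z] and [w] in [disc_id] and cancel [z - w]. *)
Lemma F_comm z w x : Cmod z < 1 -> Cmod w < 1 -> F z (F w x) = F w (F z x).
Proof.
move=> hz hw.
case: (excluded_middle_informative (z = w)) => [->//|n].
have n' : (z - w)%C <> RtoC 0.
  by move=> e; apply n; rewrite -[w]Cplus_0_l -e; ring.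
have E : scal (z - w)%C (F z (F w x)) = scal (z - w)%C (F w (F z x)).
  rewrite -F_id //.
  have -> : minus (F z x) (F w x) = opp (minus (F w x) (F z x)) by rewrite opp_minus.
  rewrite F_id //; hvec.
exact: scal_cancel n' E.
Qed.

(** One unrolling of the geometric series [F z = J + z J^2 + z^2 J^3 + ...]; the series itself never
    has to be summed. *)
Lemma F_step z x : Cmod z < 1 -> F z x = plus (J x) (scal z (F z (J x))).
Proof.
move=> hz.
have E := F_id z (RtoC 0) x hz h0.
have -> : F z x = plus (J x) (minus (F z x) (F (RtoC 0) x)) by rewrite /J; hvec.
rewrite E /J; do 2 f_equal; ring.
Qed.

Lemma F_local_bound z : Cmod z < 1 -> exists B d, 0 < B /\ 0 < d /\
  forall w x, Cmod (w - z) < d -> Cmod w < 1 /\ norm (F w x) <= B * norm x.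
Proof.
move=> hz; set a := (1 - Cmod z) / 2.
have ha : 0 < a by rewrite /a; lra.
exists (K / a), a; split; first by apply Rdiv_lt_0_compat; lra.
split=> // w x hw.
have h1 : Cmod w <= Cmod z + Cmod (w - z).
  have {1}-> : w = (z + (w - z))%C by ring. exact: Cmod_triangle.
have hw1 : Cmod w < 1 by rewrite /a in hw; lra.
split=> //.
have h2 : a <= Cmod (1 - w)%C.
  have h3 : Cmod (RtoC 1) <= Cmod (1 - w)%C + Cmod w.
    have {1}-> : RtoC 1 = ((1 - w) + w)%C by ring. exact: Cmod_triangle.
  rewrite Cmod_1 in h3; rewrite /a in hw *; lra.
have h4 := F_bound w x hw1.
apply (Rmult_le_reg_l a) => //.
have -> : a * (K / a * norm x) = K * norm x by field; lra.
apply (Rle_trans _ _ _ (Rmult_le_compat_r _ _ _ (norm_ge_0 _) h2)); exact: h4.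
Qed.

(** The product rule combined with [F' = F^2], the infinitesimal form of [disc_id]. The remainder
    consists of [F w] applied to the remainder of [X] and of a term quadratic in [w - z], both
    controlled by a local bound on [F]. *)
Lemma F_hcderiv (X : C -> H) z (Y : H) : Cmod z < 1 -> hcderiv X z Y ->
  hcderiv (fun w => F w (X w)) z (plus (F z (F z (X z))) (F z Y)).
Proof.
move=> hz hX eps he.
case: (F_local_bound z hz) => B [d0 [hB [hd0 hb0]]].
set D := norm (F z (F z (X z))) + norm (F z Y).
have hD : 0 <= D by rewrite /D; move: (norm_ge_0 (F z (F z (X z)))) (norm_ge_0 (F z Y)); lra.
case: (hX (eps / (2 * B))) => [|d1 [hd1 hb1]]; first by apply Rdiv_lt_0_compat; lra.
have hd2 : 0 < eps / (2 * B * (D + 1)) by apply Rdiv_lt_0_compat => //; apply Rmult_lt_0_compat; lra.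
exists (Rmin d0 (Rmin d1 (eps / (2 * B * (D + 1))))); split; first by repeat apply Rmin_pos.
move=> w hw.
have [l0 [l1 l2]] : Cmod (w - z) < d0 /\ Cmod (w - z) < d1 /\ Cmod (w - z) < eps / (2 * B * (D + 1)).
  move: (Rmin_l d0 (Rmin d1 (eps / (2 * B * (D + 1))))) (Rmin_r d0 (Rmin d1 (eps / (2 * B * (D + 1)))))
    (Rmin_l d1 (eps / (2 * B * (D + 1)))) (Rmin_r d1 (eps / (2 * B * (D + 1)))); lra.
have hw1 := proj1 (hb0 w zero l0).
set U := minus (minus (X w) (X z)) (scal (w - z)%C Y).
have E : minus (minus (F w (X w)) (F z (X z))) (scal (w - z)%C (plus (F z (F z (X z))) (F z Y))) =
  plus (F w U) (scal (w - z)%C (scal (w - z)%C (F w (plus (F z (F z (X z))) (F z Y))))).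
  have shift : forall v, F w v = plus (F z v) (scal (w - z)%C (F w (F z v))).
    move=> v; rewrite -F_id //; hvec.
  rewrite /U !F_minus // F_scal // F_plus // (shift (X z)) (shift (F z (X z))) (shift Y); hvec.
rewrite E; apply (Rle_trans _ _ _ (norm_plus_le _ _)).
rewrite !norm_scalC.
have q1 : norm (F w U) <= eps / 2 * Cmod (w - z).
  apply (Rle_trans _ _ _ (proj2 (hb0 w U l0))).
  apply (Rle_trans _ (B * (eps / (2 * B) * Cmod (w - z)))).
    apply Rmult_le_compat_l; [lra|exact: hb1].
  right; field; lra.
have q2 : norm (F w (plus (F z (F z (X z))) (F z Y))) <= B * (D + 1).
  apply (Rle_trans _ _ _ (proj2 (hb0 w _ l0))).
  apply Rmult_le_compat_l; first lra.
  move: (norm_plus_le (F z (F z (X z))) (F z Y)); rewrite /D; lra.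
have q3 : Cmod (w - z) * norm (F w (plus (F z (F z (X z))) (F z Y))) <= eps / 2.
  apply (Rle_trans _ (eps / (2 * B * (D + 1)) * (B * (D + 1)))).
    apply Rmult_le_compat; try lra; [exact: Cmod_ge_0|exact: norm_ge_0].
  right; field; lra.
have := Rmult_le_compat_l _ _ _ (Cmod_ge_0 (w - z)) q3; lra.
Qed.

Lemma const_hcderiv (x : H) z : hcderiv (fun _ => x) z zero.
Proof.
move=> eps he; exists 1; split; first lra. move=> w hw.
have -> : minus (minus x x) (scal (w - z)%C (zero : H)) = scal (RtoC 0) x.
  by apply inner_ext => v; rewrite /minus !(inner_plus, inner_scal, inner_opp_l, inner_zero_l); ring.
rewrite norm_scalR Rabs_R0 Rmult_0_l; apply Rmult_le_pos; [lra|exact: Cmod_ge_0].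
Qed.

Lemma const_holomorphic (x : H) : holomorphic (fun _ => x).
Proof. move=> z _; eexists; exact: const_hcderiv. Qed.

Lemma F_holomorphic (X : C -> H) : holomorphic X -> holomorphic (fun w => F w (X w)).
Proof. move=> hX z hz; case: (hX z hz) => Y hY; eexists; exact: F_hcderiv hY. Qed.

(** The mean value property asks for a continuous derivative; holomorphy of [dX] supplies the
    continuity. *)
Lemma circle_mean_0 (X dX : C -> H) (y : H) r : 0 <= r < 1 ->
  (forall z, Cmod z < 1 -> hcderiv X z (dX z)) -> holomorphic dX ->
  circle_mean X y r 0 = 2 * PI * rin (X (RtoC 0)) y.
Proof.
move=> hr hX hdX.
rewrite /rin -(mean_value (fun z => inner (X z) y) (fun z => inner (dX z) y) _ _ r hr).
- apply RInt_ext => t _.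
  have -> : eI (- INR 0 * t) = RtoC 1 by rewrite /= Ropp_0 Rmult_0_l /eI cos_0 sin_0.
  by rewrite Cmult_1_l.
- move=> z hz; exact/hcderiv_inner/hX.
- move=> z hz; case: (hdX z hz) => Y hY; exact: ccont_of_cderiv (hcderiv_inner _ _ _ y hY).
Qed.

Lemma F1_hcderiv x z : Cmod z < 1 -> hcderiv (fun w => F w x) z (F z (F z x)).
Proof.
move=> hz; apply: hcderiv_ext (F_hcderiv _ _ _ hz (const_hcderiv x z)) => //.
have e : (zero : H) = scal (RtoC 0) zero by rewrite scal_zero_r.
rewrite {1}e F_scal //; hvec.
Qed.

Lemma F2_hcderiv x z : Cmod z < 1 ->
  hcderiv (fun w => F w (F w x)) z (scal (RtoC 2) (F z (F z (F z x)))).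
Proof.
move=> hz; apply: hcderiv_ext (F_hcderiv _ _ _ hz (F1_hcderiv x z hz)) => //.
apply inner_ext => v; rewrite inner_plus inner_scal; ring.
Qed.

Lemma F3_hcderiv x z : Cmod z < 1 ->
  hcderiv (fun w => F w (F w (F w x))) z (scal (RtoC 3) (F z (F z (F z (F z x))))).
Proof.
move=> hz; apply: hcderiv_ext (F_hcderiv _ _ _ hz (F2_hcderiv x z hz)) => //.
rewrite F_scal //; apply inner_ext => v; rewrite inner_plus !inner_scal.
have -> : RtoC 3 = (RtoC 1 + RtoC 2)%C by rewrite -RtoC_plus; f_equal; ring.
ring.
Qed.

Lemma holomorphic_F1 x : holomorphic (fun z => F z x).
Proof. apply F_holomorphic, const_holomorphic. Qed.
Lemma holomorphic_F2 x : holomorphic (fun z => F z (F z x)).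
Proof. apply F_holomorphic, holomorphic_F1. Qed.
Lemma holomorphic_F3 x : holomorphic (fun z => F z (F z (F z x))).
Proof. apply F_holomorphic, holomorphic_F2. Qed.

Lemma holomorphic_scal (c : C) (X : C -> H) : holomorphic X -> holomorphic (fun z => scal c (X z)).
Proof.
move=> hX z hz; case: (hX z hz) => Y hY; exists (scal c Y) => eps he.
have hc := Cmod_ge_0 c.
case: (hY (eps / (Cmod c + 1))) => [|d [hd hb]]; first by apply Rdiv_lt_0_compat; lra.
exists d; split=> // w hw.
have -> : minus (minus (scal c (X w)) (scal c (X z))) (scal (w - z)%C (scal c Y)) =
  scal c (minus (minus (X w) (X z)) (scal (w - z)%C Y)) by hvec.
rewrite norm_scalC.
apply (Rle_trans _ ((Cmod c + 1) * (eps / (Cmod c + 1) * Cmod (w - z)))).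
  apply Rmult_le_compat => //; [exact: norm_ge_0|lra|exact: hb].
right; field; lra.
Qed.

(** Since [F z = J (1 - z J)^-1], the [j]-th coefficient of [F^m] is [J^(j+m)] times the binomial
    coefficient of [j + m - 1] over [m - 1]. This and the next two lemmas are [m = 1, 2, 3]; the
    induction on [j] uses [F^m = F^(m-1) J + z F^m J], hence Pascal's rule. *)
Lemma circle_mean_F1 y r : 0 <= r < 1 -> forall j x,
  circle_mean (fun z => F z x) y r j = 2 * PI * r ^ j * rin (Nat.iter (j + 1) J x) y.
Proof.
move=> hr; elim=> [|j IH] x.
  rewrite (circle_mean_0 _ (fun z => F z (F z x))) //=; first by rewrite /J; ring.
    by move=> z hz; exact: F1_hcderiv.
  exact: holomorphic_F2.
rewrite (circle_mean_rec _ (fun _ => J x) (fun z => F z (J x))) //.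
- rewrite circle_mean_const IH Nat.iter_swap -[Nat.iter (S j + 1) J x]/(J (Nat.iter (j + 1) J x)) /=; ring.
- exact: const_holomorphic.
- exact: holomorphic_F1.
- move=> z hz; exact: F_step.
Qed.

Lemma circle_mean_F2 y r : 0 <= r < 1 -> forall j x,
  circle_mean (fun z => F z (F z x)) y r j =
  2 * PI * r ^ j * INR (j + 1) * rin (Nat.iter (j + 2) J x) y.
Proof.
move=> hr; elim=> [|j IH] x.
  rewrite (circle_mean_0 _ (fun z => scal (RtoC 2) (F z (F z (F z x))))) //=; first by rewrite /J; ring.
    by move=> z hz; exact: F2_hcderiv.
  exact/holomorphic_scal/holomorphic_F3.
rewrite (circle_mean_rec _ (fun z => F z (J x)) (fun z => F z (F z (J x)))) //.
- rewrite circle_mean_F1 // IH !Nat.iter_swap.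
  have -> : Nat.iter (S j + 2) J x = J (Nat.iter (j + 2) J x) by [].
  have -> : J (Nat.iter (S j + 1) J x) = J (Nat.iter (j + 2) J x).
    by congr J; congr (Nat.iter _ J x); lia.
  rewrite !plus_INR !S_INR /=; ring.
- exact: holomorphic_F1.
- exact: holomorphic_F2.
- move=> z hz; rewrite (F_step z (F z x) hz) /J (F_comm (RtoC 0) z) //.
Qed.

Lemma circle_mean_F3 y r : 0 <= r < 1 -> forall j x,
  circle_mean (fun z => F z (F z (F z x))) y r j =
  2 * PI * r ^ j * (INR (j + 1) * INR (j + 2) / 2) * rin (Nat.iter (j + 3) J x) y.
Proof.
move=> hr; elim=> [|j IH] x.
  rewrite (circle_mean_0 _ (fun z => scal (RtoC 3) (F z (F z (F z (F z x)))))) //=; first by rewrite /J; field.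
    by move=> z hz; exact: F3_hcderiv.
  exact/holomorphic_scal/F_holomorphic/holomorphic_F3.
rewrite (circle_mean_rec _ (fun z => F z (F z (J x))) (fun z => F z (F z (F z (J x))))) //.
- rewrite circle_mean_F2 // IH !Nat.iter_swap.
  have -> : Nat.iter (S j + 3) J x = J (Nat.iter (j + 3) J x) by [].
  have -> : J (Nat.iter (S j + 2) J x) = J (Nat.iter (j + 3) J x).
    by congr J; congr (Nat.iter _ J x); lia.
  rewrite !plus_INR !S_INR /=; field.
- exact: holomorphic_F2.
- exact: holomorphic_F3.
- move=> z hz; rewrite (F_step z (F z (F z x)) hz) /J !(F_comm (RtoC 0) z) //.
Qed.

End DiscFamily.

(** * Poisson kernel and estimates of circle means *)

Lemma one_minus_neq_0 z : Cmod z < 1 -> (1 - z)%C <> RtoC 0.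
Proof.
move=> hz e; have h : z = RtoC 1 by rewrite -[z]Cplus_0_l -e; ring.
by rewrite h Cmod_1 in hz; lra.
Qed.

Lemma Re_Cinv_mult w s : Cmod w ^ 2 <> 0 -> Re (/ w * RtoC s)%C = Re w * s / Cmod w ^ 2.
Proof.
rewrite Cmod2_alt; case: w => a b; rewrite /Cinv /Re /Im /Cmult /= => h; field => //.
all: try (move=> e; apply h; rewrite -e; ring).
Qed.

(* The scalar family [z |-> 1 / (1 - z)] is a disc family, whose mean value is the Poisson integral. *)
Lemma poisson_integral {H : HilbertSpace} (x : H) r : x <> zero -> 0 <= r < 1 ->
  is_RInt (fun t => (1 - r ^ 2) / Cmod (1 - Cmult (RtoC r) (eI t))%C ^ 2) 0 (2 * PI) (2 * PI).
Proof.
move=> hx hr.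
have hn : 0 < norm x ^ 2.
  case: (Req_dec (norm x) 0) => [/norm_eq_0//|n]; move: (norm_ge_0 x); nra.
pose F z (v : H) := scal (/ (1 - z))%C v.
have Fp z (v w : H) : Cmod z < 1 -> F z (plus v w) = plus (F z v) (F z w) by move=> _; rewrite /F; hvec.
have Fs z a (v : H) : Cmod z < 1 -> F z (scal a v) = scal a (F z v) by move=> _; rewrite /F; hvec.
have Fi z w (v : H) : Cmod z < 1 -> Cmod w < 1 -> minus (F z v) (F w v) = scal (z - w)%C (F z (F w v)).
  move=> hz hw; rewrite /F; apply inner_ext => u; hinner; field.
  by split; apply one_minus_neq_0.
have Fb z (v : H) : Cmod z < 1 -> Cmod (1 - z)%C * norm (F z v) <= 1 * norm v.
  move=> hz; have hz1 := one_minus_neq_0 z hz.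
  rewrite /F norm_scalC Cmod_inv // -Rmult_assoc Rinv_r; first lra.
  by move=> /Cmod_eq_0.
have hF : disc_family F 1 by constructor => //; lra.
have m := circle_mean_F1 hF x r hr 0 x.
have ex := circle_mean_ex (fun z => F z x) x r 0 hr (holomorphic_F1 hF x).
have hm := RInt_correct _ _ _ ex.
rewrite -/(circle_mean (fun z => F z x) x r 0) m in hm.
(* The Poisson kernel is [2 Re (1 / (1 - z)) - 1]. The mean value of [1 / (1 - z)] is its value [1]
   at [z = 0], so the integral is [4 PI - 2 PI]; the division by [norm x ^ 2] normalises the carrier
   vector. *)
have h2 := is_RInt_minus _ _ _ _ _ _ (is_RInt_scal _ _ _ (2 / norm x ^ 2) _ hm) (is_RInt_const 0 (2 * PI) 1).
have e : minus (scal (2 / norm x ^ 2) (2 * PI * r ^ 0 * rin (Nat.iter (0 + 1) (F (RtoC 0)) x) x))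
   (scal (2 * PI - 0) 1) = 2 * PI.
  have -> : Nat.iter (0 + 1) (F (RtoC 0)) x = x.
    rewrite /= /F; apply inner_ext => v; hinner; field.
  rewrite rin_norm /minus /plus /opp /scal /= /mult /=; field.
  move=> h; rewrite /= h in hn; lra.
rewrite e in h2; apply: is_RInt_ext h2 => t _.
set z := Cmult (RtoC r) (eI t).
have hz : Cmod z = r by rewrite Cmod_circle Rabs_pos_eq; lra.
have hz1 := one_minus_neq_0 z ltac:(lra).
have -> : eI (- INR 0 * t) = RtoC 1 by rewrite /= Ropp_0 Rmult_0_l /eI cos_0 sin_0.
rewrite Cmult_1_l inner_scal inner_norm.
have p : Cmod (1 - z)%C ^ 2 <> 0.
  move=> h; have : Cmod (1 - z)%C = 0 by move: (Cmod_ge_0 (1 - z)%C); nra.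
  by move=> /Cmod_eq_0.
have e2 : Cmod (1 - z)%C ^ 2 = 1 - 2 * Re z + r ^ 2.
  rewrite -hz !Cmod2_alt /Re /Im /Cminus /Cplus /Copp /=; ring.
have e3 : Re (/ (1 - z) * RtoC (norm x ^ 2))%C = (1 - Re z) * norm x ^ 2 / Cmod (1 - z)%C ^ 2.
  rewrite Re_Cinv_mult //; f_equal; rewrite /Re /Cminus /Cplus /Copp /=; ring.
have ez : Re z = (1 + r ^ 2 - Cmod (1 - z)%C ^ 2) / 2 by lra.
rewrite e3 ez; move: p hn; move: (Cmod (1 - z)%C ^ 2) (norm x ^ 2) => p n hp hn.
rewrite /minus /plus /opp /scal /= /mult /=; field; split; lra.
Qed.

(** The integrand is at most [B |y| / |1-z|^2], a multiple of the Poisson kernel divided by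
    [1 - r^2]. *)
Lemma circle_mean_bound {H : HilbertSpace} (X : C -> H) (y : H) r j B : y <> zero -> 0 <= r < 1 ->
  holomorphic X -> (forall z, Cmod z < 1 -> Cmod (1 - z)%C ^ 2 * norm (X z) <= B) ->
  Rabs (circle_mean X y r j) <= B * norm y * (2 * PI) / (1 - r ^ 2).
Proof.
move=> hy hr hX hB.
have hr2 : 0 < 1 - r ^ 2 by nra.
have h1 := RInt_correct _ _ _ (circle_mean_ex X y r j hr hX).
have h2 := is_RInt_scal _ _ _ (B * norm y / (1 - r ^ 2)) _ (poisson_integral y r hy hr).
have hPI := PI_RGT_0.
apply (Rle_trans _ (B * norm y / (1 - r ^ 2) * (2 * PI))); last by right; field; lra.
apply: (norm_RInt_le _ _ 0 (2 * PI) _ _ _ _ h1 h2) => [|t _]; first lra.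
set c := Cmult _ _.
apply (Rle_trans (Rabs (Re c)) (B * norm y / (1 - r ^ 2) * ((1 - r ^ 2) / Cmod (1 - Cmult (RtoC r) (eI t))%C ^ 2)));
  last exact: Rle_refl.
apply (Rle_trans _ _ _ (Re_le_Cmod _)).
rewrite /c; set z := Cmult (RtoC r) (eI t).
have hz : Cmod z < 1 by rewrite Cmod_circle Rabs_pos_eq; lra.
have p : 0 < Cmod (1 - z)%C by apply Cmod_gt_0, one_minus_neq_0.
rewrite Cmod_mult Cmod_eI Rmult_1_l.
apply (Rle_trans _ _ _ (Cmod_inner_le _ _)).
apply (Rmult_le_reg_l (Cmod (1 - z)%C ^ 2)); first nra.
set n := norm y.
have -> : Cmod (1 - z)%C ^ 2 * (B * n / (1 - r ^ 2) * ((1 - r ^ 2) / Cmod (1 - z)%C ^ 2)) = B * n.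
  field; split; lra.
rewrite -Rmult_assoc; apply Rmult_le_compat_r; [exact: norm_ge_0|exact: hB].
Qed.

Lemma exp_INR_mult n x : exp (INR n * x) = exp x ^ n.
Proof.
elim: n => [|n IH]; first by rewrite Rmult_0_l exp_0.
by rewrite S_INR Rmult_plus_distr_r Rmult_1_l exp_plus IH /= Rmult_comm.
Qed.

(** [(1 + 1/j)^j <= e <= 3 < 4]; taking reciprocals and square roots gives [1/2]. *)
Lemma geometric_e_bound j : (1 <= j)%nat -> / 2 <= sqrt (INR j / (INR j + 1)) ^ j.
Proof.
move=> hj; have hj' : 1 <= INR j by rewrite -INR_1; apply le_INR.
set q := INR j / (INR j + 1).
have hq : 0 < q by apply Rdiv_lt_0_compat; lra.
have e1 : / q <= exp (/ INR j).
  have -> : / q = 1 + / INR j by rewrite /q; field; lra.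
  exact: exp_ineq1_le.
have e2 : (/ q) ^ j <= exp 1.
  apply (Rle_trans _ (exp (/ INR j) ^ j)).
    by apply pow_incr; split=> //; apply Rlt_le, Rinv_0_lt_compat.
  rewrite -exp_INR_mult; right; f_equal; field; lra.
have e3 := exp_le_3.
have hs : 0 < sqrt q by apply sqrt_lt_R0.
have hp : 0 < sqrt q ^ j by apply pow_lt.
have e4 : (sqrt q ^ j) ^ 2 * (/ q) ^ j = 1.
  have -> : (sqrt q ^ j) ^ 2 = (sqrt q * sqrt q) ^ j by rewrite Rpow_mult_distr; ring.
  rewrite sqrt_sqrt; last lra.
  rewrite -Rpow_mult_distr Rinv_r ?pow1 //; lra.
apply Rnot_lt_le => hlt.
have : (sqrt q ^ j) ^ 2 < / 4 by nra.
have : 0 <= (sqrt q ^ j) ^ 2 by apply pow2_ge_0.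
nra.
Qed.

(** * Bounds for [J^k] and [k J^k (1 - J)] *)

Section PowerBounds.
Context {H : HilbertSpace} {F : C -> H -> H} {K : R} (hF : disc_family F K).
Let K_ge_1 := disc_K _ _ hF.
Let F_plus := disc_plus _ _ hF.
Let F_scal := disc_scal _ _ hF.
Let F_id := disc_id _ _ hF.
Let F_bound := disc_bound _ _ hF.

Let J := F (RtoC 0).
Let h0 := Cmod_0_lt_1.

Lemma J_bound x : norm (J x) <= K * norm x.
Proof.
have h := F_bound (RtoC 0) x h0; rewrite -/J in h.
have e : (1 - RtoC 0 = RtoC 1)%C by ring.
by rewrite e Cmod_1 Rmult_1_l in h.
Qed.

(* The radius [sqrt (j/(j+1))] balances the Poisson factor [1/(1-r^2)] against [r^-j]. *)
Lemma coeff_bound (X : C -> H) (v : H) j B c : (1 <= j)%nat -> 0 <= B -> 0 < c -> holomorphic X ->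
  (forall z, Cmod z < 1 -> Cmod (1 - z)%C ^ 2 * norm (X z) <= B) ->
  (forall r, 0 <= r < 1 -> circle_mean X v r j = 2 * PI * r ^ j * c * rin v v) ->
  c * norm v <= 2 * B * (INR j + 1).
Proof.
move=> hj hB hc hX hb hm.
have hj' := pos_INR j.
case: (excluded_middle_informative (v = zero)) => [->|n].
  rewrite norm_zero Rmult_0_r; apply Rmult_le_pos; lra.
have hv : 0 < norm v.
  case: (Req_dec (norm v) 0) => [/norm_eq_0//|]; move: (norm_ge_0 v); lra.
set q := INR j / (INR j + 1).
have hq : 0 <= q < 1.
  split; first by apply Rdiv_le_0_compat; lra.
  apply (Rmult_lt_reg_r (INR j + 1)); first lra.
  rewrite /q /Rdiv Rmult_assoc Rinv_l; lra.
have hr : 0 <= sqrt q < 1.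
  split; first exact: sqrt_pos.
  rewrite -sqrt_1; apply sqrt_lt_1; lra.
have r2 : 1 - sqrt q ^ 2 = / (INR j + 1).
  rewrite pow2_sqrt; last lra. rewrite /q; field; lra.
(* The test vector is the coefficient vector [v] itself, so the real part already gives its full
   squared norm. *)
have := circle_mean_bound X v (sqrt q) j B n hr hX hb.
rewrite hm // r2 rin_norm.
have hPI := PI_RGT_0.
have ge := geometric_e_bound j hj; rewrite -/q in ge.
have p1 : 0 <= 2 * PI * sqrt q ^ j * c * norm v ^ 2.
  apply Rmult_le_pos; last exact: pow2_ge_0.
  apply Rmult_le_pos; last lra.
  apply Rmult_le_pos; lra.
rewrite Rabs_pos_eq // => h.
have h2 : 2 * PI * norm v * (sqrt q ^ j * (c * norm v)) <= 2 * PI * norm v * (B * (INR j + 1)).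
  apply (Rle_trans _ (2 * PI * sqrt q ^ j * c * norm v ^ 2)); first by right; ring.
  apply (Rle_trans _ _ _ h); right; field; lra.
have h3 : sqrt q ^ j * (c * norm v) <= B * (INR j + 1).
  apply (Rmult_le_reg_l (2 * PI * norm v)) => //; apply Rmult_lt_0_compat; lra.
have h4 : 0 <= c * norm v by apply Rmult_le_pos; lra.
nra.
Qed.

Lemma F2_bound z x : Cmod z < 1 -> Cmod (1 - z)%C ^ 2 * norm (F z (F z x)) <= K ^ 2 * norm x.
Proof.
move=> hz; have p := Cmod_ge_0 (1 - z)%C.
have h1 := F_bound z x hz; have h2 := F_bound z (F z x) hz.
have := Rmult_le_compat_l _ _ _ p h2.
have := Rmult_le_compat_l K _ _ ltac:(lra) h1.
rewrite /=; nra.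
Qed.

(** For [k = j + 2] with [j >= 1], the coefficient [(j + 1) J^(j+2)] of [F^2] is bounded by
    [2 K^2 (j + 1)] and the factors [j + 1] cancel. The powers [k <= 2] are covered by
    [K^k <= 2 K^2], as [1 <= K]. *)
Lemma J_pow_bound k x : norm (Nat.iter k J x) <= 2 * K ^ 2 * norm x.
Proof.
have hx := norm_ge_0 x.
case: k => [|[|[|j]]].
- have k1 : 1 <= 2 * K ^ 2 by nra.
  have := Rmult_le_compat_r _ _ _ hx k1; rewrite /Nat.iter /=; lra.
- have k1 : K <= 2 * K ^ 2 by nra.
  have := Rmult_le_compat_r _ _ _ hx k1; have := J_bound x; rewrite /Nat.iter /=; lra.
- apply (Rle_trans _ _ _ (J_bound _)).
  have k1 : K * K <= 2 * K ^ 2 by nra.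
  have := Rmult_le_compat_r _ _ _ hx k1.
  have := Rmult_le_compat_l K _ _ ltac:(lra) (J_bound x); rewrite /Nat.iter /=; lra.
have e : S (S (S j)) = (S j + 2)%nat by lia.
rewrite e.
have h := coeff_bound (fun z => F z (F z x)) (Nat.iter (S j + 2) J x) (S j) (K ^ 2 * norm x)
  (INR (S j + 1)) ltac:(lia).
have hp : 0 < INR (S j + 1) by apply lt_0_INR; lia.
have h' := h ltac:(apply Rmult_le_pos; nra) hp (holomorphic_F2 hF x)
  (fun z hz => F2_bound z x hz)
  (fun r hr => circle_mean_F2 hF _ r hr (S j) x).
rewrite plus_INR INR_1 in h' hp.
apply (Rmult_le_reg_l (INR (S j) + 1)) => //; nra.
Qed.

Lemma J_comm_F z x : Cmod z < 1 -> J (F z x) = F z (J x).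
Proof. move=> hz; exact: (F_comm hF). Qed.

(* [(1 - J) F(z) = J (1 - (1 - z) F(z))], where the second factor stays bounded as [z -> 1]. *)
Lemma F3_defect_bound z x : Cmod z < 1 ->
  Cmod (1 - z)%C ^ 2 * norm (F z (F z (F z (minus x (J x))))) <= 2 * K ^ 4 * norm x.
Proof.
move=> hz.
have E : F z (minus x (J x)) = J (minus x (scal (1 - z)%C (F z x))).
  have mJ v w : J (minus v w) = minus (J v) (J w) by apply (F_minus hF).
  rewrite mJ (F_minus hF) // /J F_scal // -/J J_comm_F //.
  have := F_step hF z x hz; rewrite -/J => ->.
  hvec.
rewrite E.
apply (Rle_trans _ _ _ (F2_bound z _ hz)).
have b1 : norm (minus x (scal (1 - z)%C (F z x))) <= (1 + K) * norm x.
  apply (Rle_trans _ _ _ (norm_plus_le _ _)); rewrite norm_opp norm_scalC.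
  have := F_bound z x hz; lra.
have b2 : norm (J (minus x (scal (1 - z)%C (F z x)))) <= K * ((1 + K) * norm x).
  apply (Rle_trans _ _ _ (J_bound _)); apply Rmult_le_compat_l; lra.
have b3 := Rmult_le_compat_l (K ^ 2) _ _ ltac:(nra) b2.
have hx := norm_ge_0 x.
apply (Rle_trans _ _ _ b3).
have -> : 2 * K ^ 4 * norm x = K ^ 2 * (K * ((K + K) * norm x)) by ring.
do 2 (apply Rmult_le_compat_l; first nra).
apply Rmult_le_compat_r; lra.
Qed.

(** The coefficient of [F^3] carries [(j + 1)(j + 2) / 2] against the bound [4 K^4 (j + 1)], which
    leaves [8 K^4 / (j + 2)]. Passing from [j + 2] to [k = j + 3 <= 2 (j + 2)] doubles the constant,
    and [j >= 1] means [k >= 4]. *)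
Lemma J_defect_bound k x : (4 <= k)%nat -> INR k * norm (Nat.iter k J (minus x (J x))) <= 16 * K ^ 4 * norm x.
Proof.
move=> hk.
have [j [hj ->]] : exists j, (1 <= j)%nat /\ k = (j + 3)%nat by exists (k - 3)%nat; lia.
have hx := norm_ge_0 x.
have p1 : 0 < INR (j + 1) * INR (j + 2) / 2.
  apply Rdiv_lt_0_compat; last lra. apply Rmult_lt_0_compat; apply lt_0_INR; lia.
have K4 : 0 <= K ^ 4 by apply pow_le; lra.
have h := coeff_bound (fun z => F z (F z (F z (minus x (J x))))) (Nat.iter (j + 3) J (minus x (J x))) j
  (2 * K ^ 4 * norm x) (INR (j + 1) * INR (j + 2) / 2) hj ltac:(apply Rmult_le_pos; lra) p1
  (holomorphic_F3 hF _)
  (fun z hz => F3_defect_bound z x hz)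
  (fun r hr => circle_mean_F3 hF _ r hr j _).
rewrite !plus_INR INR_1 in h p1 *.
have e2 : INR 2 = 2 by rewrite /=; ring. have e3 : INR 3 = 3 by rewrite /=; ring.
rewrite e2 in h p1; rewrite e3.
have hj' : 1 <= INR j by rewrite -INR_1; apply le_INR.
set N := norm _ in h *.
have hN : 0 <= N by apply norm_ge_0.
have h2 : (INR j + 2) * N <= 8 * K ^ 4 * norm x.
  apply (Rmult_le_reg_l (INR j + 1)); first lra.
  nra.
nra.
Qed.

End PowerBounds.

(** * Resolvents and the exponential formula *)

Lemma exp_le_compat a b : a <= b -> exp a <= exp b.
Proof. by case=> [h|->]; [apply Rlt_le, exp_increasing|apply Rle_refl]. Qed.

Section Resolvent.
Context {H : HilbertSpace} {A : operator H}.

Lemma res_plus l Q (x y : H) : bounded_inverse A l Q -> Q (plus x y) = plus (Q x) (Q y).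
Proof. by move=> [h _]; apply (linear_plus _ h). Qed.

Lemma res_scal l Q a (x : H) : bounded_inverse A l Q -> Q (scal a x) = scal a (Q x).
Proof. by move=> [h _]; apply (linear_scal _ h). Qed.

Lemma res_opp l Q (x : H) : bounded_inverse A l Q -> Q (opp x) = opp (Q x).
Proof. by move=> h; rewrite -scal_opp_one (res_scal l Q) // scal_opp_one. Qed.

Lemma res_minus l Q (x y : H) : bounded_inverse A l Q -> Q (minus x y) = minus (Q x) (Q y).
Proof. by move=> h; rewrite /minus (res_plus l Q) // (res_opp l Q). Qed.

Lemma res_dom l Q (y : H) : bounded_inverse A l Q -> dom A (Q y).
Proof. by case=> _ [h _]; case: (h y). Qed.

Lemma res_op l Q (y : H) : bounded_inverse A l Q -> A (Q y) = minus y (scal l (Q y)).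
Proof. case=> _ [h _]; case: (h y) => _ {2}<-; hvec. Qed.

Lemma res_op_comm l Q (y : H) : bounded_inverse A l Q -> dom A y -> Q (A y) = minus y (scal l (Q y)).
Proof.
move=> hQ hy; have h := proj2 (proj2 hQ) y hy.
rewrite (res_plus l Q) // (res_scal l Q) // in h; rewrite -{2}h; hvec.
Qed.

Lemma resolvent_identity l m Q P (y : H) : bounded_inverse A l Q -> bounded_inverse A m P ->
  minus (Q y) (P y) = scal (m - l)%C (Q (P y)).
Proof.
move=> hQ hP.
have h := proj2 (proj2 hQ) (P y) (res_dom _ _ _ hP).
rewrite (res_op m P) // (res_plus l Q) // (res_minus l Q) // !(res_scal l Q) // in h.
have -> : minus (Q y) (P y) = minus (Q y) (plus (minus (Q y) (scal m (Q (P y)))) (scal l (Q (P y)))) by rewrite h.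
hvec.
Qed.

Lemma resolvent_unique l Q P (y : H) : bounded_inverse A l Q -> bounded_inverse A l P -> Q y = P y.
Proof.
move=> hQ hP; have h := resolvent_identity l l Q P y hQ hP.
have -> : Q y = plus (P y) (minus (Q y) (P y)) by hvec.
rewrite h; hvec.
Qed.

(** The vertex [b] is a parameter: [b = 0] is the given estimate, and [b = - mu] is the same
    estimate for [A - mu], from which exponential decay is read off. *)
Definition half_plane (b K : R) (Q : C -> H -> H) : Prop :=
  forall l : C, b < Re l -> bounded_inverse A l (Q l) /\
    forall y, Cmod (l - RtoC b)%C * norm (Q l y) <= K * norm y.

Definition disc_point (b c : R) (z : C) : C := (RtoC b + RtoC c * (1 - z))%C.

Lemma disc_point_Re b c z : 0 < c -> Cmod z < 1 -> b < Re (disc_point b c z).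
Proof.
move=> hc hz; have := Re_le_Cmod z => /(Rle_lt_trans _ _ _) /(_ hz) /Rabs_def2.
rewrite /disc_point /Re /Cplus /Cminus /Cmult /Copp /=; nra.
Qed.

(** For [l = b + c (1 - z)] one has [|l - b| = c |1 - z|], so the factor [c] turns the resolvent
    estimate into [disc_bound] with the same [K] for every [c]. This uniformity is what survives
    when the step size tends to zero. *)
Lemma half_plane_disc_family b K Q c : 1 <= K -> half_plane b K Q -> 0 < c ->
  disc_family (fun z (x : H) => scal (RtoC c) (Q (disc_point b c z) x)) K.
Proof.
move=> hK hQ hc.
have hb z : Cmod z < 1 -> bounded_inverse A (disc_point b c z) (Q (disc_point b c z)).
  by move=> hz; case: (hQ _ (disc_point_Re b c z hc hz)).
constructor=> //.
- by move=> z x y hz; rewrite (res_plus _ _ _ _ (hb z hz)); hvec.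
- by move=> z a x hz; rewrite (res_scal _ _ _ _ (hb z hz)); hvec.
- move=> z w x hz hw; rewrite (res_scal _ _ _ _ (hb z hz)).
  have h := resolvent_identity _ _ _ _ x (hb z hz) (hb w hw).
  have -> : forall u v : H, minus (scal (RtoC c) u) (scal (RtoC c) v) = scal (RtoC c) (minus u v) by move=> u v; hvec.
  rewrite h /disc_point; hvec.
- move=> z x hz; case: (hQ _ (disc_point_Re b c z hc hz)) => _ /(_ x).
  have -> : (disc_point b c z - RtoC b = RtoC c * (1 - z))%C by rewrite /disc_point; ring.
  rewrite Cmod_mult norm_scalC; lra.
Qed.

Lemma disc_point_0 b c : disc_point b c (RtoC 0) = RtoC (b + c).
Proof. rewrite /disc_point RtoC_plus; ring. Qed.

Lemma iter_scal (G : H -> H) (a : C) k x : (forall c y, G (scal c y) = scal c (G y)) ->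
  Nat.iter k (fun v => scal a (G v)) x = scal (Cpow a k) (Nat.iter k G x).
Proof.
move=> hG; elim: k => [|k IH] /=; first by hvec.
rewrite IH hG; hvec.
Qed.

End Resolvent.

Lemma iter_lin {H : HilbertSpace} (G : H -> H) k : (forall x y, G (minus x y) = minus (G x) (G y)) ->
  forall x y, Nat.iter k G (minus x y) = minus (Nat.iter k G x) (Nat.iter k G y).
Proof. by move=> hG x y; elim: k => //= k ->. Qed.

Lemma closed_operator_lim {H : HilbertSpace} (A : operator H) (x y : H) : closed_operator A ->
  (forall eps, 0 < eps -> exists u, dom A u /\ norm (minus u x) < eps /\ norm (minus (A u) y) < eps) ->
  dom A x /\ y = A x.
Proof.
move=> hA h; apply (hA (x, y)) => -[eps he].
case: (h eps (cond_pos eps)) => u [hu [h1 h2]].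
apply (he (u, A u)) => //; split; [exact: (norm_compat1 x u eps h1)|exact: (norm_compat1 y (A u) eps h2)].
Qed.

(** * Implicit Euler scheme, exponential formula, smoothing and decay *)

Section Euler.
Context {H : HilbertSpace} {A : operator H} {T : R -> H -> H}
  (T_C0 : C0_semigroup T) (T_gen : generated_by_opp A T)
  (A_dense : densely_defined A) (A_closed : closed_operator A)
  {K : R} {Q : C -> H -> H} (K_ge_1 : 1 <= K) (hQ : half_plane (A := A) 0 K Q).

(** The implicit Euler step [(1 + h A)^-1]; it is the value at [z = 0] of the disc family with
    [b = 0] and [c = / h]. *)
Definition euler (h : R) (v : H) : H := scal (RtoC (/ h)) (Q (RtoC (/ h)) v).

Lemma res_h h : 0 < h -> bounded_inverse A (RtoC (/ h)) (Q (RtoC (/ h))).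
Proof. by move=> hh; case: (hQ (RtoC (/ h)) (Rinv_0_lt_compat _ hh)). Qed.

Lemma euler_scal h a x : 0 < h -> euler h (scal a x) = scal a (euler h x).
Proof. by move=> hh; rewrite /euler (res_scal _ _ _ _ (res_h h hh)); hvec. Qed.

Lemma euler_minus h x y : 0 < h -> euler h (minus x y) = minus (euler h x) (euler h y).
Proof. by move=> hh; rewrite /euler (res_minus _ _ _ _ (res_h h hh)); hvec. Qed.

Lemma euler_disc h : 0 < h ->
  disc_family (fun z x => scal (RtoC (/ h)) (Q (disc_point 0 (/ h) z) x)) K.
Proof. move=> hh; apply (half_plane_disc_family (A := A)) => //; exact: Rinv_0_lt_compat. Qed.

Lemma euler_pow_bound h k x : 0 < h -> norm (Nat.iter k (euler h) x) <= 2 * K ^ 2 * norm x.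
Proof.
move=> hh; have := J_pow_bound (euler_disc h hh) k x.
by rewrite disc_point_0 Rplus_0_l.
Qed.

Lemma euler_defect_bound h k x : 0 < h -> (4 <= k)%nat ->
  INR k * norm (Nat.iter k (euler h) (minus x (euler h x))) <= 16 * K ^ 4 * norm x.
Proof.
move=> hh hk; have := J_defect_bound (euler_disc h hh) k x hk.
by rewrite disc_point_0 Rplus_0_l.
Qed.

Lemma euler_defect h x : 0 < h -> dom A x -> minus x (euler h x) = scal (RtoC h) (euler h (A x)).
Proof.
move=> hh hx; rewrite /euler (res_op_comm _ _ _ (res_h h hh)) //.
apply inner_ext => v; hinner; rewrite RtoC_inv; last lra. field; apply RtoC_neq_0; lra.
Qed.

Lemma euler_dom h x : 0 < h -> dom A (euler h x).
Proof. move=> hh; apply dom_scal, (res_dom _ _ _ (res_h h hh)). Qed.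

Lemma euler_op h x : 0 < h -> dom A x -> A (euler h x) = euler h (A x).
Proof.
move=> hh hx; rewrite /euler op_scal; last exact: (res_dom _ _ _ (res_h h hh)).
by rewrite (res_op _ _ _ (res_h h hh)) (res_op_comm _ _ _ (res_h h hh)).
Qed.

Lemma euler_bound h x : 0 < h -> norm (euler h x) <= K * norm x.
Proof.
move=> hh; have h' := Rinv_0_lt_compat _ hh.
case: (hQ (RtoC (/ h)) h') => _ /(_ x).
have -> : (RtoC (/ h) - RtoC 0 = RtoC (/ h))%C by ring.
by rewrite /euler norm_scalC.
Qed.

Lemma euler_approx x eps : 0 < eps -> exists d, 0 < d /\ forall h, 0 < h < d -> norm (minus (euler h x) x) < eps.
Proof.
move=> he.
have hk : 0 < eps / (2 * (K + 2)) by apply Rdiv_lt_0_compat; lra.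
case: (A_dense x _ hk) => y [hy hxy].
have hn := norm_ge_0 (A y).
exists (eps / (2 * (K * (norm (A y) + 1)))); split.
  apply Rdiv_lt_0_compat => //; nra.
move=> h hh.
have hb := euler_bound h.
have E : minus (euler h x) x = plus (minus (euler h (minus x y)) (minus x y)) (opp (minus y (euler h y))).
  rewrite euler_minus; last lra. hvec.
rewrite E euler_defect //; last lra.
apply (Rle_lt_trans _ _ _ (norm_plus_le _ _)).
rewrite norm_opp norm_scalR Rabs_pos_eq; last lra.
have q1 : norm (minus (euler h (minus x y)) (minus x y)) <= (K + 1) * norm (minus x y).
  apply (Rle_trans _ _ _ (norm_plus_le _ _)); rewrite norm_opp.
  have := hb (minus x y) ltac:(lra); lra.
have q2 : (K + 1) * norm (minus x y) < eps / 2.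
  apply (Rle_lt_trans _ ((K + 1) * (eps / (2 * (K + 2))))).
    apply Rmult_le_compat_l; lra.
  have -> : (K + 1) * (eps / (2 * (K + 2))) = eps / 2 - eps / (2 * (K + 2)) by field; lra.
  lra.
have q3 : h * norm (euler h (A y)) <= eps / 2.
  apply (Rle_trans _ (eps / (2 * (K * (norm (A y) + 1))) * (K * (norm (A y) + 1)))).
    apply Rmult_le_compat; try lra; first exact: norm_ge_0.
    have := hb (A y) ltac:(lra); nra.
  right; field; nra.
lra.
Qed.

(** The Euler step commutes with [A], so it maps [D(A)] into [D(A^2)], and it tends strongly to the
    identity as [h] tends to [0]. *)
Lemma dom2_dense x eps : 0 < eps -> exists y, dom A y /\ dom A (A y) /\ norm (minus x y) < eps.
Proof.
move=> he.
case: (A_dense x (eps / 2)) => [|y [hy hxy]]; first lra.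
case: (euler_approx y (eps / 2)) => [|d [hd hb]]; first lra.
have hd2 : 0 < d / 2 < d by lra.
exists (euler (d / 2) y); split; first by apply euler_dom; lra.
split; first by rewrite euler_op //; [apply euler_dom|]; lra.
have := hb _ hd2; rewrite norm_minus_sym.
have := norm_triangle3 x y (euler (d / 2) y); lra.
Qed.

Lemma T_increment t M s x : (forall s x, 0 <= s <= t -> norm (T s x) <= M * norm x) ->
  0 <= s <= t -> dom A x -> norm (minus (T s x) x) <= s * (M * norm (A x)).
Proof.
move=> hM hs hx.
have hB : 0 <= M * norm (A x).
  apply (Rle_trans _ (norm (T 0 (A x)))); [exact: norm_ge_0|apply hM; lra].
apply norm_le_rin; first by apply Rmult_le_pos; lra.
move=> v; rewrite rin_minus_l.
case: (Req_dec s 0) => [->|n].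
  rewrite (C0_zero _ T_C0); lra.
case: (MVT_half_line (fun u => rin (T u x) v) (fun u => - rin (T u (A x)) v) 0 s) => //; try lra.
- move=> u hu; apply (T_hderiv_rin_l T_C0 T_gen) => //; lra.
- move=> u hu; exact: (hderiv_hcont _ _ _ (T_hderiv_rin_l T_C0 T_gen _ _ _ hu hx)).
move=> c [hc]; rewrite (C0_zero _ T_C0) Rminus_0_r => ->.
rewrite (Rmult_comm _ s) Rmult_assoc; apply Rmult_le_compat_l; first lra.
rewrite -rin_opp_l; apply (Rle_trans _ _ _ (rin_le _ _)); rewrite norm_opp.
apply Rmult_le_compat_r; [exact: norm_ge_0|apply hM; lra].
Qed.

(** The mean value theorem is applied to [u |-> (T u x + u A x | v)], whose derivative
    [- (T u (A x) - A x | v)] is of order [u] by [T_increment]. *)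
Lemma T_taylor t M h x : (forall s x, 0 <= s <= t -> norm (T s x) <= M * norm x) ->
  0 < h <= t -> dom A x -> dom A (A x) ->
  norm (plus (minus (T h x) x) (scal (RtoC h) (A x))) <= h * (h * (M * norm (A (A x)))).
Proof.
move=> hM hh hx hAx.
have hB : 0 <= M * norm (A (A x)).
  apply (Rle_trans _ (norm (T 0 (A (A x))))); [exact: norm_ge_0|apply hM; lra].
apply norm_le_rin; first by do 2 (apply Rmult_le_pos; first lra).
move=> v; rewrite rin_plus_l rin_minus_l rin_scal_l.
have hd u : 0 <= u -> hderiv (fun u => rin (T u x) v + rin (A x) v * u) u (- rin (T u (A x)) v + rin (A x) v * 1).
  move=> hu; apply hderiv_plus; first exact: (T_hderiv_rin_l T_C0 T_gen).
  by apply hderiv_scal, is_derive_hderiv; auto_derive.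
case: (MVT_half_line _ _ 0 h (Rle_refl _) (proj1 hh) (fun u hu => hd u (Rlt_le _ _ (proj1 hu)))
   (fun u hu => hderiv_hcont _ _ _ (hd u hu))) => c [hc].
rewrite (C0_zero _ T_C0) Rmult_0_r Rplus_0_r Rminus_0_r => e.
have -> : rin (T h x) v - rin x v + h * rin (A x) v = rin (T h x) v + rin (A x) v * h - rin x v by ring.
rewrite e (Rmult_comm _ h) !Rmult_assoc; apply Rmult_le_compat_l; first lra.
have -> : - rin (T c (A x)) v + rin (A x) v * 1 = rin (opp (minus (T c (A x)) (A x))) v.
  rewrite rin_opp_l rin_minus_l; ring.
apply (Rle_trans _ _ _ (rin_le _ _)); rewrite norm_opp.
rewrite -!Rmult_assoc; apply Rmult_le_compat_r; first exact: norm_ge_0.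
apply (Rle_trans _ _ _ (T_increment t M c (A x) hM ltac:(lra) hAx)).
rewrite Rmult_assoc; apply Rmult_le_compat_r; lra.
Qed.

Lemma euler_taylor h x : 0 < h -> dom A x -> dom A (A x) ->
  norm (plus (minus (euler h x) x) (scal (RtoC h) (A x))) <= h * (h * (K * norm (A (A x)))).
Proof.
move=> hh hx hAx.
have E : plus (minus (euler h x) x) (scal (RtoC h) (A x)) = scal (RtoC h) (scal (RtoC h) (euler h (A (A x)))).
  rewrite -(euler_defect h (A x)) //.
  have e := euler_defect h x hh hx.
  have -> : minus (euler h x) x = opp (minus x (euler h x)) by hvec.
  rewrite e; hvec.
rewrite E 2!norm_scalR !Rabs_pos_eq; try lra.
do 2 (apply Rmult_le_compat_l; first lra).
exact: euler_bound.
Qed.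

Lemma euler_T_step t M h x : (forall s x, 0 <= s <= t -> norm (T s x) <= M * norm x) ->
  0 < h <= t -> dom A x -> dom A (A x) ->
  norm (minus (T h x) (euler h x)) <= h ^ 2 * ((M + K) * norm (A (A x))).
Proof.
move=> hM hh hx hAx.
have -> : minus (T h x) (euler h x) =
  minus (plus (minus (T h x) x) (scal (RtoC h) (A x))) (plus (minus (euler h x) x) (scal (RtoC h) (A x))) by hvec.
apply (Rle_trans _ _ _ (norm_plus_le _ _)); rewrite norm_opp.
have := T_taylor t M h x hM hh hx hAx; have := euler_taylor h x (proj1 hh) hx hAx.
lra.
Qed.

Lemma T_dom2 s x : 0 <= s -> dom A x -> dom A (A x) ->
  dom A (T s x) /\ dom A (A (T s x)) /\ A (A (T s x)) = T s (A (A x)).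
Proof.
move=> hs hx hAx.
case: (T_dom T_C0 T_gen s x hs hx) => h1 e1; case: (T_dom T_C0 T_gen s (A x) hs hAx) => h2 e2.
by rewrite e1.
Qed.

(** Stability and consistency: with [E = euler h], the error telescopes into the [n] terms
    [E^(n-k-1) (T h - E) T(k h) x]. The powers of [E] are bounded uniformly and the local error is
    of order [h^2] on [D(A^2)], so the total is of order [n h^2 = t^2 / n]. *)
Lemma euler_converges_dom2 t x : 0 < t -> dom A x -> dom A (A x) ->
  exists D, 0 <= D /\ forall n, (1 <= n)%nat ->
    norm (minus (Nat.iter n (euler (t / INR n)) x) (T t x)) <= D / INR n.
Proof.
move=> ht hx hAx.
case: (T_bounded_on T_C0 t) => M [hM1 hM].
set a := norm (A (A x)); have ha : 0 <= a by apply norm_ge_0.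
have hK2 : 0 <= 2 * K ^ 2 by nra.
have hD0 : 0 <= (M + K) * (M * a) by apply Rmult_le_pos; [lra|apply Rmult_le_pos; lra].
exists (2 * K ^ 2 * (t ^ 2 * ((M + K) * (M * a)))); split.
  apply Rmult_le_pos => //; apply Rmult_le_pos => //; exact: pow2_ge_0.
move=> n hn.
have hn' : 1 <= INR n by rewrite -INR_1; apply le_INR.
set h := t / INR n.
have hh : 0 < h by apply Rdiv_lt_0_compat; lra.
have hnt : INR n * h = t by rewrite /h; field; lra.
have step k : (k < n)%nat ->
    norm (minus (Nat.iter (n - S k) (euler h) (T (INR (S k) * h) x)) (Nat.iter (n - k) (euler h) (T (INR k * h) x)))
    <= 2 * K ^ 2 * (h ^ 2 * ((M + K) * (M * a))).
  move=> hk.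
  have hk0 := pos_INR k.
  have hkn : INR k + 1 <= INR n by rewrite -S_INR; apply le_INR; lia.
  have hkt : (INR k + 1) * h <= t by rewrite -hnt; apply Rmult_le_compat_r; lra.
  have hkh : 0 <= INR k * h by apply Rmult_le_pos; lra.
  have -> : (n - k = S (n - S k))%nat by lia.
  rewrite Nat.iter_succ_r.
  rewrite -iter_lin; last by move=> u v; apply euler_minus.
  apply (Rle_trans _ _ _ (euler_pow_bound _ _ _ hh)).
  apply Rmult_le_compat_l => //.
  have -> : INR (S k) * h = h + INR k * h by rewrite S_INR; ring.
  rewrite (T_add T_C0); [|lra|lra].
  case: (T_dom2 (INR k * h) x hkh hx hAx) => d1 [d2 e2].
  have h2 : h <= t by nra.
  apply (Rle_trans _ _ _ (euler_T_step t M h _ hM (conj hh h2) d1 d2)).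
  apply Rmult_le_compat_l; first exact: pow2_ge_0.
  apply Rmult_le_compat_l; first lra.
  rewrite e2; apply hM; nra.
have tel k : (k <= n)%nat ->
    norm (minus (Nat.iter (n - k) (euler h) (T (INR k * h) x)) (Nat.iter n (euler h) x))
    <= INR k * (2 * K ^ 2 * (h ^ 2 * ((M + K) * (M * a)))).
  elim: k => [|k IH] hk.
    rewrite Nat.sub_0_r /= !Rmult_0_l (C0_zero _ T_C0) /minus plus_opp_r norm_zero; lra.
  have := IH ltac:(lia); have := step k ltac:(lia); rewrite S_INR.
  have := norm_triangle3 (Nat.iter (n - S k) (euler h) (T ((INR k + 1) * h) x))
    (Nat.iter (n - k) (euler h) (T (INR k * h) x)) (Nat.iter n (euler h) x).
  lra.
have := tel n (Nat.le_refl _); rewrite Nat.sub_diag /= hnt norm_minus_sym => hf.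
apply (Rle_trans _ _ _ hf); right; rewrite /h; field; lra.
Qed.

Lemma euler_converges t x eps : 0 < t -> 0 < eps -> exists N, (1 <= N)%nat /\ forall n, (N <= n)%nat ->
  norm (minus (Nat.iter n (euler (t / INR n)) x) (T t x)) < eps.
Proof.
move=> ht he.
case: (T_bounded_on T_C0 t) => M [hM1 hM].
set B := 2 * K ^ 2 + M.
have hB : 1 <= B by rewrite /B; nra.
have hd : 0 < eps / (2 * B) by apply Rdiv_lt_0_compat; lra.
case: (dom2_dense x _ hd) => y [hy [hAy hxy]].
case: (euler_converges_dom2 t y ht hy hAy) => D [hD hb].
case: (INR_unbounded (2 * D / eps + 1)) => N hN.
have hq : 0 <= 2 * D / eps by apply Rdiv_le_0_compat; lra.
exists (S N); split; first lia. move=> n hn.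
have hn1 : 2 * D / eps + 1 < INR n.
  by apply (Rlt_le_trans _ (INR N)) => //; apply le_INR; lia.
have hh : 0 < t / INR n by apply Rdiv_lt_0_compat; lra.
set J := euler (t / INR n).
have E : minus (Nat.iter n J x) (T t x) =
  plus (minus (Nat.iter n J y) (T t y)) (minus (Nat.iter n J (minus x y)) (T t (minus x y))).
  rewrite (T_minus T_C0); last lra.
  rewrite iter_lin; last by move=> u v; apply euler_minus.
  hvec.
rewrite E; apply (Rle_lt_trans _ _ _ (norm_plus_le _ _)).
have q1 : norm (minus (Nat.iter n J y) (T t y)) < eps / 2.
  apply (Rle_lt_trans _ _ _ (hb n ltac:(lia))).
  apply (Rmult_lt_reg_r (INR n)); first lra.
  rewrite /Rdiv Rmult_assoc Rinv_l; last lra.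
  have : D = eps / 2 * (2 * D / eps) by field; lra.
  nra.
have q2 : norm (minus (Nat.iter n J (minus x y)) (T t (minus x y))) <= B * norm (minus x y).
  apply (Rle_trans _ _ _ (norm_plus_le _ _)); rewrite norm_opp.
  have := euler_pow_bound (t / INR n) n (minus x y) hh.
  have := hM t (minus x y) ltac:(lra); rewrite /B -/J; lra.
have q3 : B * norm (minus x y) <= B * (eps / (2 * B)) by apply Rmult_le_compat_l; lra.
have q4 : B * (eps / (2 * B)) = eps / 2 by field; lra.
lra.
Qed.

(** [E^(n-1) (1 - E) x = h E^n A x], so [euler_defect_bound] controls [(n - 1) h E^n A x]. Here
    [(n - 1) h >= t / 2], which doubles the constant, and [E^n A x] tends to
    [T t (A x) = A (T t x)]. *)
Lemma A_T_bound t x : 0 < t -> dom A x -> norm (A (T t x)) <= 32 * K ^ 4 / t * norm x.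
Proof.
move=> ht hx.
rewrite (proj2 (T_dom T_C0 T_gen t x ltac:(lra) hx)).
apply Rnot_lt_le => hlt.
case: (euler_converges t (A x) _ ht (proj2 (Rlt_0_minus _ _) hlt)) => N [hN hb].
(* The offset ensures [n - 1 >= 4], the range of the defect bound. *)
set n := (N + 5)%nat.
have := hb n ltac:(rewrite /n; lia).
have hn : 5 <= INR n by have -> : 5 = INR 5 by [rewrite /=; ring]; apply le_INR; rewrite /n; lia.
set h := t / INR n.
have hh : 0 < h by apply Rdiv_lt_0_compat; lra.
have hdef := euler_defect_bound h (n - 1) x hh ltac:(rewrite /n; lia).
rewrite euler_defect // in hdef.
have sc k c v : Nat.iter k (euler h) (scal c v) = scal c (Nat.iter k (euler h) v).
  by elim: k => //= k ->; rewrite euler_scal.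
rewrite sc -Nat.iter_succ_r norm_scalR Rabs_pos_eq in hdef; last lra.
have e1 : S (n - 1) = n by rewrite /n; lia.
rewrite e1 minus_INR ?INR_1 in hdef; last by rewrite /n; lia.
set w := Nat.iter n (euler h) (A x) in hdef *.
have hw : norm w <= 32 * K ^ 4 / t * norm x.
  have K4 : 0 <= 16 * K ^ 4 * norm x.
    apply Rmult_le_pos; last exact: norm_ge_0.
    apply Rmult_le_pos; [lra|apply pow_le; lra].
  have hnw := norm_ge_0 w.
  have e2 : INR n * h = t by rewrite /h; field; lra.
  have h2 : t * norm w <= 2 * (16 * K ^ 4 * norm x).
    have : h * norm w * (INR n - 2) >= 0.
      apply Rle_ge, Rmult_le_pos; [apply Rmult_le_pos|]; lra.
    nra.
  apply (Rmult_le_reg_l t) => //.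
  have -> : t * (32 * K ^ 4 / t * norm x) = 2 * (16 * K ^ 4 * norm x) by field; lra.
  done.
have := norm_minus_le (T t (A x)) w; rewrite norm_minus_sym; lra.
Qed.

(** For [y n] in [D(A)] tending to [x], the vectors [A (T t (y n))] form a Cauchy sequence by
    [A_T_bound], whose constant does not involve [A x]; closedness of [A] concludes. *)
Lemma T_smoothing t x : 0 < t -> dom A (T t x).
Proof.
move=> ht.
case: (T_bounded_on T_C0 t) => M [hM1 hM].
set B := 32 * K ^ 4 / t.
have hB : 0 <= B by apply Rdiv_le_0_compat => //; have := pow_le K 4 ltac:(lra); lra.
have ap n : exists y, dom A y /\ norm (minus x y) < / (INR n + 1).
  by apply A_dense, Rinv_0_lt_compat; move: (pos_INR n); lra.
pose y n := proj1_sig (constructive_indefinite_description _ (ap n)).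
have hy n : dom A (y n) /\ norm (minus x (y n)) < / (INR n + 1) := proj2_sig (constructive_indefinite_description _ (ap n)).
have small eps : 0 < eps -> exists N, forall n, (N <= n)%nat -> norm (minus x (y n)) < eps.
  move=> he; case: (INR_unbounded (/ eps)) => N hN; exists N => n hn.
  apply (Rlt_trans _ _ _ (proj2 (hy n))).
  have hn' : INR N <= INR n by apply le_INR.
  have := Rinv_0_lt_compat _ he => hi.
  rewrite -(Rinv_inv eps); apply Rinv_lt_contravar; last lra.
  apply Rmult_lt_0_compat; lra.
case: (hilbert_complete (fun n => A (T t (y n)))).
  move=> eps he.
  case: (small (eps / (2 * (B + 1)))) => [|N hN]; first by apply Rdiv_lt_0_compat; lra.
  exists N => n m hn hm.
  have [d1 _] := hy n; have [d2 _] := hy m.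
  have [e1 _] := T_dom T_C0 T_gen t _ (Rlt_le _ _ ht) d1; have [e2 _] := T_dom T_C0 T_gen t _ (Rlt_le _ _ ht) d2.
  rewrite -op_minus // -(T_minus T_C0); last lra.
  apply (Rle_lt_trans _ _ _ (A_T_bound t _ ht (dom_minus _ _ d1 d2))).
  have h1 := hN n hn; have h2 := hN m hm.
  have h3 := norm_triangle3 (y n) x (y m); rewrite (norm_minus_sym (y n) x) in h3.
  apply (Rle_lt_trans _ (B * (2 * (eps / (2 * (B + 1)))))).
    apply Rmult_le_compat_l => //; lra.
  have -> : B * (2 * (eps / (2 * (B + 1)))) = eps - eps / (B + 1) by field; lra.
  have : 0 < eps / (B + 1) by apply Rdiv_lt_0_compat; lra.
  lra.
move=> l hl.
apply (fun h => proj1 (closed_operator_lim A (T t x) l A_closed h)) => eps he.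
case: (hl eps he) => N1 hN1.
case: (small (eps / M)) => [|N2 hN2]; first by apply Rdiv_lt_0_compat; lra.
exists (T t (y (N1 + N2)%nat)); have [d1 _] := hy (N1 + N2)%nat.
split; first exact: (proj1 (T_dom T_C0 T_gen t _ (Rlt_le _ _ ht) d1)).
split; last by apply hN1; lia.
rewrite norm_minus_sym -(T_minus T_C0); last lra.
apply (Rle_lt_trans _ _ _ (hM t _ ltac:(lra))).
have := hN2 (N1 + N2)%nat ltac:(lia) => h2.
apply (Rlt_le_trans _ (M * (eps / M))); first by apply Rmult_lt_compat_l; lra.
right; field; lra.
Qed.

(** The Euler step is [(1 + mu h)^-1] times the operator [J] of the shifted family, whose powers are
    bounded by [2 K'^2]. The parameter [eta] absorbs the loss of rate at finite [n], so the limit of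
    [(1 + mu t / n)^-n] need not be computed. *)
Lemma T_decay mu K' Q' eta t x : 0 < mu -> 1 <= K' -> half_plane (A := A) (- mu) K' Q' -> 0 < eta -> 0 < t ->
  norm (T t x) <= 2 * K' ^ 2 * exp (- (mu * t / (1 + eta))) * norm x.
Proof.
move=> hmu hK' hQ' heta ht.
apply Rnot_lt_le => hlt.
case: (euler_converges t x _ ht (proj2 (Rlt_0_minus _ _) hlt)) => N [hN hb].
have hmt : 0 < mu * t by apply Rmult_lt_0_compat.
case: (INR_unbounded (mu * t / eta)) => N2 hN2.
set n := (N + N2)%nat.
have := hb n ltac:(rewrite /n; lia).
have hn : 1 <= INR n by rewrite -INR_1; apply le_INR; rewrite /n; lia.
have hn2 : mu * t / eta < INR n.
  by apply (Rlt_le_trans _ (INR N2)) => //; apply le_INR; rewrite /n; lia.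
set h := t / INR n.
have hh : 0 < h by apply Rdiv_lt_0_compat; lra.
have hi : 0 < / h by apply Rinv_0_lt_compat.
(* This [c] makes [- mu + c = / h], so that both families use the resolvent at the same point. *)
set c := / h + mu; have hc : 0 < c by rewrite /c; lra.
have hpow := J_pow_bound (half_plane_disc_family (A := A) (- mu) K' Q' c hK' hQ' hc) n x.
have e0 : - mu + c = / h by rewrite /c; ring.
rewrite disc_point_0 e0 in hpow.
have hQ'h : bounded_inverse A (RtoC (/ h)) (Q' (RtoC (/ h))).
  by case: (hQ' (RtoC (/ h))) => //; rewrite /Re /=; lra.
rewrite iter_scal in hpow; last by move=> a y; exact: (res_scal _ _ _ _ hQ'h).
have eQ : Nat.iter n (Q' (RtoC (/ h))) x = Nat.iter n (Q (RtoC (/ h))) x.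
  elim: (n) => //= k ->; exact: (resolvent_unique _ _ _ _ hQ'h (res_h h hh)).
rewrite eQ norm_scalC Cmod_pow Cmod_R Rabs_pos_eq in hpow; last lra.
rewrite /euler iter_scal; last by move=> a y; exact: (res_scal _ _ _ _ (res_h h hh)).
set w := Nat.iter n (Q (RtoC (/ h))) x in hpow *.
set q := / (1 + mu * h).
have hmh : 0 < mu * h by apply Rmult_lt_0_compat.
have eq1 : / h = q * c by rewrite /q /c; field; split; lra.
have hq : 0 < q by apply Rinv_0_lt_compat; lra.
(* [1 / (1 + s) = 1 - s / (1 + s)], bounded by the tangent inequality for [exp]. *)
have hqe : q <= exp (- (mu * h / (1 + mu * h))).
  apply (Rle_trans _ (1 + - (mu * h / (1 + mu * h)))); last exact: exp_ineq1_le.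
  right; rewrite /q; field; lra.
have hmhe : mu * h < eta.
  have -> : mu * h = mu * t / eta * (eta / INR n) by rewrite /h; field; lra.
  apply (Rlt_le_trans _ (INR n * (eta / INR n))); last by right; field; lra.
  apply Rmult_lt_compat_r => //; apply Rdiv_lt_0_compat; lra.
have hqn : q ^ n <= exp (- (mu * t / (1 + eta))).
  apply (Rle_trans _ (exp (- (mu * h / (1 + mu * h))) ^ n)); first by apply pow_incr; lra.
  rewrite -exp_INR_mult.
  have -> : INR n * - (mu * h / (1 + mu * h)) = - (mu * t / (1 + mu * h)).
    rewrite {1}/h; rewrite -/h; have e2 : INR n * h = t by rewrite /h; field; lra.
    rewrite -{1}e2; field; lra.
  apply exp_le_compat; apply Ropp_le_contravar.
  apply Rmult_le_compat_l; first lra.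
  apply Rinv_le_contravar; lra.
have hw : norm (scal (Cpow (RtoC (/ h)) n) w) <= 2 * K' ^ 2 * exp (- (mu * t / (1 + eta))) * norm x.
  rewrite norm_scalC Cmod_pow Cmod_R Rabs_pos_eq; last lra.
  rewrite eq1 Rpow_mult_distr.
  have hcw : 0 <= c ^ n * norm w by apply Rmult_le_pos; [apply pow_le; lra|exact: norm_ge_0].
  have hqn0 : 0 <= q ^ n by apply pow_le; lra.
  rewrite Rmult_assoc.
  apply (Rle_trans _ (exp (- (mu * t / (1 + eta))) * (2 * K' ^ 2 * norm x))); last by right; ring.
  exact: Rmult_le_compat.
have := norm_minus_le (T t x) (scal (Cpow (RtoC (/ h)) n) w); rewrite norm_minus_sym; lra.
Qed.

End Euler.

(** * Spectrum *)

(** The half-angle exceeds [PI / 2], so the punctured imaginary axis is included; it is treated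
    apart because elsewhere the angle is [atan (Im l / Re l)]. *)
Lemma sector_half_plane delta (l : C) : 0 < delta -> 0 <= Re l -> l <> RtoC 0 -> sector (delta + PI / 2) l.
Proof.
move=> hd hl hn; have hPI := PI_RGT_0.
case: (Req_dec (Re l) 0) => [z|n].
  case: (Rlt_le_dec 0 (Im l)) => hi.
    exists (Im l), (PI / 2); split=> //; split; first lra.
    rewrite cos_PI2 sin_PI2; case: l z hi {hl hn} => a b /= -> _; f_equal; ring.
  have hi' : Im l < 0.
    case: hi => // e; case: hn; case: l z e {hl} => a b /= -> ->; reflexivity.
  exists (- Im l), (- (PI / 2)); split; first lra. split; first lra.
  rewrite cos_neg sin_neg cos_PI2 sin_PI2; case: l z hi' {hl hn hi} => a b /= -> _; f_equal; ring.
have hp : 0 < Re l by lra.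
set q := Im l / Re l.
have h1 : 0 < 1 + q ^ 2 by nra.
have hs : 0 < sqrt (1 + q ^ 2) by apply sqrt_lt_R0.
exists (Re l * sqrt (1 + q ^ 2)), (atan q); split; first exact: Rmult_lt_0_compat.
split; first by have := atan_bound q; lra.
have e : 1 + q² = 1 + q ^ 2 by rewrite /Rsqr; ring.
rewrite cos_atan sin_atan e.
rewrite /q in hs h1 *; case: l hp hs {hl hn n q h1 e} => a b /= hp hs.
set s := sqrt _ in hs *; f_equal; field; lra.
Qed.

Lemma generates_half_plane {H : HilbertSpace} (A : operator H) : generates_bounded_holomorphic A ->
  exists (K : R) (Q : C -> H -> H), 1 <= K /\ forall l, 0 <= Re l ->
    bounded_inverse A l (Q l) /\ forall y, Cmod l * norm (Q l y) <= K * norm y.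
Proof.
case=> _ [_ [delta [K0 [hd [hK h]]]]].
have ex (l : C) : exists Q : H -> H, 0 <= Re l ->
    bounded_inverse A l Q /\ forall y, Cmod l * norm (Q y) <= K0 * norm y.
  case: (Rle_lt_dec 0 (Re l)) => hl; last by exists (fun y => y) => ?; lra.
  have [|Q hQ] := h l; last by exists Q.
  case: (excluded_middle_informative (l = RtoC 0)) => [->|n]; [by left|right].
  apply sector_half_plane => //; lra.
exists (Rmax 1 K0), (fun l => proj1_sig (constructive_indefinite_description _ (ex l))).
split; first exact: Rmax_l.
move=> l hl; have [h1 h2] := proj2_sig (constructive_indefinite_description _ (ex l)) hl.
split=> // y; apply (Rle_trans _ _ _ (h2 y)).
apply Rmult_le_compat_r; [exact: norm_ge_0|exact: Rmax_r].
Qed.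

(** * Perturbation of resolvents *)

Section Neumann.
Context {H : HilbertSpace} {A : operator H}.

(** [(A + m) x = y] is the fixed-point equation [x = Q (y + (l - m) x)], a contraction with factor
    [1/2]; summing the geometric series doubles the bound. *)
Lemma neumann l m Q B : bounded_inverse A l Q -> (forall y, norm (Q y) <= B * norm y) -> 0 < B ->
  Cmod (m - l)%C * B <= / 2 ->
  exists P, bounded_inverse A m P /\ forall y, norm (P y) <= 2 * B * norm y.
Proof.
move=> hQ hB hB0 hml.
have contr y : norm (Q (scal (l - m)%C y)) <= / 2 * norm y.
  apply (Rle_trans _ _ _ (hB _)); rewrite norm_scalC.
  have -> : (l - m = - (m - l))%C by ring.
  rewrite Cmod_opp; have := Rmult_le_compat_r _ _ _ (norm_ge_0 y) hml; lra.
have ex y : exists x, x = Q (plus y (scal (l - m)%C x)) /\ norm x <= 2 * B * norm y.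
  pose u := fix u (n : nat) : H := match n with O => zero | S k => Q (plus y (scal (l - m)%C (u k))) end.
  have d n : norm (minus (u (S n)) (u n)) <= norm (Q y) * (/ 2) ^ n.
    elim: n => [|n IH].
      rewrite /= Rmult_1_r; right; f_equal.
      have -> : scal (l - m)%C zero = (zero : H) by rewrite scal_zero_r.
      rewrite plus_zero_r; hvec.
    have -> : minus (u (S (S n))) (u (S n)) = Q (scal (l - m)%C (minus (u (S n)) (u n))).
      rewrite -[u (S (S n))]/(Q (plus y (scal (l - m)%C (u (S n))))) -{2}[u (S n)]/(Q (plus y (scal (l - m)%C (u n)))).
      rewrite -(res_minus _ _ _ _ hQ); congr Q; hvec.
    apply (Rle_trans _ _ _ (contr _)); rewrite -[(/ 2) ^ S n]/(/ 2 * (/ 2) ^ n); lra.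
  case: (geometric_cauchy u _ (norm_ge_0 (Q y)) d) => x [hx hxb].
  exists x; split.
    apply norm_minus_small_eq => eps he.
    case: (hx (eps / 2) ltac:(lra)) => N hN.
    have := hN (S N) ltac:(lia); have := hN N ltac:(lia).
    have := contr (minus (u N) x).
    have -> : Q (scal (l - m)%C (minus (u N) x)) = minus (u (S N)) (Q (plus y (scal (l - m)%C x))).
      rewrite -[u (S N)]/(Q (plus y (scal (l - m)%C (u N)))) -(res_minus _ _ _ _ hQ); congr Q; hvec.
    have := norm_triangle3 x (u (S N)) (Q (plus y (scal (l - m)%C x))).
    rewrite (norm_minus_sym x (u (S N))); have := norm_ge_0 (minus (u N) x); lra.
  have := hxb O; rewrite /= Rmult_1_r.
  have -> : minus x zero = x by hvec.
  have := hB y; lra.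
have inj x : dom A x -> plus (A x) (scal m x) = zero -> x = zero.
  move=> hx e; apply norm_eq_0.
  have e2 : x = Q (scal (l - m)%C x).
    have -> : scal (l - m)%C x = minus (plus (A x) (scal l x)) (plus (A x) (scal m x)) by hvec.
    rewrite e; have -> : minus (plus (A x) (scal l x)) zero = plus (A x) (scal l x) by hvec.
    by rewrite (proj2 (proj2 hQ)).
  have := contr x; rewrite -e2; have := norm_ge_0 x; lra.
pose P y := proj1_sig (constructive_indefinite_description _ (ex y)).
have hP y : P y = Q (plus y (scal (l - m)%C (P y))) /\ norm (P y) <= 2 * B * norm y
  := proj2_sig (constructive_indefinite_description _ (ex y)).
have dP y : dom A (P y) by rewrite (proj1 (hP y)); exact: (res_dom _ _ _ hQ).
have aP y : plus (A (P y)) (scal m (P y)) = y.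
  have e : A (P y) = minus (plus y (scal (l - m)%C (P y))) (scal l (P y)).
    by rewrite {1}(proj1 (hP y)) (res_op _ _ _ hQ) -(proj1 (hP y)).
  rewrite e; hvec.
have uniq x : dom A x -> P (plus (A x) (scal m x)) = x.
  move=> hx; set y := plus _ _.
  have e : minus (P y) x = zero.
    apply inj; first exact: dom_minus.
    rewrite op_minus //.
    have -> : plus (minus (A (P y)) (A x)) (scal m (minus (P y) x)) =
      minus (plus (A (P y)) (scal m (P y))) (plus (A x) (scal m x)) by hvec.
    rewrite aP -/y; hvec.
  have -> : P y = plus (minus (P y) x) x by hvec.
  rewrite e; hvec.
exists P; split; last by move=> y; case: (hP y).
split; last by split=> // y; split.
split.
- move=> x y.
  have -> : plus x y = plus (A (plus (P x) (P y))) (scal m (plus (P x) (P y))).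
    rewrite op_plus // -{1}(aP x) -{1}(aP y); hvec.
  by rewrite uniq //; apply dom_plus.
- move=> k x.
  have -> : scal k x = plus (A (scal k (P x))) (scal m (scal k (P x))).
    rewrite op_scal // -{1}(aP x); hvec.
  by rewrite uniq //; apply dom_scal.
- exists (2 * B); split; first lra. by move=> y; case: (hP y).
Qed.

Lemma bounded_inverse_pos_bound l Q : bounded_inverse A l Q ->
  exists B, 0 < B /\ forall y : H, norm (Q y) <= B * norm y.
Proof. by case=> hl _; case: (linear_norm _ hl) => B [hB h]; exists B. Qed.

(** The estimate [|l| |Q l| <= K] is void near [l = 0]; there the inverse at [0] is perturbed, and
    elsewhere [|l|] is bounded below. *)
Lemma closed_half_plane_bound K Q :
  (forall l, 0 <= Re l -> bounded_inverse A l (Q l) /\ forall y, Cmod l * norm (Q l y) <= K * norm y) ->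
  exists B, 0 < B /\ forall l y, 0 <= Re l -> norm (Q l y) <= B * norm y.
Proof.
move=> hQ.
have h0 : 0 <= Re (RtoC 0) by rewrite /Re /=; lra.
case: (hQ _ h0) => hQ0 _.
case: (bounded_inverse_pos_bound _ _ hQ0) => B [hB hb].
exists (2 * B * (Rabs K + 1)); have hK := Rabs_pos K; split; first by apply Rmult_lt_0_compat; lra.
move=> l y hl; case: (hQ l hl) => hQl hbl.
have hy := norm_ge_0 y.
have hBy : 0 <= B * norm y by apply Rmult_le_pos; lra.
case: (Rle_lt_dec (Cmod l * B) (/ 2)) => hc.
  have e : (l - RtoC 0 = l)%C by ring.
  case: (neumann _ l _ B hQ0 hb hB); first by rewrite e.
  move=> P [hP hPb]; rewrite (resolvent_unique _ _ _ y hQl hP).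
  apply (Rle_trans _ _ _ (hPb y)); nra.
have hcl : 0 < Cmod l by have := Cmod_ge_0 l; nra.
apply (Rmult_le_reg_l (Cmod l)) => //.
apply (Rle_trans _ _ _ (hbl y)).
have := Rle_abs K => hk.
apply (Rle_trans _ ((Rabs K + 1) * norm y)); first by apply Rmult_le_compat_r; lra.
have : / 2 * ((Rabs K + 1) * norm y) <= Cmod l * B * ((Rabs K + 1) * norm y).
  apply Rmult_le_compat_r; [apply Rmult_le_pos; lra|lra].
lra.
Qed.

End Neumann.

(** * Spectrum, numerical range and decay rates *)

Section Spectrum.
Context {H : HilbertSpace} {A : operator H} {K : R} {Q : C -> H -> H} (K_ge_1 : 1 <= K)
  (hQ : forall l, 0 <= Re l -> bounded_inverse A l (Q l) /\ forall y, Cmod l * norm (Q l y) <= K * norm y).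

Lemma closed_half_plane_open : half_plane (A := A) 0 K Q.
Proof.
move=> l hl; case: (hQ l ltac:(lra)) => h1 h2; split=> // y.
by have -> : (l - RtoC 0 = l)%C by ring.
Qed.

Lemma resolvent_set_neg z : Re z <= 0 -> resolvent_set A z.
Proof.
move=> hz; exists (Q (Copp z)); case: (hQ (Copp z)) => //.
by rewrite /Re /Copp /= -[fst z]/(Re z); lra.
Qed.

(** The resolvent bound [B] is uniform along the imaginary axis, so the perturbation radius
    [/ (2 B)] is too; a whole strip is gained, which is what makes the spectral abscissa strictly
    positive. *)
Lemma resolvent_set_near_axis : exists e, 0 < e /\ forall z, Re z <= e -> resolvent_set A z.
Proof.
case: (closed_half_plane_bound K Q hQ) => B [hB hb].
exists (/ (2 * B)); split; first by apply Rinv_0_lt_compat; lra.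
move=> z hz; case: (Rle_lt_dec (Re z) 0) => hz0; first exact: resolvent_set_neg.
pose l : C := (0, - Im z).
have hl : 0 <= Re l by rewrite /l /=; lra.
case: (hQ l hl) => hQl _.
have hd : Cmod (Copp z - l)%C * B <= / 2.
  have -> : (Copp z - l = RtoC (- Re z))%C.
    rewrite /l; case: (z) => a b; rewrite /Re /Im /Copp /Cminus /Cplus /Copp /RtoC /=; f_equal; ring.
  rewrite Cmod_R Rabs_Ropp Rabs_pos_eq; last lra.
  apply (Rle_trans _ (/ (2 * B) * B)); first by apply Rmult_le_compat_r; lra.
  right; field; lra.
case: (neumann l (Copp z) (Q l) B hQl (fun y => hb l y hl) hB hd) => P [hP _].
by exists P.
Qed.

Lemma accretive_resolvent_bound mu l P : (forall x, dom A x -> mu * norm x ^ 2 <= rin (A x) x) ->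
  - mu < Re l -> bounded_inverse A l P -> forall y : H, norm (P y) <= / (Re l + mu) * norm y.
Proof.
move=> hmu hl hP y.
have hx := hmu _ (res_dom _ _ y hP).
rewrite (res_op _ _ y hP) rin_minus_l in hx.
set x := P y in hx *.
have e : rin (scal l x) x = Re l * norm x ^ 2.
  rewrite /rin inner_scal inner_norm /Re /Cmult /=; ring.
rewrite e in hx.
have h1 := rin_le y x.
case: (Req_dec (norm x) 0) => [->|n].
  by apply Rmult_le_pos; [apply Rlt_le, Rinv_0_lt_compat; lra|exact: norm_ge_0].
have hp : 0 < norm x by have := norm_ge_0 x; lra.
apply (Rmult_le_reg_l (Re l + mu)); first lra.
rewrite -Rmult_assoc Rinv_r ?Rmult_1_l; last lra.
apply (Rmult_le_reg_r (norm x)) => //; nra.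
Qed.

(** Continuation along a horizontal line from the left half-plane. Accretivity gives the a priori
    bound [/ d] at every point of the resolvent set passed on the way, so each perturbation may
    advance by the fixed length [d / 2]. *)
Lemma accretive_resolvent_set mu z : (forall x, dom A x -> mu * norm x ^ 2 <= rin (A x) x) ->
  Re z < mu -> resolvent_set A z.
Proof.
move=> hmu hz; set d := mu - Re z; have hd : 0 < d by rewrite /d; lra.
have step : forall k xi, xi <= INR k * (d / 2) -> xi <= Re z -> resolvent_set A (xi, Im z).
  elim=> [|k IH] xi h1 h2.
    by apply resolvent_set_neg; rewrite /= in h1 *; lra.
  rewrite S_INR in h1.
  case: (IH (xi - d / 2) ltac:(lra) ltac:(lra)) => P hP.
  have hRe : Re (Copp (xi - d / 2, Im z)) = - (xi - d / 2) by [].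
  have hl : - mu < Re (Copp (xi - d / 2, Im z)) by rewrite hRe; lra.
  have hb := accretive_resolvent_bound mu _ P hmu hl hP.
  have hbd y : norm (P y) <= / d * norm y.
    apply (Rle_trans _ _ _ (hb y)); apply Rmult_le_compat_r; first exact: norm_ge_0.
    apply Rinv_le_contravar => //; rewrite hRe /d; lra.
  have hc : Cmod (Copp (xi, Im z) - Copp ((xi - d / 2)%R, Im z))%C * / d <= / 2.
    have -> : (Copp (xi, Im z) - Copp ((xi - d / 2)%R, Im z) = RtoC (- (d / 2)))%C.
      by rewrite /Copp /Cminus /Cplus /RtoC /=; f_equal; ring.
    rewrite Cmod_R Rabs_Ropp Rabs_pos_eq; last lra.
    right; field; lra.
  case: (neumann _ _ _ _ hP hbd (Rinv_0_lt_compat _ hd) hc) => P' [hP' _].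
  by exists P'.
case: (INR_unbounded (Re z / (d / 2))) => k hk.
have -> : z = (Re z, Im z) by case: z {hz d hd step hk}.
apply (step k); last exact: Rle_refl.
have -> : Re z = Re z / (d / 2) * (d / 2) by field; lra.
apply Rmult_le_compat_r; lra.
Qed.

(** Three regions: the closed right half-plane, where the given estimates apply; the strip far from
    the real axis, reached by perturbation from the imaginary axis; and a compact rectangle, where
    local bounds are made uniform by compactness. *)
Lemma half_plane_of_resolvent_set mu : 0 < mu -> (forall z, Re z <= mu -> resolvent_set A z) ->
  exists K' Q', 1 <= K' /\ half_plane (A := A) (- mu) K' Q'.
Proof.
move=> hmu hres.
have ex (l : C) : exists P : H -> H, - mu <= Re l -> bounded_inverse A l P.
  case: (Rle_lt_dec (- mu) (Re l)) => hl; last by exists (fun y => y) => ?; lra.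
  case: (hres (Copp l)) => [|P hP]; first by rewrite /Re /Copp /= -[fst l]/(Re l); lra.
  exists P => _; have e : (- - l = l)%C by ring. by rewrite -e.
pose Q' l := proj1_sig (constructive_indefinite_description _ (ex l)).
have hQ' l : - mu <= Re l -> bounded_inverse A l (Q' l) := proj2_sig (constructive_indefinite_description _ (ex l)).
have exB u v : exists B, 0 < B /\ (- mu <= u -> forall y, norm (Q' (u, v) y) <= B * norm y).
  case: (Rle_lt_dec (- mu) u) => hu; last by exists 1; split; lra.
  case: (bounded_inverse_pos_bound _ _ (hQ' (u, v) hu)) => B [hB hb]; by exists B.
pose Bf u v := proj1_sig (constructive_indefinite_description _ (exB u v)).
have hBf u v : 0 < Bf u v /\ (- mu <= u -> forall y, norm (Q' (u, v) y) <= Bf u v * norm y)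
  := proj2_sig (constructive_indefinite_description _ (exB u v)).
have hdel u v : 0 < / (4 * Bf u v) by apply Rinv_0_lt_compat; case: (hBf u v); lra.
(* Within the radius [/ (4 B)] around a centre with bound [B], the perturbed inverse is bounded by
   [2 B], which is half the reciprocal of the radius. A lower bound [d] for the radii of the cover
   is therefore a uniform bound [/ (2 d)]. *)
case: (compactness_value_2d (- mu) 0 (- (2 * mu * K)) (2 * mu * K) (fun u v => mkposreal _ (hdel u v))) => d hcomp.
have hd := cond_pos d.
have rect x w y : - mu <= x <= 0 -> - (2 * mu * K) <= w <= 2 * mu * K -> norm (Q' (x, w) y) <= / (2 * d) * norm y.
  move=> hx hw; apply NNPP => hno; apply (hcomp x w hx hw) => -[u [v [hu [hv [h1 [h2 h3]]]]]].
  apply hno; rewrite /= in h1 h2 h3.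
  case: (hBf u v) => hB hb.
  have hdiff : Cmod ((x, w) - (u, v))%C * Bf u v <= / 2.
    have hm : Cmod ((x, w) - (u, v))%C <= 2 * / (4 * Bf u v).
      apply (Rle_trans _ _ _ (Cmod_le_Re_Im _)); rewrite /Re /Im /Cminus /Cplus /Copp /=.
      rewrite /Rminus in h1 h2; lra.
    apply (Rle_trans _ (2 * / (4 * Bf u v) * Bf u v)); first by apply Rmult_le_compat_r; lra.
    right; field; lra.
  case: (neumann (u, v) (x, w) _ _ (hQ' (u, v) (proj1 hu)) (hb (proj1 hu)) hB hdiff) => P [hP hPb].
  rewrite (resolvent_unique _ _ _ y (hQ' (x, w) (proj1 hx)) hP).
  apply (Rle_trans _ _ _ (hPb y)); apply Rmult_le_compat_r; first exact: norm_ge_0.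
  have -> : 2 * Bf u v = / (2 * / (4 * Bf u v)) by field; lra.
  apply Rinv_le_contravar; lra.
case: (closed_half_plane_bound K Q hQ) => B [hB hb].
have hd' : 0 < / (2 * d) by apply Rinv_0_lt_compat; lra.
(* A common majorant of the constants of the three regions: [K + mu B], [1 + 2 K] and
   [(mu + 2 mu K) / (2 d)]. *)
exists (1 + 2 * K + mu * B + (mu + 2 * mu * K) * / (2 * d)), Q'.
have hmB : 0 < mu * B by apply Rmult_lt_0_compat.
have hmK : 0 < mu * K by apply Rmult_lt_0_compat; lra.
have hmd : 0 < (mu + 2 * mu * K) * / (2 * d) by apply Rmult_lt_0_compat; lra.
split; first lra.
move=> l hl; split; first by apply hQ'; lra.
move=> y; have hy := norm_ge_0 y.
set N := norm (Q' l y); have hN : 0 <= N by apply norm_ge_0.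
suff hs : exists k, Cmod (l - RtoC (- mu))%C * N <= k * norm y /\
    k <= 1 + 2 * K + mu * B + (mu + 2 * mu * K) * / (2 * d).
  case: hs => k [h1 h2]; apply (Rle_trans _ _ _ h1); by apply Rmult_le_compat_r.
have tri : Cmod (l - RtoC (- mu))%C <= Cmod l + mu.
  apply (Rle_trans _ _ _ (Cmod_triangle _ _)); rewrite Cmod_opp Cmod_R Rabs_Ropp Rabs_pos_eq; lra.
case: (Rle_lt_dec 0 (Re l)) => hl0.
  exists (K + mu * B); split; last lra.
  case: (hQ l hl0) => h1 h2.
  have e : N = norm (Q l y) by rewrite /N (resolvent_unique _ _ _ y (hQ' l (Rlt_le _ _ hl)) h1).
  have := h2 y; have := hb l y hl0; rewrite -e => h3 h4.
  apply (Rle_trans _ ((Cmod l + mu) * N)); first by apply Rmult_le_compat_r.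
  have := Rmult_le_compat_l _ _ _ (Rlt_le _ _ hmu) h3; lra.
have im_tri : Cmod (l - RtoC (- mu))%C <= mu + Rabs (Im l).
  apply (Rle_trans _ _ _ (Cmod_le_Re_Im _)).
  have -> : Re (l - RtoC (- mu))%C = Re l + mu by rewrite /Re /Cminus /Cplus /Copp /=; ring.
  have -> : Im (l - RtoC (- mu))%C = Im l by rewrite /Im /Cminus /Cplus /Copp /=; ring.
  rewrite Rabs_pos_eq; lra.
case: (Rle_lt_dec (Rabs (Im l)) (2 * mu * K)) => him.
  exists ((mu + 2 * mu * K) * / (2 * d)); split; last lra.
  rewrite Rmult_assoc; apply Rmult_le_compat => //; [exact: Cmod_ge_0|lra|].
  have el : l = (Re l, Im l) by case: (l).
  rewrite /N el; apply rect; first lra.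
  by apply Rabs_le_between.
(* Here [|Im l| > 2 mu K], so the horizontal distance, less than [mu], times the bound [K / |Im l|]
   at [l0] is below [1/2]. *)
pose l0 : C := (0, Im l).
have hl00 : 0 <= Re l0 by rewrite /=; lra.
have himp : 0 < Rabs (Im l) by lra.
have cl0 : Cmod l0 = Rabs (Im l).
  rewrite /Cmod /l0 /=.
  have -> : 0 * (0 * 1) + Im l * (Im l * 1) = (Im l)² by rewrite /Rsqr; ring.
  exact: sqrt_Rsqr_abs.
case: (hQ l0 hl00) => h1 h2.
have hb0 w : norm (Q l0 w) <= K / Rabs (Im l) * norm w.
  apply (Rmult_le_reg_l (Rabs (Im l))) => //; have := h2 w; rewrite cl0 => h3.
  apply (Rle_trans _ _ _ h3); right; field; lra.
have hKi : 0 < K / Rabs (Im l) by apply Rdiv_lt_0_compat; lra.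
have hdiff : Cmod (l - l0)%C * (K / Rabs (Im l)) <= / 2.
  have -> : (l - l0 = RtoC (Re l))%C.
    by rewrite /l0; case: (l) => a b; rewrite /Cminus /Cplus /Copp /RtoC /=; f_equal; ring.
  rewrite Cmod_R Rabs_left //.
  apply (Rle_trans _ (mu * (K / Rabs (Im l)))); first by apply Rmult_le_compat_r; lra.
  apply (Rmult_le_reg_r (Rabs (Im l))) => //.
  have -> : mu * (K / Rabs (Im l)) * Rabs (Im l) = mu * K by field; lra.
  lra.
case: (neumann l0 l _ _ h1 hb0 hKi hdiff) => P [hP hPb].
have hNb : N <= 2 * (K / Rabs (Im l)) * norm y.
  by rewrite /N (resolvent_unique _ _ _ y (hQ' l (Rlt_le _ _ hl)) hP).
exists (1 + 2 * K); split; last lra.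
apply (Rle_trans _ ((mu + Rabs (Im l)) * (2 * (K / Rabs (Im l)) * norm y))).
  apply Rmult_le_compat => //; exact: Cmod_ge_0.
have -> : (mu + Rabs (Im l)) * (2 * (K / Rabs (Im l)) * norm y) = (2 * mu * K / Rabs (Im l) + 2 * K) * norm y by field; lra.
apply Rmult_le_compat_r => //.
have : 2 * mu * K / Rabs (Im l) <= 1; last lra.
apply (Rmult_le_reg_r (Rabs (Im l))) => //.
rewrite /Rdiv Rmult_assoc Rinv_l; lra.
Qed.

Context {T : R -> H -> H} (T_C0 : C0_semigroup T) (T_gen : generated_by_opp A T)
  (A_dense : densely_defined A).

Lemma norm_sq_hderiv x t : 0 <= t -> dom A x ->
  hderiv (fun s => norm (T s x) ^ 2) t (- 2 * rin (T t (A x)) (T t x)).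
Proof.
move=> ht hx eps he.
case: (T_hderiv_rin T_C0 T_gen x x t ht hx hx eps he) => d [hd hb]; exists d; split=> // s hs hsd.
have := hb s hs hsd; rewrite !rin_norm (rin_sym (T t (A x)) (T t x)).
by have -> : - rin (T t (A x)) (T t x) - rin (T t (A x)) (T t x) = - 2 * rin (T t (A x)) (T t x) by ring.
Qed.

(* Log-convexity forces the orbit of [x] to decay no faster than its initial rate
   [q = Re(Ax|x)/|x|^2], whereas every orbit decays at rate [mu]. *)
Lemma log_convex_accretive mu :
  (forall u, u <> zero -> log_convex (fun t => norm (T t u))) ->
  0 < mu -> (forall z, Re z <= mu -> resolvent_set A z) ->
  forall x, dom A x -> mu * norm x ^ 2 <= rin (A x) x.
Proof.
move=> hII hmu hres x hx.
case: (half_plane_of_resolvent_set mu hmu hres) => K' [Q' [hK' hQ']].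
apply Rnot_lt_le => hlt.
have hx0 : x <> zero.
  move=> e; have nz : norm x = 0 by rewrite e norm_zero.
  have := Rabs_le_between (rin (A x) x) 0; have := rin_abs_le (A x) x.
  rewrite nz Rmult_0_r => h [h1 _]; have := h1 h; rewrite nz in hlt; nra.
have hn : 0 < norm x ^ 2.
  case: (Req_dec (norm x) 0) => [/norm_eq_0//|n]; move: (norm_ge_0 x); nra.
have hnx : norm x <> 0 by move=> e; rewrite e in hn; lra.
set q := rin (A x) x / norm x ^ 2.
have hq : q < mu.
  apply (Rmult_lt_reg_r (norm x ^ 2)) => //; rewrite /q /Rdiv Rmult_assoc Rinv_l; lra.
(* The tilt [2 q] cancels the initial slope: [2 q |x|^2 - 2 Re(Ax|x) = 0]. A convex function with
   zero slope at [0] stays above its initial value, which is [low]. *)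
have tc := log_convex_tilt_sq _ (fun t _ => norm_ge_0 (T t x)) (hII x hx0) (2 * q).
have hd0 := hderiv_exp_mult (2 * q) _ 0 _ (norm_sq_hderiv x 0 (Rle_refl _) hx).
rewrite !(C0_zero _ T_C0) Rmult_0_r exp_0 in hd0.
have low t : 0 < t -> norm x ^ 2 <= exp (2 * q * t) * norm (T t x) ^ 2.
  move=> ht; have := hconvex_slope_l _ 0 t _ tc (Rle_refl _) ht hd0.
  rewrite (C0_zero _ T_C0) Rmult_0_r exp_0 Rminus_0_r !Rmult_1_l.
  have -> : 2 * q * norm x ^ 2 + - 2 * rin (A x) x = 0 by rewrite /q; field.
  move=> h; have := Rmult_le_compat_r t _ _ ltac:(lra) h.
  rewrite /Rdiv Rmult_assoc Rinv_l; lra.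
(* A positive rate strictly between [q] and [mu]; with [eta = mu / nu - 1] the rate in [T_decay]
   becomes exactly [nu]. *)
set nu := (mu + Rmax q 0) / 2.
have m1 := Rmax_l q 0; have m2 := Rmax_r q 0.
have m3 : Rmax q 0 < mu by apply Rmax_lub_lt.
have hnu : q < nu /\ 0 < nu < mu by rewrite /nu; lra.
set eta := mu / nu - 1.
have heta : 0 < eta.
  have : 1 < mu / nu; last by rewrite /eta; lra.
  apply (Rmult_lt_reg_r nu); first lra. rewrite /Rdiv Rmult_assoc Rinv_l; lra.
have up t : 0 < t -> norm (T t x) <= 2 * K' ^ 2 * exp (- (nu * t)) * norm x.
  move=> ht; have := T_decay T_C0 T_gen A_dense K_ge_1 closed_half_plane_open mu K' Q' eta t x hmu hK' hQ' heta ht.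
  by have -> : mu * t / (1 + eta) = nu * t by rewrite /eta; field; lra.
set C := (2 * K' ^ 2) ^ 2.
have hC : 1 <= C by apply pow_R1_Rle; nra.
have hgap : 0 < 2 * (nu - q) by lra.
(* At this time the two bounds give [1 <= C exp(-C)], against [exp C >= 1 + C]. *)
set t := C / (2 * (nu - q)).
have ht : 0 < t by apply Rdiv_lt_0_compat; lra.
have sq : norm (T t x) ^ 2 <= (2 * K' ^ 2 * exp (- (nu * t)) * norm x) ^ 2.
  by apply pow_incr; split; [exact: norm_ge_0|exact: up].
have l := low t ht.
have hE : exp (2 * q * t) * (2 * K' ^ 2 * exp (- (nu * t)) * norm x) ^ 2 = C * exp (- (2 * (nu - q) * t)) * norm x ^ 2.
  have -> : - (2 * (nu - q) * t) = 2 * q * t + (- (nu * t) + - (nu * t)) by ring.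
  rewrite !exp_plus /C; ring.
have l2 : norm x ^ 2 <= C * exp (- (2 * (nu - q) * t)) * norm x ^ 2.
  rewrite -hE; apply (Rle_trans _ _ _ l); apply Rmult_le_compat_l => //; exact/Rlt_le/exp_pos.
have e1 : exp (- (2 * (nu - q) * t)) * exp (2 * (nu - q) * t) = 1 by rewrite -exp_plus Rplus_opp_l exp_0.
have e2 := exp_ineq1_le (2 * (nu - q) * t).
have e3 : 2 * (nu - q) * t = C by rewrite /t; field; lra.
rewrite e3 in e1 e2 l2.
have l3 : 1 <= C * exp (- C) by apply (Rmult_le_reg_r (norm x ^ 2)) => //; lra.
have p := exp_pos (- C).
nra.
Qed.

End Spectrum.

(** * Orbits of the semigroup *)

Lemma hcont_comp g f t : hcont f t -> continuity_pt g (f t) -> hcont (fun s => g (f s)) t.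
Proof.
move=> hf hg eps he; case: (hg eps he) => a [ha hb]; case: (hf a ha) => d [hd hdb].
exists d; split=> // s hs hsd.
case: (Req_dec (f s) (f t)) => [->|n]; first by rewrite Rminus_diag Rabs_R0.
apply hb; split; first by split=> // e; apply n.
exact: hdb.
Qed.

Lemma hderiv_comp g f t a l : hderiv f t a -> is_derive g (f t) l -> hderiv (fun s => g (f s)) t (l * a).
Proof.
move=> hf /is_derive_eps hg eps he.
set D := Rabs a + Rabs l + 2.
have hD : 2 <= D by rewrite /D; move: (Rabs_pos a) (Rabs_pos l); lra.
have he' : 0 < Rmin 1 (eps / D) by apply Rmin_pos; [lra|apply Rdiv_lt_0_compat; lra].
set e := Rmin 1 (eps / D) in he'.
have e1 : e <= 1 by apply Rmin_l.
have e2 : e * D <= eps.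
  apply (Rle_trans _ (eps / D * D)); last by right; field; lra.
  apply Rmult_le_compat_r; [lra|exact: Rmin_r].
case: (hg e he') => d1 [hd1 b1]; case: (hf e he') => d2 [hd2 b2].
case: (hderiv_hcont f t a hf d1 hd1) => d3 [hd3 b3].
exists (Rmin d2 d3); split; first exact: Rmin_pos.
move=> s hs hsd; move: (Rmin_l d2 d3) (Rmin_r d2 d3) => m1 m2.
have c1 := b1 _ (b3 s hs ltac:(lra)); have c2 := b2 s hs ltac:(lra).
have p := Rabs_pos (s - t).
have c3 : Rabs (f s - f t) <= (e + Rabs a) * Rabs (s - t).
  have -> : f s - f t = (f s - f t - (s - t) * a) + (s - t) * a by ring.
  apply (Rle_trans _ _ _ (Rabs_triang _ _)); rewrite Rabs_mult; lra.
have -> : g (f s) - g (f t) - (s - t) * (l * a) =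
  (g (f s) - g (f t) - (f s - f t) * l) + l * (f s - f t - (s - t) * a) by ring.
apply (Rle_trans _ _ _ (Rabs_triang _ _)); rewrite Rabs_mult.
have q := Rmult_le_compat_l _ _ _ (Rabs_pos l) c2.
have q2 := Rmult_le_compat_l _ _ _ (Rlt_le _ _ he') c3.
apply (Rle_trans _ (e * D * Rabs (s - t))); last by apply Rmult_le_compat_r.
have q3 : e * (e * Rabs (s - t)) <= e * (1 * Rabs (s - t)).
  apply Rmult_le_compat_l; first lra. apply Rmult_le_compat_r; lra.
rewrite /D; nra.
Qed.

Lemma hcont_rin {H : HilbertSpace} (u v : R -> H) t : vcont u t -> vcont v t ->
  hcont (fun s => rin (u s) (v s)) t.
Proof.
move=> hu hv eps he.
set D := norm (v t) + norm (u t) + 2.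
have hD : 2 <= D by rewrite /D; move: (norm_ge_0 (v t)) (norm_ge_0 (u t)); lra.
have he' : 0 < Rmin 1 (eps / D) by apply Rmin_pos; [lra|apply Rdiv_lt_0_compat; lra].
set e := Rmin 1 (eps / D) in he'.
have e1 : e <= 1 by apply Rmin_l.
have e2 : e * D <= eps.
  apply (Rle_trans _ (eps / D * D)); last by right; field; lra.
  apply Rmult_le_compat_r; [lra|exact: Rmin_r].
case: (hu e he') => d1 [hd1 b1]; case: (hv e he') => d2 [hd2 b2].
exists (Rmin d1 d2); split; first exact: Rmin_pos.
move=> s hs hsd; move: (Rmin_l d1 d2) (Rmin_r d1 d2) => m1 m2.
move: (b1 s hs ltac:(lra)) (b2 s hs ltac:(lra)).
set U := minus (u s) _; set V := minus (v s) _ => c1 c2.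
have -> : rin (u s) (v s) - rin (u t) (v t) = rin U (v s) + rin (u t) V.
  rewrite /U /V !(rin_minus_l, rin_minus_r); ring.
apply (Rle_lt_trans _ _ _ (Rabs_triang _ _)).
have q1 : Rabs (rin U (v s)) <= e * (norm (v t) + 1).
  apply (Rle_trans _ _ _ (rin_abs_le _ _)).
  apply Rmult_le_compat; try exact: norm_ge_0; first lra.
  move: (norm_minus_le (v s) (v t)); rewrite -/V; lra.
have q2 : Rabs (rin (u t) V) <= norm (u t) * e.
  apply (Rle_trans _ _ _ (rin_abs_le _ _)).
  apply Rmult_le_compat_l; [exact: norm_ge_0|lra].
rewrite /D in e2; lra.
Qed.

Lemma exp_strictly_convex a b X Y : 0 < a -> 0 < b -> a + b = 1 -> X <> Y ->
  exp (a * X + b * Y) < a * exp X + b * exp Y.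
Proof.
move=> ha hb hab hXY; set M := a * X + b * Y.
have hM := exp_pos M.
have h : forall Z, Z <> M -> exp M * (1 + (Z - M)) < exp Z.
  move=> Z hZ; have -> : exp Z = exp M * exp (Z - M) by rewrite -exp_plus; f_equal; ring.
  apply Rmult_lt_compat_l; [lra|apply exp_ineq1; lra].
have e1 : X <> M.
  move=> e; apply hXY; apply (Rmult_eq_reg_l b); last lra.
  have : (a + b) * X = M by rewrite hab -e; ring. rewrite /M; lra.
have e2 : Y <> M.
  move=> e; apply hXY; apply (Rmult_eq_reg_l a); last lra.
  have : (a + b) * Y = M by rewrite hab -e; ring. rewrite /M; lra.
have hX := Rmult_lt_compat_l _ _ _ ha (h X e1).
have hY := Rmult_lt_compat_l _ _ _ hb (h Y e2).
have e : a * (exp M * (1 + (X - M))) + b * (exp M * (1 + (Y - M))) = exp M * ((a + b) + (M - (a + b) * M)).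
  rewrite /M; ring.
rewrite hab in e; lra.
Qed.

Lemma rpow_sq x a : 0 <= x -> rpow (x ^ 2) a = rpow x a ^ 2.
Proof.
move=> hx; rewrite /rpow.
case: (Req_EM_T x 0) => [->|n].
  case: Req_EM_T => [_|n']; [ring|case: n'; ring].
case: Req_EM_T => [e|_]; first by exfalso; apply n; nra.
rewrite /Rpower; have -> : x ^ 2 = x * x by ring.
rewrite ln_mult; try lra.
rewrite /= Rmult_1_r -exp_plus; f_equal; ring.
Qed.

Lemma rpow_ge_0 x a : 0 <= rpow x a.
Proof. rewrite /rpow; case: Req_EM_T => _; [lra|exact/Rlt_le/exp_pos]. Qed.

(** Tilts are handled on squared norms, which are differentiable even at zeros of the orbit; [rpow]
    commutes with squaring, so log-convexity passes to the root. *)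
Lemma log_convex_sq h : (forall t, 0 <= t -> 0 <= h t) -> log_convex (fun t => h t ^ 2) -> log_convex h.
Proof.
move=> hp hl r s t hr hrs hst.
have := hl r s t hr hrs hst.
rewrite !rpow_sq; try (apply hp; lra).
have p1 := rpow_ge_0 (h r) ((t - s) / (t - r)); have p2 := rpow_ge_0 (h t) ((s - r) / (t - r)).
have p := Rmult_le_pos _ _ p1 p2.
rewrite -Rpow_mult_distr; move: (rpow _ _ * _) p => q hq hle.
apply Rnot_lt_le => hlt; nra.
Qed.

(** * Right derivative at [0] of a convex function *)

Section Slopes.
Context (h : R -> R) (hc : hconvex h).

Let slope t := (h t - h 0) / t.

Lemma slope_mono s t : 0 < s -> s < t -> slope s <= slope t.
Proof.
move=> hs hst; have := hc 0 s t (Rle_refl _) hs hst; rewrite /slope => hh.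
apply (Rmult_le_reg_r (s * t)); first by apply Rmult_lt_0_compat; lra.
have -> : (h s - h 0) / s * (s * t) = (h s - h 0) * t by field; lra.
have -> : (h t - h 0) / t * (s * t) = (h t - h 0) * s by field; lra.
lra.
Qed.

(** The candidate for [h'(0)]: slopes from [0] increase with [t], so their limit at [0] is their
    infimum, possibly minus infinity. *)
Definition slope_inf : Rbar := Glb_Rbar (fun y => exists t, 0 < t /\ y = (h t - h 0) / t).

Lemma slope_inf_le t : 0 < t -> Rbar_le slope_inf (Finite (slope t)).
Proof. by move=> ht; apply (proj1 (Glb_Rbar_correct _)); exists t. Qed.

Lemma slope_inf_right_derivative : right_derivative0 h slope_inf.
Proof.
have glb : forall b, (forall t, 0 < t -> Rbar_le b (Finite (slope t))) -> Rbar_le b slope_inf.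
  by move=> b hb; apply (proj2 (Glb_Rbar_correct _)) => y [t [ht ->]]; apply hb.
have lb := slope_inf_le.
rewrite /right_derivative0; move: glb lb; case: slope_inf => [d| |] glb lb.
- apply filterlim_at_right_0_R => eps he.
  have [t0 [ht0 hs]] : exists t, 0 < t /\ slope t < d + eps.
    apply NNPP => hno; suff : Rbar_le (Finite (d + eps)) (Finite d) by rewrite /=; lra.
    apply glb => t ht /=; apply Rnot_lt_le => hlt; apply hno; by exists t.
  exists t0; split=> // t ht.
  have h1 := slope_mono t t0 (proj1 ht) (proj2 ht); have h2 := lb t (proj1 ht); rewrite /= in h2.
  rewrite -/(slope t) Rabs_pos_eq; lra.
- by have := lb 1 Rlt_0_1.
- move=> P [M hM]; apply at_right_0.
  have [t0 [ht0 hs]] : exists t, 0 < t /\ slope t < M.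
    apply NNPP => hno; apply (glb (Finite M)) => t ht /=.
    apply Rnot_lt_le => hlt; apply hno; by exists t.
  exists t0; split=> // t ht; apply hM.
  have := slope_mono t t0 (proj1 ht) (proj2 ht); rewrite /slope in hs *; lra.
Qed.

(** Each derivative [h'(t)] dominates the slope over [[0, t]] by convexity, and each slope is a
    derivative at an intermediate point, so the two sets have the same infimum. *)
Lemma slope_inf_Derive : (forall t, 0 < t -> ex_derive h t) -> (forall t, 0 <= t -> hcont h t) ->
  slope_inf = Glb_Rbar (fun y => exists t, 0 < t /\ y = Derive h t).
Proof.
move=> hd hcont; apply eq_sym, is_glb_Rbar_unique; split.
  move=> y [t [ht ->]].
  apply (Rbar_le_trans _ (Finite (slope t))); first exact: slope_inf_le.
  have := hconvex_slope_r h 0 t (Derive h t) hc (Rle_refl _) ht.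
  rewrite Rminus_0_r; apply; exact/is_derive_hderiv/Derive_correct/hd.
move=> b hb; apply (proj2 (Glb_Rbar_correct _)) => y [t [ht ->]].
case: (MVT_half_line h (Derive h) 0 t (Rle_refl _) ht) => //.
  by move=> s hs; apply is_derive_hderiv, Derive_correct, hd; lra.
move=> c [hc0 e].
have -> : (h t - h 0) / t = Derive h c by rewrite e; field; lra.
apply hb; exists c; split=> //; lra.
Qed.

End Slopes.

(** * Equivalence of (I) and (II), and regularity of orbit norms *)

Section Dynamics.
Context {H : HilbertSpace} {A : operator H} {T : R -> H -> H}
  (T_C0 : C0_semigroup T) (T_gen : generated_by_opp A T)
  (A_dense : densely_defined A) (A_closed : closed_operator A)
  {K : R} {Q : C -> H -> H} (K_ge_1 : 1 <= K) (hQ : half_plane (A := A) 0 K Q).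

Lemma norm_pos (u : H) : u <> zero -> 0 < norm u.
Proof. move=> h; case: (norm_ge_0 u) => // e; by case: h; apply norm_eq_0. Qed.

Lemma T_norm_hcont u t : 0 <= t -> hcont (fun s => norm (T s u)) t.
Proof. move=> ht; apply (vcont_hcont_norm (fun s => T s u)); exact: (T_vcont T_C0). Qed.

(** [f1] and [f2] are the first and second derivatives of [norm (T t x) ^ 2], for [x] in [D(A)] and
    [D(A^2)] respectively. *)
Let f1 x t := - 2 * rin (T t (A x)) (T t x).
Let f2 x t := - 2 * (- rin (T t (A (A x))) (T t x) - rin (T t (A x)) (T t (A x))).

Let f1_hderiv x t : 0 <= t -> dom A x -> dom A (A x) -> hderiv (f1 x) t (f2 x t).
Proof. by move=> ht hx hAx; apply hderiv_scal, (T_hderiv_rin T_C0 T_gen). Qed.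

Lemma tilt_convex_dom2 x :
  (forall x : H, dom A x -> dom A (A x) ->
     2 * (rin (A x) x) ^ 2 <= rin (A (A x)) x * norm x ^ 2 + norm (A x) ^ 2 * norm x ^ 2) ->
  dom A x -> dom A (A x) -> tilt_convex (fun t => norm (T t x) ^ 2).
Proof.
move=> hI hx hAx.
apply (tilt_convex_of_deriv _ (f1 x) (f2 x)).
- by move=> t ht; apply (norm_sq_hderiv T_C0 T_gen) => //; lra.
- by move=> t ht; apply f1_hderiv => //; lra.
- move=> t ht; exact: (hderiv_hcont _ _ _ (norm_sq_hderiv T_C0 T_gen x t ht hx)).
- move=> t ht; split; first exact: pow2_ge_0.
  case: (T_dom2 T_C0 T_gen t x (Rlt_le _ _ ht) hx hAx) => d1 [d2 e2].
  have := hI _ d1 d2; rewrite e2 (proj2 (T_dom T_C0 T_gen t x (Rlt_le _ _ ht) hx)).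
  rewrite /f1 /f2 rin_norm; set y := T t x; set z := T t (A x); set w := T t (A (A x)) => h.
  split; last by nra.
  (* Property (I) bounds [f2] from below only after multiplication by [|y|^2]; if [y = 0] then
     [A y = 0] and [f2] vanishes. *)
  case: (Req_dec (norm y) 0) => [e|n].
    have z0 : norm z = 0.
      rewrite /z -(proj2 (T_dom T_C0 T_gen t x (Rlt_le _ _ ht) hx)) -/y (norm_eq_0 _ e).
      have -> : (zero : H) = scal (RtoC 0) zero by rewrite scal_zero_r.
      rewrite op_scal; last exact: dom_zero.
      by rewrite norm_scalR Rabs_R0 Rmult_0_l.
    have := rin_abs_le w y; rewrite e z0 Rmult_0_r => /Rabs_le_between; lra.
  have p : 0 < norm y ^ 2 by nra.
  have : 0 <= (rin w y + norm z ^ 2) * norm y ^ 2 by nra.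
  nra.
Qed.

Lemma T_norm_sq_continuous s (u : H) eps : 0 <= s -> 0 < eps -> exists d, 0 < d /\
  forall y : H, norm (minus u y) < d -> Rabs (norm (T s u) ^ 2 - norm (T s y) ^ 2) < eps.
Proof.
move=> hs he.
case: (T_bounded_on T_C0 s) => M [hM1 hM].
have hu := norm_ge_0 u.
set D := M * (M * (2 * norm u + 1)) + 1.
have hD0 : 0 <= M * (M * (2 * norm u + 1)) by do 2 (apply Rmult_le_pos; first lra); lra.
have hD : 1 <= D by rewrite /D; lra.
exists (Rmin 1 (eps / D)); split; first by apply Rmin_pos; [lra|apply Rdiv_lt_0_compat; lra].
move=> y hy; move: (Rmin_l 1 (eps / D)) (Rmin_r 1 (eps / D)) => m1 m2.
have -> : norm (T s u) ^ 2 - norm (T s y) ^ 2 = (norm (T s u) - norm (T s y)) * (norm (T s u) + norm (T s y)) by ring.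
have hTu := norm_ge_0 (T s u); have hTy := norm_ge_0 (T s y).
rewrite Rabs_mult (Rabs_pos_eq (norm (T s u) + norm (T s y))); last lra.
have b1 : Rabs (norm (T s u) - norm (T s y)) <= M * norm (minus u y).
  apply (Rle_trans _ (norm (minus (T s u) (T s y)))); first exact: norm_triangle_inv.
  rewrite -(T_minus T_C0) //; apply hM; lra.
have b2 : norm (T s u) + norm (T s y) <= M * (2 * norm u + 1).
  have := hM s u ltac:(lra); have := hM s y ltac:(lra).
  have : norm y <= norm u + 1 by have := norm_minus_le y u; rewrite norm_minus_sym; lra.
  nra.
have hny := norm_ge_0 (minus u y).
apply (Rle_lt_trans _ (M * norm (minus u y) * (M * (2 * norm u + 1)))).
  apply Rmult_le_compat => //; [exact: Rabs_pos|lra].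
apply (Rle_lt_trans _ ((D - 1) * norm (minus u y))); first by right; rewrite /D; ring.
apply (Rle_lt_trans _ ((D - 1) * (eps / D))); first by apply Rmult_le_compat_l; lra.
have -> : (D - 1) * (eps / D) = eps - eps / D by field; lra.
have : 0 < eps / D by apply Rdiv_lt_0_compat; lra.
lra.
Qed.

Lemma tilt_convex_all :
  (forall x : H, dom A x -> dom A (A x) ->
     2 * (rin (A x) x) ^ 2 <= rin (A (A x)) x * norm x ^ 2 + norm (A x) ^ 2 * norm x ^ 2) ->
  forall u, tilt_convex (fun t => norm (T t u) ^ 2).
Proof.
move=> hI u k r s t hr hrs hst.
apply Rnot_lt_le => hlt.
set L := (t - s) * (exp (k * r) * norm (T r u) ^ 2) + (s - r) * (exp (k * t) * norm (T t u) ^ 2) in hlt.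
(* The sum of the three weights: an error [eps] in each squared norm shifts the inequality by less
   than [E * eps = gap / 2]. *)
set E := (t - r) * exp (k * s) + (t - s) * exp (k * r) + (s - r) * exp (k * t).
have c1 : 0 < (t - r) * exp (k * s) by apply Rmult_lt_0_compat; [lra|exact: exp_pos].
have c2 : 0 < (t - s) * exp (k * r) by apply Rmult_lt_0_compat; [lra|exact: exp_pos].
have c3 : 0 < (s - r) * exp (k * t) by apply Rmult_lt_0_compat; [lra|exact: exp_pos].
have hE : 0 < E by rewrite /E; lra.
set gap := (t - r) * (exp (k * s) * norm (T s u) ^ 2) - L.
have hgap : 0 < gap by rewrite /gap; lra.
set eps := gap / (2 * E).
have he : 0 < eps by apply Rdiv_lt_0_compat; lra.
case: (T_norm_sq_continuous r u eps hr he) => d1 [hd1 b1].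
case: (T_norm_sq_continuous s u eps ltac:(lra) he) => d2 [hd2 b2].
case: (T_norm_sq_continuous t u eps ltac:(lra) he) => d3 [hd3 b3].
have hd : 0 < Rmin d1 (Rmin d2 d3) by repeat apply Rmin_pos.
case: (dom2_dense A_dense K_ge_1 hQ u _ hd) => y [hy [hAy hyu]].
have [l1 [l2 l3]] : norm (minus u y) < d1 /\ norm (minus u y) < d2 /\ norm (minus u y) < d3.
  move: (Rmin_l d1 (Rmin d2 d3)) (Rmin_r d1 (Rmin d2 d3)) (Rmin_l d2 d3) (Rmin_r d2 d3); lra.
move: (b1 y l1) (b2 y l2) (b3 y l3) => /Rabs_def2 [x1 x1'] /Rabs_def2 [x2 x2'] /Rabs_def2 [x3 x3'].
have := tilt_convex_dom2 y hI hy hAy k r s t hr hrs hst => hyc.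
have e1 : E * eps = gap / 2 by rewrite /eps; field; lra.
have := Rmult_lt_compat_l _ _ _ c1 x2; have := Rmult_lt_compat_l _ _ _ c2 x1'; have := Rmult_lt_compat_l _ _ _ c3 x3'.
rewrite /E in e1; rewrite /gap /L in e1 hgap; lra.
Qed.

Lemma property_I_of_log_convex :
  (forall u, u <> zero -> log_convex (fun t => norm (T t u))) ->
  forall x : H, dom A x -> dom A (A x) ->
     2 * (rin (A x) x) ^ 2 <= rin (A (A x)) x * norm x ^ 2 + norm (A x) ^ 2 * norm x ^ 2.
Proof.
move=> hII x hx hAx.
case: (excluded_middle_informative (x = zero)) => [e|n].
  have nz : norm x = 0 by rewrite e norm_zero.
  have h := rin_abs_le (A x) x; rewrite nz Rmult_0_r in h.
  have /Rabs_le_between h' := h; have -> : rin (A x) x = 0 by lra.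
  rewrite nz; lra.
have hn := norm_pos x n.
have tc := log_convex_tilt_sq _ (fun t _ => norm_ge_0 (T t x)) (hII x n).
have := tilt_convex_deriv_at_0 (fun t => norm (T t x) ^ 2) (f1 x) (f2 x 0) _ tc
  (fun t ht => norm_sq_hderiv T_C0 T_gen x t ht hx) (f1_hderiv x 0 (Rle_refl _) hx hAx).
rewrite /f1 /f2 !(C0_zero _ T_C0) rin_norm => /(_ ltac:(nra)); nra.
Qed.

Section Accretive.
Context (m : R) (hm : 0 < m) (A_accr : forall x, dom A x -> m * norm x ^ 2 <= rin (A x) x).

(** On [D(A)] accretivity makes the derivative of [exp (2 m t) * norm (T t x) ^ 2] nonpositive;
    density and local boundedness of [T] extend the bound to [H]. *)
Lemma T_contraction t u : 0 <= t -> norm (T t u) <= exp (- (m * t)) * norm u.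
Proof.
move=> ht.
case: (Req_dec t 0) => [->|nt].
  rewrite (C0_zero _ T_C0) Rmult_0_r Ropp_0 exp_0; lra.
have on_dom x : dom A x -> norm (T t x) <= exp (- (m * t)) * norm x.
  move=> hx.
  have hd s : 0 <= s -> hderiv (fun s => exp (2 * m * s) * norm (T s x) ^ 2) s
      (exp (2 * m * s) * (2 * m * norm (T s x) ^ 2 + - 2 * rin (T s (A x)) (T s x))).
    by move=> hs; apply (hderiv_exp_mult (2 * m)), (norm_sq_hderiv T_C0 T_gen).
  case: (MVT_half_line _ _ 0 t (Rle_refl _) ltac:(lra) (fun s hs => hd s (Rlt_le _ _ (proj1 hs)))
     (fun s hs => hderiv_hcont _ _ _ (hd s hs))) => c [hc].
  rewrite (C0_zero _ T_C0) Rmult_0_r exp_0 => e.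
  case: (T_dom T_C0 T_gen c x ltac:(lra) hx) => d1 e1.
  have := A_accr _ d1; rewrite e1 => hac.
  have hexp := exp_pos (2 * m * c).
  have h1 : exp (2 * m * t) * norm (T t x) ^ 2 <= norm x ^ 2.
    have : exp (2 * m * c) * (2 * m * norm (T c x) ^ 2 + - 2 * rin (T c (A x)) (T c x)) <= 0.
      have : 0 <= exp (2 * m * c) * (2 * (rin (T c (A x)) (T c x) - m * norm (T c x) ^ 2)).
        apply Rmult_le_pos; lra.
      lra.
    nra.
  set E := exp (m * t).
  have hE : 0 < E by apply exp_pos.
  have e2 : exp (2 * m * t) = E ^ 2 by rewrite /E /= Rmult_1_r -exp_plus; f_equal; ring.
  have h2 : E * norm (T t x) <= norm x.
    rewrite e2 in h1; have := norm_ge_0 x; have : 0 <= E * norm (T t x) by apply Rmult_le_pos; [lra|exact: norm_ge_0].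
    nra.
  have e3 : exp (- (m * t)) * E = 1 by rewrite /E -exp_plus Rplus_opp_l exp_0.
  have := Rmult_le_compat_l _ _ _ (Rlt_le _ _ (exp_pos (- (m * t)))) h2.
  rewrite -Rmult_assoc e3; lra.
apply Rnot_lt_le => hlt.
case: (T_bounded_on T_C0 t) => M [hM1 hM].
set gap := norm (T t u) - exp (- (m * t)) * norm u.
have hexp := exp_pos (- (m * t)).
case: (A_dense u (gap / (M + exp (- (m * t))))) => [|y [hy hyu]].
  apply Rdiv_lt_0_compat; rewrite /gap; lra.
have h1 := on_dom y hy.
have h2 := norm_minus_le (T t u) (T t y); rewrite -(T_minus T_C0) // in h2.
have h3 := hM t (minus u y) ltac:(lra).
have h4 : norm y <= norm u + norm (minus u y) by have := norm_minus_le y u; rewrite norm_minus_sym.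
have h5 := Rmult_le_compat_l _ _ _ (Rlt_le _ _ hexp) h4.
have h6 : (M + exp (- (m * t))) * norm (minus u y) < gap.
  apply (Rlt_le_trans _ ((M + exp (- (m * t))) * (gap / (M + exp (- (m * t)))))).
    apply Rmult_lt_compat_l; lra.
  right; field; lra.
rewrite /gap in h6; lra.
Qed.

Context (hII : forall u, u <> zero -> log_convex (fun t => norm (T t u))).

(** Backward uniqueness: a zero at [t] as right endpoint in the log-convexity inequality makes the
    orbit vanish on all of []0, t[], against continuity at [0]. *)
Lemma orbit_positive u : u <> zero -> strictly_positive (fun t => norm (T t u)).
Proof.
move=> hu t ht.
case: (norm_ge_0 (T t u)) => // e; exfalso.
have hu0 := norm_pos u hu.
case: (Req_dec t 0) => [t0|nt]; first by rewrite t0 (C0_zero _ T_C0) in e; lra.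
have z s : 0 < s < t -> norm (T s u) = 0.
  move=> hs; have := hII u hu 0 s t (Rle_refl _) (proj1 hs) (proj2 hs).
  rewrite -e {2}/rpow; case: Req_EM_T => // _; rewrite Rmult_0_r; have := norm_ge_0 (T s u); lra.
case: (T_norm_hcont u 0 (Rle_refl _) (norm u) hu0) => d [hd hb].
have hmn : 0 < Rmin d t by apply Rmin_pos; lra.
move: (Rmin_l d t) (Rmin_r d t) => m1 m2.
have := hb (Rmin d t / 2) ltac:(lra).
rewrite (z (Rmin d t / 2)) ?(C0_zero _ T_C0); last lra.
rewrite !Rminus_0_r Rminus_0_l Rabs_Ropp !Rabs_pos_eq; try lra.
Qed.

Lemma orbit_decreasing u : u <> zero -> strictly_decreasing (fun t => norm (T t u)).
Proof.
move=> hu s t hs hst.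
have -> : t = (t - s) + s by ring.
rewrite (T_add T_C0); [|lra|lra].
have h1 := T_contraction (t - s) (T s u) ltac:(lra).
have h2 := orbit_positive u hu s hs.
have h3 : exp (- (m * (t - s))) < 1.
  rewrite -exp_0; apply exp_increasing; have := Rmult_lt_0_compat m (t - s) hm; lra.
nra.
Qed.

(** The endpoint values differ because the orbit norm is strictly decreasing, so their weighted
    geometric mean is strictly below the arithmetic one. *)
Lemma orbit_strictly_convex u : u <> zero -> strictly_convex (fun t => norm (T t u)).
Proof.
move=> hu.
have wlog p q c : 0 <= p -> p < q -> 0 < c < 1 ->
    norm (T (c * p + (1 - c) * q) u) < c * norm (T p u) + (1 - c) * norm (T q u).
  move=> hp hpq hc.
  have hpos := orbit_positive u hu.
  have pp := hpos p hp; have pq := hpos q ltac:(lra).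
  have hdec := orbit_decreasing u hu p q hp hpq.
  have := hII u hu p (c * p + (1 - c) * q) q hp ltac:(nra) ltac:(nra).
  have -> : (q - (c * p + (1 - c) * q)) / (q - p) = c by field; lra.
  have -> : (c * p + (1 - c) * q - p) / (q - p) = 1 - c by field; lra.
  rewrite /rpow; case: Req_EM_T => [e|_]; first lra. case: Req_EM_T => [e|_]; first lra.
  rewrite /Rpower -exp_plus => hle.
  apply (Rle_lt_trans _ _ _ hle).
  have := exp_strictly_convex c (1 - c) (ln (norm (T p u))) (ln (norm (T q u))) ltac:(lra) ltac:(lra) ltac:(lra).
  rewrite !exp_ln //; apply => e; have := ln_inv _ _ pp pq e; lra.
move=> s t a hs ht hst ha.
case: (Rtotal_order s t) => [h|[h|h]]; [exact: wlog|by []|].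
have := wlog t s (1 - a) ht h ltac:(lra).
have -> : (1 - a) * t + (1 - (1 - a)) * s = a * s + (1 - a) * t by ring.
lra.
Qed.

Lemma orbit_hconvex u : u <> zero -> hconvex (fun t => norm (T t u)).
Proof.
move=> hu r s t hr hrs hst.
have ha : 0 < (t - s) / (t - r) < 1.
  split; first by apply Rdiv_lt_0_compat; lra.
  apply (Rmult_lt_reg_r (t - r)); first lra. rewrite /Rdiv Rmult_assoc Rinv_l; lra.
have := orbit_strictly_convex u hu r t _ hr ltac:(lra) ltac:(lra) ha.
have -> : (t - s) / (t - r) * r + (1 - (t - s) / (t - r)) * t = s by field; lra.
move=> h; have := Rmult_lt_compat_l (t - r) _ _ ltac:(lra) h.
have -> : (t - r) * ((t - s) / (t - r) * norm (T r u) + (1 - (t - s) / (t - r)) * norm (T t u)) =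
  (t - s) * norm (T r u) + (s - r) * norm (T t u) by field; lra.
lra.
Qed.

Lemma orbit_slope_inf_le u : norm u = 1 -> Rbar_le (slope_inf (fun t => norm (T t u))) (Finite (- m)).
Proof.
move=> hu.
(* [exp (- m t) <= 1 / (1 + m t)] bounds the slope over [[0, t]], and the bound tends to [- m] as
   [t] tends to [0]. *)
have hle t : 0 < t -> Rbar_le (slope_inf (fun t => norm (T t u))) (Finite (- m / (1 + m * t))).
  move=> ht; have hmt : 0 < m * t by apply Rmult_lt_0_compat.
  apply (Rbar_le_trans _ _ _ (slope_inf_le _ t ht)); rewrite /= (C0_zero _ T_C0) hu.
  have := T_contraction t u (Rlt_le _ _ ht); rewrite hu Rmult_1_r => h1.
  have e1 := exp_ineq1_le (m * t).
  have e2 : exp (- (m * t)) * exp (m * t) = 1 by rewrite -exp_plus Rplus_opp_l exp_0.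
  have p := exp_pos (- (m * t)).
  have h2 : exp (- (m * t)) * (1 + m * t) <= 1 by nra.
  apply (Rmult_le_reg_r (t * (1 + m * t))); first by apply Rmult_lt_0_compat; lra.
  have -> : (norm (T t u) - 1) / t * (t * (1 + m * t)) = (norm (T t u) - 1) * (1 + m * t) by field; lra.
  have -> : - m / (1 + m * t) * (t * (1 + m * t)) = - (m * t) by field; lra.
  nra.
move: hle; case: slope_inf => [d| |] hle //=; last by have := hle 1 Rlt_0_1.
apply Rnot_lt_le => hlt.
(* With [m t (m + 1) = d + m], the inequality [d (1 + m t) <= - m] reads [m t (m + 1 + d) <= 0],
   impossible for [d > - m]. *)
set t := (d + m) / (m * (m + 1)).
have ht : 0 < t by apply Rdiv_lt_0_compat; [lra|apply Rmult_lt_0_compat; lra].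
have := hle t ht; rewrite /= => h1.
have hmt : 0 < m * t by apply Rmult_lt_0_compat.
have h2 : d * (1 + m * t) <= - m.
  have := Rmult_le_compat_r (1 + m * t) _ _ ltac:(lra) h1.
  by have -> : - m / (1 + m * t) * (1 + m * t) = - m by field; lra.
have e : m * t * (m + 1) = d + m by rewrite /t; field; lra.
nra.
Qed.

Lemma sqrt_norm_sq (x : H) : sqrt (norm x ^ 2) = norm x.
Proof. rewrite sqrt_pow2 //; exact: norm_ge_0. Qed.

Lemma orbit_norm_hderiv x t : 0 <= t -> dom A x -> x <> zero ->
  hderiv (fun s => norm (T s x)) t (- rin (T t (A x)) (T t x) / norm (T t x)).
Proof.
move=> ht hx hx0.
have hp := orbit_positive x hx0 t ht; rewrite /= in hp.
have hs : is_derive sqrt (norm (T t x) ^ 2) (/ (2 * norm (T t x))).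
  rewrite -{2}(sqrt_norm_sq (T t x)).
  apply is_derive_Reals, derivable_pt_lim_sqrt; nra.
have := hderiv_comp sqrt _ t _ _ (norm_sq_hderiv T_C0 T_gen x t ht hx) hs.
move=> hd eps he; case: (hd eps he) => d [hd0 hb]; exists d; split=> // s hs0 hsd.
have := hb s hs0 hsd; rewrite !sqrt_norm_sq.
have -> : / (2 * norm (T t x)) * (- 2 * rin (T t (A x)) (T t x)) = - rin (T t (A x)) (T t x) / norm (T t x) by field; lra.
done.
Qed.

(** Vectors already smoothed by the semigroup: a class inside the domain of every power of [A],
    stable under [A], on which orbits can be differentiated indefinitely. *)
Definition in_range (x : H) : Prop := exists s w, 0 < s /\ x = T s w.

(** Half of the time is spent on entering the domain: [A (T s w) = T (s/2) (A (T (s/2) w))]. *)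
Lemma in_range_dom x : in_range x -> dom A x /\ in_range (A x).
Proof.
case=> s [w [hs ->]]; split; first exact: (T_smoothing T_C0 T_gen A_dense A_closed K_ge_1 hQ).
have hd := T_smoothing T_C0 T_gen A_dense A_closed K_ge_1 hQ (s / 2) w ltac:(lra).
exists (s / 2), (A (T (s / 2) w)); split; first lra.
have {1}-> : s = s / 2 + s / 2 by field.
rewrite (T_add T_C0); [|lra|lra].
exact: (proj2 (T_dom T_C0 T_gen (s / 2) _ ltac:(lra) hd)).
Qed.

Context (v : H) (v_range : in_range v) (v_nz : v <> zero).

(* On [0 < t] this algebra is closed under differentiation, and it contains [norm (T t v)] as
   [(T t v | T t v) / norm (T t v)]. *)
Inductive orbit_algebra : (R -> R) -> Prop :=
| oa_rin x y : in_range x -> in_range y -> orbit_algebra (fun t => rin (T t x) (T t y))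
| oa_inv : orbit_algebra (fun t => / norm (T t v))
| oa_scal c f : orbit_algebra f -> orbit_algebra (fun t => c * f t)
| oa_plus f g : orbit_algebra f -> orbit_algebra g -> orbit_algebra (fun t => f t + g t)
| oa_mult f g : orbit_algebra f -> orbit_algebra g -> orbit_algebra (fun t => f t * g t).

Lemma orbit_algebra_derive f : orbit_algebra f ->
  exists g, orbit_algebra g /\ forall t, 0 < t -> is_derive f t (g t).
Proof.
elim=> {f} [x y hx hy||c f _ [g [hg hd]]|f1' f2' h1 [g1 [hg1 hd1]] h2 [g2 [hg2 hd2]]|f1' f2' h1 [g1 [hg1 hd1]] h2 [g2 [hg2 hd2]]].
- case: (in_range_dom x hx) => dx rx; case: (in_range_dom y hy) => dy ry.
  exists (fun t => - 1 * rin (T t (A x)) (T t y) + - 1 * rin (T t x) (T t (A y))); split.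
    by apply oa_plus; apply oa_scal; apply oa_rin.
  move=> t ht; apply hderiv_is_derive => //.
  apply: hderiv_eq (T_hderiv_rin T_C0 T_gen x y t (Rlt_le _ _ ht) dx dy); ring.
- case: (in_range_dom v v_range) => dv rv.
  exists (fun t => rin (T t (A v)) (T t v) * (/ norm (T t v) * (/ norm (T t v) * / norm (T t v)))); split.
    by repeat apply oa_mult; try apply oa_inv; apply oa_rin.
  move=> t ht; have hp := orbit_positive v v_nz t (Rlt_le _ _ ht); rewrite /= in hp.
  have hd := hderiv_is_derive _ _ _ ht (orbit_norm_hderiv v t (Rlt_le _ _ ht) dv v_nz).
  have hn : norm (T t v) <> 0 by lra.
  have hi := is_derive_inv _ t _ hd hn.
  apply: (is_derive_val _ _ _ _ _ hi); rewrite /=; field; exact: hn.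
- exists (fun t => c * g t); split; first exact: oa_scal.
  move=> t ht; apply (is_derive_scal f t c); exact: hd.
- exists (fun t => g1 t + g2 t); split; first exact: oa_plus.
  move=> t ht; apply: (is_derive_plus f1' f2'); [exact: hd1|exact: hd2].
- exists (fun t => g1 t * f2' t + f1' t * g2 t); split; first by apply oa_plus; apply oa_mult.
  move=> t ht; exact: (is_derive_mult _ _ t _ _ (hd1 t ht) (hd2 t ht) Rmult_comm).
Qed.

Lemma locally_pos t : 0 < t -> locally t (fun s => 0 < s).
Proof.
move=> ht; exists (mkposreal t ht) => s; rewrite /ball /= /AbsRing_ball /abs /minus /plus /opp /= => /Rabs_def2; lra.
Qed.

Lemma orbit_algebra_Derive_n f n : orbit_algebra f ->
  exists g, orbit_algebra g /\ forall t, 0 < t -> Derive_n f n t = g t.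
Proof.
move=> hf; elim: n => [|n [g [hg e]]]; first by exists f.
case: (orbit_algebra_derive g hg) => g' [hg' hd]; exists g'; split=> // t ht /=.
rewrite (Derive_ext_loc _ g); first exact: is_derive_unique (hd t ht).
case: (locally_pos t ht) => d hd'; exists d => s hs; exact/e/hd'.
Qed.

Lemma orbit_algebra_ex_derive_n f n t : orbit_algebra f -> 0 < t -> ex_derive_n f n t.
Proof.
move=> hf ht; case: n => [//|n] /=.
case: (orbit_algebra_Derive_n f n hf) => g [hg e].
case: (orbit_algebra_derive g hg) => g' [_ hd].
apply (ex_derive_ext_loc g); last by exists (g' t); exact: hd.
case: (locally_pos t ht) => d hd'; exists d => s hs; exact/eq_sym/e/hd'.
Qed.

Lemma range_orbit_smooth n t : 0 < t -> ex_derive_n (fun s => norm (T s v)) n t.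
Proof.
move=> ht.
apply (ex_derive_n_ext_loc (fun s => rin (T s v) (T s v) * / norm (T s v))).
  case: (locally_pos t ht) => d hd; exists d => s hs.
  have := orbit_positive v v_nz s (Rlt_le _ _ (hd s hs)); rewrite rin_norm /= => hp; field; lra.
apply orbit_algebra_ex_derive_n => //.
by apply oa_mult; [apply oa_rin|apply oa_inv].
Qed.

End Accretive.

(** Near [t] the orbit of [u] is the orbit of [T (t / 2) u] shifted by [t / 2], and that vector is
    in the range and nonzero. *)
Lemma orbit_smooth m u : 0 < m -> (forall x, dom A x -> m * norm x ^ 2 <= rin (A x) x) ->
  (forall u, u <> zero -> log_convex (fun t => norm (T t u))) -> u <> zero ->
  smooth_pos (fun t => norm (T t u)).
Proof.
move=> hm hA hII hu n t ht.
have hv : T (t / 2) u <> zero.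
  move=> e; have := orbit_positive hII u hu (t / 2) ltac:(lra); rewrite e norm_zero; lra.
have hr : in_range (T (t / 2) u) by exists (t / 2), u; split=> //; lra.
apply (ex_derive_n_ext_loc (fun s => norm (T (s + - (t / 2)) (T (t / 2) u)))).
  have ht2 : 0 < t / 2 by lra.
  exists (mkposreal _ ht2) => s; rewrite /ball /= /AbsRing_ball /abs /minus /plus /opp /= => /Rabs_def2 hs.
  rewrite -(T_add T_C0); [|lra|lra]. by have -> : s + - (t / 2) + t / 2 = s by ring.
apply (ex_derive_n_comp_trans (fun s => norm (T s (T (t / 2) u)))).
apply (range_orbit_smooth hII) => //; lra.
Qed.

End Dynamics.

Lemma inf_Re_lb S z : S z -> Rbar_le (inf_Re S) (Finite (Re z)).
Proof. by move=> hz; apply (proj1 (Glb_Rbar_correct _)); exists z. Qed.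

Lemma inf_Re_glb S b : (forall z, S z -> Rbar_le b (Finite (Re z))) -> Rbar_le b (inf_Re S).
Proof. by move=> h; apply (proj2 (Glb_Rbar_correct _)) => r [z [hz ->]]; apply h. Qed.

Lemma Rbar_between (a : R) (b : Rbar) : Rbar_lt (Finite a) b ->
  exists c : R, a < c /\ Rbar_lt (Finite c) b.
Proof.
case: b => [b| |] //= h; last by exists (a + 1); split=> //; lra.
exists ((a + b) / 2); lra.
Qed.

(** * Equality of spectral abscissa and lower bound *)

Section LowerBound.
Context {H : HilbertSpace} {A : operator H} {T : R -> H -> H}
  (T_C0 : C0_semigroup T) (T_gen : generated_by_opp A T) (A_dense : densely_defined A)
  {K : R} {Q : C -> H -> H} (K_ge_1 : 1 <= K)
  (hQ : forall l, 0 <= Re l -> bounded_inverse A l (Q l) /\ forall y, Cmod l * norm (Q l y) <= K * norm y)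
  (H_nontrivial : exists x : H, x <> zero)
  (hII : forall u, u <> zero -> log_convex (fun t => norm (T t u))).

Lemma lower_bound_accretive (mu : R) : Rbar_le (Finite mu) (lower_bound A) ->
  forall x, dom A x -> mu * norm x ^ 2 <= rin (A x) x.
Proof.
move=> hmu x hx.
case: (excluded_middle_informative (x = zero)) => [e|n].
  have nz : norm x = 0 by rewrite e norm_zero.
  have h := rin_abs_le (A x) x; rewrite nz Rmult_0_r in h.
  have /Rabs_le_between h' := h; rewrite nz; lra.
have hn := norm_pos x n.
set c := / norm x; have hc : 0 < c by apply Rinv_0_lt_compat.
have hy : numerical_range A (inner (A (scal (RtoC c) x)) (scal (RtoC c) x)).
  exists (scal (RtoC c) x); split; first exact: dom_scal.
  split=> //; rewrite norm_scalR Rabs_pos_eq; last lra.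
  rewrite /c Rinv_l //; lra.
have := Rbar_le_trans _ _ _ hmu (inf_Re_lb _ _ hy).
rewrite /= -/(rin _ _) op_scal // rin_scal_l rin_scal_r => h.
have e : norm x ^ 2 * (c * (c * rin (A x) x)) = rin (A x) x by rewrite /c; field; lra.
have := Rmult_le_compat_l (norm x ^ 2) _ _ ltac:(nra) h; rewrite e; lra.
Qed.

Lemma accretive_lower_bound (mu : R) : (forall x, dom A x -> mu * norm x ^ 2 <= rin (A x) x) ->
  Rbar_le (Finite mu) (lower_bound A).
Proof.
move=> h; apply inf_Re_glb => z [x [hx [hn ->]]] /=.
have := h x hx; rewrite hn /rin; lra.
Qed.

Lemma numerical_range_nonempty : exists z, numerical_range A z.
Proof.
case: H_nontrivial => x hx; have hn := norm_pos x hx.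
case: (A_dense x _ hn) => y [hy hxy].
have hny : 0 < norm y.
  apply norm_pos => e; rewrite e in hxy.
  have e2 : minus x zero = x by hvec.
  rewrite e2 in hxy; lra.
exists (inner (A (scal (RtoC (/ norm y)) y)) (scal (RtoC (/ norm y)) y)), (scal (RtoC (/ norm y)) y).
split; first exact: dom_scal.
split=> //; rewrite norm_scalR Rabs_pos_eq; last exact/Rlt_le/Rinv_0_lt_compat.
rewrite Rinv_l //; lra.
Qed.

(** The strip of resolvent points next to the imaginary axis gives a positive lower estimate through
    [log_convex_accretive]; a single point of the numerical range excludes plus infinity. *)
Lemma lower_bound_real : exists m : R, 0 < m /\ lower_bound A = Finite m /\
  forall x, dom A x -> m * norm x ^ 2 <= rin (A x) x.
Proof.
case: (resolvent_set_near_axis hQ) => e [he hres].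
have hacc := log_convex_accretive K_ge_1 hQ T_C0 T_gen A_dense e hII he hres.
have h1 := accretive_lower_bound e hacc.
case: numerical_range_nonempty => z hz.
have h2 := inf_Re_lb _ _ hz; rewrite -/(lower_bound A) in h2.
have h3 := lower_bound_accretive.
move: h1 h2 h3; case: (lower_bound A) => [m| |] //= h1 h2 h3.
exists m; split; first lra. split=> //; apply h3; lra.
Qed.

Lemma spectral_abscissa_eq_lower_bound : spectral_abscissa A = lower_bound A.
Proof.
apply Rbar_le_antisym.
  apply inf_Re_glb => z [x [hx [hn ->]]]; apply Rbar_not_lt_le => hlt.
  case: (Rbar_between _ _ hlt) => mu0 [hmu0 hmu0s].
  case: (resolvent_set_near_axis hQ) => e [he hres].
  have [mu [hmu [hqmu hmures]]] : exists mu, 0 < mu /\ Re (inner (A x) x) < mu /\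
      forall z, Re z <= mu -> resolvent_set A z.
    (* [mu0] lies between [Re(Ax|x)] and the spectral abscissa but may be negative; the maximum with
       [e] is a positive rate, and the points up to [e] are covered by the strip. *)
    exists (Rmax e mu0); move: (Rmax_l e mu0) (Rmax_r e mu0) => m1 m2; split; first lra.
    split; first lra. move=> w hw; case: (Rle_lt_dec (Re w) e) => hwe; first exact: hres.
    apply NNPP => hspec; have := Rbar_lt_le_trans _ _ _ hmu0s (inf_Re_lb (spectrum A) w hspec).
    rewrite /=; move: hw; rewrite /Rmax; case: Rle_dec => _; lra.
  have := log_convex_accretive K_ge_1 hQ T_C0 T_gen A_dense mu hII hmu hmures x hx.
  rewrite hn /rin; lra.
apply inf_Re_glb => z hz; apply Rbar_not_lt_le => hlt.
case: (Rbar_between _ _ hlt) => mu [hmu hmul]; apply hz.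
apply (accretive_resolvent_set hQ mu) => //.
exact/lower_bound_accretive/Rbar_lt_le.
Qed.

End LowerBound.

Theorem theorem3p4 (H : HilbertSpace) (H_nontrivial : exists x : H, x <> zero)
  (A : operator H) (A_generates : generates_bounded_holomorphic A)
  (T : R -> H -> H) (T_C0 : C0_semigroup T) (T_gen : generated_by_opp A T) :
  let property_I :=
    forall x : H, dom A x -> dom A (A x) ->
      2 * (Re (inner (A x) x)) ^ 2
      <= Re (inner (A (A x)) x) * norm x ^ 2 + norm (A x) ^ 2 * norm x ^ 2 in
  let property_II :=
    forall u0 : H, u0 <> zero -> log_convex (fun t => norm (T t u0)) in
  (property_I <-> property_II) /\
  (property_I /\ property_II ->
    (* (a) *)
    (forall u0 : H, u0 <> zero ->
       let h := fun t => norm (T t u0) in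
       strictly_positive h /\ strictly_decreasing h /\ strictly_convex h /\
       exists d : Rbar, right_derivative0 h d /\ Rbar_lt d (Finite 0)) /\
    (* (b) *)
    (forall u0 : H, norm u0 = 1 ->
       let h := fun t => norm (T t u0) in
       (forall t : R, 0 < t -> ex_derive h t) /\
       exists d : Rbar, right_derivative0 h d /\
         d = Glb_Rbar (fun y => exists t : R, 0 < t /\ y = Derive h t) /\
         Rbar_le d (Rbar_opp (lower_bound A)) /\
         Rbar_lt (Rbar_opp (lower_bound A)) (Finite 0)) /\
    (* (c) *)
    (forall u0 : H, dom A u0 -> norm u0 = 1 ->
       let h := fun t => norm (T t u0) in
       (exists dh : R -> R, C1_with h dh /\ dh 0 = - Re (inner (A u0) u0)) /\
       smooth_pos h) /\
    (* (d) *)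
    (spectral_abscissa A = lower_bound A /\
     Rbar_lt (Finite 0) (lower_bound A) /\
     strictly_accretive A)).
Proof.
move=> property_I property_II.
have A_dense : densely_defined A := proj1 A_generates.
have A_closed : closed_operator A := proj1 (proj2 A_generates).
case: (generates_half_plane A A_generates) => K [Q [K_ge_1 hQ]].
have hQ0 := closed_half_plane_open hQ.
split.
  split.
    move=> hI u _; apply log_convex_sq; first by move=> t _; exact: norm_ge_0.
    apply tilt_convex_log_convex; first by move=> t _; exact: pow2_ge_0.
    exact: (tilt_convex_all T_C0 T_gen A_dense K_ge_1 hQ0 hI).
  exact: (property_I_of_log_convex T_C0 T_gen).
move=> [_ hII].
case: (lower_bound_real T_C0 T_gen A_dense K_ge_1 hQ H_nontrivial hII) => m [hm [em hacc]].
have nz1 (u : H) : norm u = 1 -> u <> zero by move=> e z; rewrite z norm_zero in e; lra.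
have pos := orbit_positive T_C0 hII.
have dec := orbit_decreasing T_C0 T_gen A_dense m hm hacc hII.
have conv := orbit_hconvex T_C0 T_gen A_dense m hm hacc hII.
have smooth u : u <> zero -> smooth_pos (fun t => norm (T t u)).
  exact: (orbit_smooth T_C0 T_gen A_dense A_closed K_ge_1 hQ0 m u hm hacc hII).
split.
  move=> u hu h; split; first exact: pos. split; first exact: dec.
  split; first exact: (orbit_strictly_convex T_C0 T_gen A_dense m hm hacc hII).
  exists (slope_inf h); split; first exact/slope_inf_right_derivative/conv.
  (* The infimum of the slopes is at most the slope over [[0, 1]], which is negative by strict
     decrease. *)
  apply (Rbar_le_lt_trans _ _ _ (slope_inf_le h 1 Rlt_0_1)); rewrite /=.
  have := dec u hu 0 1 (Rle_refl _) Rlt_0_1; rewrite /h; lra.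
split.
  move=> u hu h; have hu0 := nz1 u hu.
  have hd t : 0 < t -> ex_derive h t by move=> ht; exact: (smooth u hu0 1%nat t ht).
  split=> //.
  exists (slope_inf h); split; first exact/slope_inf_right_derivative/conv.
  split; first by apply slope_inf_Derive => //; [exact: conv|exact: (T_norm_hcont T_C0)].
  rewrite em /=; split; last lra.
  exact: (orbit_slope_inf_le T_C0 T_gen A_dense m hm hacc).
split.
  move=> u hu hn h; have hu0 := nz1 u hn.
  split; last exact: smooth.
  have hd t : 0 <= t -> hderiv h t (- rin (T t (A u)) (T t u) / norm (T t u)).
    by move=> ht; apply (orbit_norm_hderiv T_C0 T_gen hII).
  exists (fun t => - rin (T t (A u)) (T t u) / norm (T t u)); split; last first.
    rewrite !(C0_zero _ T_C0) hn /rin; field.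
  split; first by move=> t ht; apply hderiv_is_derive => //; apply hd; lra.
  split; first exact/hderiv_right/hd/Rle_refl.
  move=> t ht.
  have hcn : hcont (fun s => - rin (T s (A u)) (T s u) / norm (T s u)) t.
    apply (hcont_mult (fun s => - rin (T s (A u)) (T s u)) (fun s => / norm (T s u))).
      apply (hcont_comp Ropp (fun s => rin (T s (A u)) (T s u))).
        by apply (hcont_rin (fun s => T s (A u)) (fun s => T s u)); apply (T_vcont T_C0).
      apply derivable_continuous_pt, derivable_pt_opp, derivable_pt_id.
    apply (hcont_comp Rinv (fun s => norm (T s u))); first exact: (T_norm_hcont T_C0).
    apply derivable_continuous_pt, derivable_pt_inv; last exact: derivable_pt_id.
    have := pos u hu0 t ht; rewrite /id /=; lra.
  apply filterlim_locally => eps.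
  case: (hcn eps (cond_pos eps)) => d [hd0 hb].
  exists (mkposreal d hd0) => s hs hs0; exact: hb.
split; first exact: (spectral_abscissa_eq_lower_bound T_C0 T_gen A_dense K_ge_1 hQ hII).
by rewrite /strictly_accretive em.
Qed.
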